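(* Suppose $f\in L^{\infty}(0,\infty;L^2(\Omega))$ and $u_0\in H^1(\Omega)$. Denote $\alpha:=1+\nu\lambda^{-2}\Delta t$. For any $\Delta t>0$, the solutions of the backward Euler velocity-vorticity algorithm (described in the context) satisfy, for every positive integer $n$, $$\|\nabla u_h^{n}\|^2\le\left(\frac1\alpha\right)^n\|\nabla u_h^0\|^2+\left(2\nu^{-1}\|f\|^2_{L^\infty(0,\infty;L^2(\Omega))}+C\nu^{-3}C_1^4C_0^2\right)\frac{\alpha\lambda^2}{\nu}=:C_2^2$$ and $$\|\nabla u_h^{n}\|^2\le\left(\frac1\alpha\right)^n\|\nabla u_h^0\|^2+2\,\frac{\alpha\lambda^2}{\nu^2}\|f\|^2_{L^\infty(0,\infty;L^2(\Omega))}+C(1+|\ln h|)\,\nu^{-2}C_1^2C_0^2=:\widetilde C_2^2,$$ where $C_0,C_1$ are given by $$C_0^2:=\left(\frac1\alpha\right)^n\|u_h^0\|^2+\frac{2\alpha\lambda^2}{\nu^2}\|f\|^2_{L^\infty(0,\infty;V_h^* )},\qquad C_1^2:=\left(\frac1\alpha\right)^n\|w_h^0\|^2+\frac{2\alpha\lambda^2}{\nu^2}\|f\|^2_{L^\infty(0,\infty;L^2(\Omega))},$$ and $C$ is a generic constant, which depends on the optimal constants of Sobolev's embedding inequalities and the constants of the Agmon-type inequalities listed in the context.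
   Context: Setting. $\Omega=(0,2\pi)^2\subset\mathbb{R}^2$ with periodic boundary conditions; all functions (including $f$ and $u_0$) are $2\pi$-periodic in each direction with zero mean. $(\cdot,\cdot)$ and $\|\cdot\|$ are the $L^2(\Omega)$ inner product and norm. $X=H^1_\#(\Omega)^2$, $Q=L^2_\#(\Omega)$, $Y=H^1_\#(\Omega)$, where $\#$ denotes $2\pi$-periodic functions of zero mean ($X$ is vector valued; $Q$, $Y$ scalar valued). Discretization. $\tau_h$ is a regular, conforming triangulation of $\Omega$ of mesh size $h$, compatible with the periodic boundary conditions; $X_h\subset X$, $Q_h\subset Q$, $Y_h\subset Y$ are piecewise polynomial finite element spaces on $\tau_h$, with $(X_h,Q_h)$ inf-sup stable. $V_h=\{v_h\in X_h:(\nabla\cdot v_h,q_h)=0\ \forall q_h\in Q_h\}$; $V_h^*$ is its dual, with norm $\|f\|_{V_h^*}=\sup_{0\neq v_h\in V_h}(f,v_h)/\|\nabla v_h\|$. $\lambda$ is a constant, depending only on $\Omega$, in the Poincaré inequality $\|\phi\|\le\lambda\|\nabla\phi\|$ (for $\phi\in X$ and for $\phi\in Y$). Discrete operators. For $\phi\in H^1(\Omega)$, $\Delta_h\phi\in Y_h$ is defined by $(\Delta_h\phi,v_h)=-(\nabla\phi,\nabla v_h)$ for all $v_h\in Y_h$, and the discrete Stokes operator $A_h\phi\in V_h$ by $(A_h\phi,v_h)=(\nabla\phi,\nabla v_h)$ for all $v_h\in V_h$. Agmon-type inequalities used in this setting, with constants $C$ independent of $h$: $\|v_h\|_{L^\infty}\le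 C\|v_h\|^{1/2}\|A_hv_h\|^{1/2}$ for $v_h\in V_h$; and $\|z_h\|_{L^\infty}\le C\|z_h\|^{1/2}\|\Delta_hz_h\|^{1/2}$, $\|\nabla z_h\|_{L^4}\le C\|\nabla z_h\|^{1/2}\|\Delta_hz_h\|^{1/2}$, $\|\nabla z_h\|_{L^3}\le C\|z_h\|^{1/3}\|\Delta_hz_h\|^{2/3}$ for $z_h\in Y_h$. The two-dimensional finite element inverse inequality $\|v_h\|_{L^\infty}\le C(1+|\ln h|)^{1/2}\|\nabla v_h\|$ is also used. For scalar $w$ and $u=(u_1,u_2)$, $w\times u:=(-u_2w,\,u_1w)^T$. For a vector field $f=(f_1,f_2)$, $\nabla\times f=\partial_1f_2-\partial_2f_1$; for $f\in L^2$, $(\nabla\times f,\chi)$ is understood after integration by parts, i.e. as $\int_\Omega(f_1\partial_2\chi-f_2\partial_1\chi)\,dx$. The trilinear form $b^*:X_h\times Y_h\times Y_h\to\mathbb{R}$ is $b^*(u,w,\chi)=(u\cdot\nabla w,\chi)+\frac12((\nabla\cdot u)w,\chi)$. Backward Euler velocity-vorticity algorithm. $\nu>0$ is the viscosity, $\Delta t>0$ the time step, $t^n=n\Delta t$, $f^n=f(t^n)$. Given $f$ and $u_0$, let $u_h^0$ be the interpolant of $u_0$ and $w_h^0$ the interpolant of the curl of $u_0$. For $n=0,1,2,\dots$: Step 1: find $(u_h^{n+1},P_h^{n+1})\in(X_h,Q_h)$ such that for all $(v_h,q_h)\in(X_h,Q_h)$, $$\tfrac{1}{\Delta t}(u_h^{n+1}-u_h^n,v_h)+(w_h^n\times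 u_h^{n+1},v_h)-(P_h^{n+1},\nabla\cdot v_h)+\nu(\nabla u_h^{n+1},\nabla v_h)=(f^{n+1},v_h),\qquad(\nabla\cdot u_h^{n+1},q_h)=0.$$ Step 2: find $w_h^{n+1}\in Y_h$ such that for all $\chi_h\in Y_h$, $$\tfrac1{\Delta t}(w_h^{n+1}-w_h^n,\chi_h)+b^*(u_h^{n+1},w_h^{n+1},\chi_h)+\nu(\nabla w_h^{n+1},\nabla\chi_h)=(\nabla\times f^{n+1},\chi_h).$$
   Formalization: The initial velocity u_h^0 is additionally assumed discretely divergence free (in V_h), without which the first step can violate the bound; and each sampled value f(t^n), n ≥ 1, is assumed to lie in the essential range of f, since point values of an L^∞-in-time class are undefined. *)

(* Defs.v *)
From HB Require Import structures.
From mathcomp Require Import all_boot all_order all_algebra.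
From mathcomp Require Import all_classical all_reals all_analysis.
Set Implicit Arguments.
Unset Strict Implicit.
Unset Printing Implicit Defensive.
Import Order.TTheory GRing.Theory Num.Theory.
Import numFieldNormedType.Exports.
Local Open Scope classical_set_scope.
Local Open Scope ring_scope.

(* Functions on the torus are represented by 2pi-periodic functions on the
   plane and integrated over one period cell [Omega]. *)
Definition sfield (R : realType) := (R * R)%type -> R.
Definition vfield (R : realType) := (sfield R * sfield R)%type.

Notation area := (lebesgue_measure \x lebesgue_measure)%E.

Definition Omega {R : realType} : set (R * R) :=
  `]0, 2 * pi[ `*` `]0, 2 * pi[.

Lemma measurable_Omega {R : realType} : measurable (@Omega R).
Proof. by apply: measurableX; exact: measurable_itv. Qed.

Definition halfline {R : realType} : set R := `]0, +oo[.

Lemma measurable_halfline {R : realType} : measurable (@halfline R).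
Proof. exact: measurable_itv. Qed.

Definition periodic {R : realType} (phi : sfield R) : Prop :=
  forall x, phi (x.1 + 2 * pi, x.2) = phi x /\ phi (x.1, x.2 + 2 * pi) = phi x.

Definition dot {R : realType} (phi psi : sfield R) : R :=
  (\int[area]_(x in Omega) (phi x * psi x))%R.

Definition vdot {R : realType} (u v : vfield R) : R :=
  dot u.1 v.1 + dot u.2 v.2.

Definition norm2 {R : realType} (phi : sfield R) : R := Num.sqrt (dot phi phi).

Definition vnorm2 {R : realType} (u : vfield R) : R := Num.sqrt (vdot u u).

Definition vmag {R : realType} (u : vfield R) : sfield R :=
  fun x => Num.sqrt (u.1 x ^+ 2 + u.2 x ^+ 2).

Definition Lp_norm {R : realType} (p : \bar R) (phi : sfield R) : \bar R :=
  'N[mrestr area measurable_Omega]_p[EFin \o phi].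

Definition L2per {R : realType} (phi : sfield R) : Prop :=
  [/\ measurable_fun setT phi, periodic phi &
      area.-integrable Omega (fun x => (phi x ^+ 2)%:E)].

Definition L2 {R : realType} : set (sfield R) :=
  [set phi | L2per phi /\ (\int[area]_(x in Omega) phi x)%R = 0].

Definition e1 {R : realType} : (R * R)%type := (1, 0).
Definition e2 {R : realType} : (R * R)%type := (0, 1).

Definition C1per {R : realType} (psi : sfield R) : Prop :=
  [/\ periodic psi, continuous psi &
      forall e, e = e1 \/ e = e2 ->
        (forall x, derivable psi x e) /\ continuous (fun x => 'D_e psi x)].

Definition is_weak_derivative {R : realType} (e : (R * R)%type)
    (phi g : sfield R) : Prop :=
  L2per g /\
  forall psi, C1per psi -> dot phi (fun x => 'D_e psi x) = - dot g psi.

(* A representative of the weak derivative of [phi] in direction [e], which is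
   unique up to a null set; junk when there is none. *)
Definition wD {R : realType} (e : (R * R)%type) (phi : sfield R) : sfield R :=
  get [set g | is_weak_derivative e phi g].

Definition H1 {R : realType} : set (sfield R) :=
  [set phi | [/\ L2 phi, exists g, is_weak_derivative e1 phi g &
                         exists g, is_weak_derivative e2 phi g]].

Definition L2v {R : realType} : set (vfield R) :=
  [set u | L2 u.1 /\ L2 u.2].

Definition H1v {R : realType} : set (vfield R) :=
  [set u | H1 u.1 /\ H1 u.2].

Definition grad {R : realType} (phi : sfield R) : vfield R :=
  (wD e1 phi, wD e2 phi).

Definition gdot {R : realType} (phi psi : sfield R) : R :=
  vdot (grad phi) (grad psi).

Definition gnorm {R : realType} (phi : sfield R) : R :=
  Num.sqrt (gdot phi phi).

Definition vgdot {R : realType} (u v : vfield R) : R :=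
  gdot u.1 v.1 + gdot u.2 v.2.

Definition vgnorm {R : realType} (u : vfield R) : R := Num.sqrt (vgdot u u).

Definition divergence {R : realType} (u : vfield R) : sfield R :=
  fun x => wD e1 u.1 x + wD e2 u.2 x.

Definition curl {R : realType} (u : vfield R) : sfield R :=
  fun x => wD e1 u.2 x - wD e2 u.1 x.

(* The pairing (curl g, chi) for g merely in L^2, integrated by parts. *)
Definition curl_dot {R : realType} (g : vfield R) (chi : sfield R) : R :=
  dot g.1 (wD e2 chi) - dot g.2 (wD e1 chi).

Definition cross {R : realType} (w : sfield R) (u : vfield R) : vfield R :=
  (fun x => - u.2 x * w x, fun x => u.1 x * w x).

Definition bstar {R : realType} (u : vfield R) (w chi : sfield R) : R :=
  dot (fun x => u.1 x * wD e1 w x + u.2 x * wD e2 w x) chi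
  + 2^-1 * dot (fun x => divergence u x * w x) chi.

Definition poincare {R : realType} (lambda : R) : Prop :=
  (forall phi : vfield R, H1v phi -> vnorm2 phi <= lambda * vgnorm phi) /\
  (forall phi : sfield R, H1 phi -> norm2 phi <= lambda * gnorm phi).

Definition edist {R : realType} (x y : R * R) : R :=
  Num.sqrt ((x.1 - y.1) ^+ 2 + (x.2 - y.2) ^+ 2).

(* The vertices of N triangles covering the closed period cell. *)
Definition mesh (R : realType) (N : nat) := 'I_N -> 'I_3 -> (R * R)%type.

(* Convex hull of those vertices v i for which P i holds. *)
Definition face {R : realType} (v : 'I_3 -> (R * R)%type) (P : set 'I_3) :
    set (R * R) :=
  [set x | exists c : 'I_3 -> R,
    [/\ forall i, 0 <= c i, forall i, ~ P i -> c i = 0, \sum_i c i = 1 &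
        x = (\sum_i c i * (v i).1, \sum_i c i * (v i).2)]].

Definition triangle {R : realType} (v : 'I_3 -> (R * R)%type) : set (R * R) :=
  face v setT.

Definition translate {R : realType} (k l : int) (v : 'I_3 -> (R * R)%type) :
    'I_3 -> (R * R)%type :=
  fun i => ((v i).1 + k%:~R * (2 * pi), (v i).2 + l%:~R * (2 * pi)).

Definition diameter {R : realType} (v : 'I_3 -> (R * R)%type) : R :=
  \big[Num.max/0]_(i < 3) \big[Num.max/0]_(j < 3) edist (v i) (v j).

Definition mesh_size {R : realType} (N : nat) (T : mesh R N) : R :=
  \big[Num.max/0]_(t < N) diameter (T t).

(* The last clause is conformity of the mesh extended periodically to the
   plane: any two triangles meet exactly in the convex hull of their common
   vertices. The case k = l = 0 is conformity inside the cell, the others say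
   that the traces of the mesh on opposite sides of the cell match. *)
Definition periodic_triangulation {R : realType} (N : nat) (T : mesh R N) :
    Prop :=
  [/\ forall t, (triangle (T t))° !=set0,
      \bigcup_t triangle (T t) = `[0, 2 * pi] `*` `[0, 2 * pi] &
      forall s t (k l : int),
        triangle (T s) `&` triangle (translate k l (T t)) =
        face (T s) [set i | exists j, T s i = translate k l (T t) j]].

Definition shape_regular {R : realType} (sigma : R) (N : nat) (T : mesh R N) :
    Prop :=
  forall t, exists (c : (R * R)%type) (r : R),
    [/\ 0 < r, [set x | edist c x <= r] `<=` triangle (T t) &
        diameter (T t) <= sigma * (2 * r)].

Definition piecewise_polynomial {R : realType} (N : nat) (T : mesh R N)
    (phi : sfield R) : Prop :=
  forall t, exists p : {poly {poly R}},
    forall x, (triangle (T t))° x -> phi x = p.[x.2%:P].[x.1].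

(* A finite element space is the span of finitely many piecewise polynomials. *)
Definition fe_space {R : realType} (N : nat) (T : mesh R N)
    (S : set (sfield R)) : Prop :=
  exists (n : nat) (b : 'I_n -> sfield R),
    (forall i, piecewise_polynomial T (b i)) /\
    S = [set phi | exists c : 'I_n -> R, phi = fun x => \sum_i c i * b i x].

Definition fe_vspace {R : realType} (N : nat) (T : mesh R N)
    (S : set (vfield R)) : Prop :=
  exists (n : nat) (b : 'I_n -> vfield R),
    (forall i, piecewise_polynomial T (b i).1 /\
               piecewise_polynomial T (b i).2) /\
    S = [set u | exists c : 'I_n -> R,
          u = (fun x => \sum_i c i * (b i).1 x,
               fun x => \sum_i c i * (b i).2 x)].

Definition inf_sup {R : realType} (beta : R) (Xh : set (vfield R))
    (Qh : set (sfield R)) : Prop :=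
  forall q, Qh q ->
    beta * norm2 q <=
    sup [set dot q (divergence v) / vgnorm v |
         v in [set v | Xh v /\ vnorm2 v != 0]].

Definition discrete_div_free {R : realType} (Xh : set (vfield R))
    (Qh : set (sfield R)) : set (vfield R) :=
  [set v | Xh v /\ forall q, Qh q -> dot (divergence v) q = 0].

Definition dual_norm {R : realType} (Vh : set (vfield R)) (g : vfield R) : R :=
  sup [set vdot g v / vgnorm v | v in [set v | Vh v /\ vnorm2 v != 0]].

Definition discrete_laplacian {R : realType} (Yh : set (sfield R))
    (phi : sfield R) : sfield R :=
  get [set z | Yh z /\ forall v, Yh v -> dot z v = - gdot phi v].

Definition discrete_stokes {R : realType} (Vh : set (vfield R))
    (phi : vfield R) : vfield R :=
  get [set a | Vh a /\ forall v, Vh v -> vdot a v = vgdot phi v].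

Definition agmon_inequalities {R : realType} (K : R) (Vh : set (vfield R))
    (Yh : set (sfield R)) : Prop :=
  (forall v, Vh v ->
    (Lp_norm +oo (vmag v) <=
     (K * Num.sqrt (vnorm2 v) *
      Num.sqrt (vnorm2 (discrete_stokes Vh v)))%:E)%E) /\
  (forall z, Yh z -> let dz := norm2 (discrete_laplacian Yh z) in
    [/\ (Lp_norm +oo z <= (K * Num.sqrt (norm2 z) * Num.sqrt dz)%:E)%E,
        (Lp_norm 4%:E (vmag (grad z)) <=
         (K * Num.sqrt (gnorm z) * Num.sqrt dz)%:E)%E &
        (Lp_norm 3%:E (vmag (grad z)) <=
         (K * norm2 z `^ (1 / 3) * dz `^ (2 / 3))%:E)%E]).

Definition inverse_inequality {R : realType} (K h : R)
    (Xh : set (vfield R)) : Prop :=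
  forall v, Xh v ->
    (Lp_norm +oo (vmag v) <=
     (K * Num.sqrt (1 + `|ln h|) * vgnorm v)%:E)%E.

Definition time_Linf {R : realType} (g : R -> R) : \bar R :=
  'N[mrestr lebesgue_measure measurable_halfline]_+oo[EFin \o g].

Definition LinfL2 {R : realType} (f : R -> vfield R) : Prop :=
  [/\ measurable_fun (halfline `*` setT) (fun p : R * (R * R) => (f p.1).1 p.2),
      measurable_fun (halfline `*` setT) (fun p : R * (R * R) => (f p.1).2 p.2),
      forall t, 0 < t -> L2v (f t) &
      (time_Linf (fun t => vnorm2 (f t)) < +oo)%E].

Definition LinfL2_norm {R : realType} (f : R -> vfield R) : R :=
  fine (time_Linf (fun t => vnorm2 (f t))).

Definition LinfVh_norm {R : realType} (Vh : set (vfield R))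
    (f : R -> vfield R) : R :=
  fine (time_Linf (fun t => dual_norm Vh (f t))).

(* f s lies in the essential range of f. Point values of a class in
   L^oo(0,oo; L^2) are only meaningful for a choice of representative; this
   property holds at almost every s, and at every s > 0 if f is continuous. *)
Definition essential_value {R : realType} (f : R -> vfield R) (s : R) : Prop :=
  forall eps : R, 0 < eps ->
    ~ lebesgue_measure.-negligible
        [set t | 0 < t /\ vnorm2 (f t - f s) < eps].

(* P 0 is unconstrained: the scheme has no initial pressure. *)
Definition velocity_vorticity_solution {R : realType}
    (Xh : set (vfield R)) (Qh Yh : set (sfield R)) (nu dt : R)
    (f : R -> vfield R) (uh0 : vfield R) (wh0 : sfield R)
    (u : nat -> vfield R) (P w : nat -> sfield R) : Prop :=
  [/\ u 0%N = uh0, w 0%N = wh0 &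
      forall n : nat,
      [/\ Xh (u n.+1) /\ Qh (P n.+1),
          forall v, Xh v ->
            1 / dt * vdot (u n.+1 - u n) v + vdot (cross (w n) (u n.+1)) v
            - dot (P n.+1) (divergence v) + nu * vgdot (u n.+1) v
            = vdot (f (n.+1%:R * dt)) v,
          forall q, Qh q -> dot (divergence (u n.+1)) q = 0,
          Yh (w n.+1) &
          forall chi, Yh chi ->
            1 / dt * dot (w n.+1 - w n) chi + bstar (u n.+1) (w n.+1) chi
            + nu * gdot (w n.+1) chi
            = curl_dot (f (n.+1%:R * dt)) chi]].

(* Main.v *)
Require Import Defs.
From HB Require Import structures.
From mathcomp Require Import all_boot all_order all_algebra.
From mathcomp Require Import all_classical all_reals all_analysis.
From mathcomp Require Import measurable_realfun ring lra.
Set Implicit Arguments.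
Unset Strict Implicit.
Unset Printing Implicit Defensive.
Import Order.TTheory GRing.Theory Num.Theory.
Import numFieldNormedType.Exports.
Local Open Scope classical_set_scope.
Local Open Scope ring_scope.

(** Three tests give three one-step inequalities. Testing the momentum equation with
    u_h^{n+1} removes the rotational term pointwise and the pressure by discrete
    incompressibility ([velocity_energy]); testing it with A_h u_h^{n+1} gives the
    gradient estimate with one nonlinear contribution, at most |w_h^n| |u_h^{n+1}|_oo
    |A_h u_h^{n+1}| ([velocity_gradient]); testing the vorticity equation with
    w_h^{n+1} removes b^* ([vorticity_energy]). The sup norm of the velocity is
    controlled by Agmon's inequality for the first bound of the theorem and by the
    inverse inequality for the second. What is left concerns real sequences, and a
    scaling ([gradient_bound_agmon], [gradient_bound_inverse]) reduces it to the case
    where the Poincare constant and the viscosity are 1.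

    The delicate point of the recursion is that C_0 and C_1 carry the weight s_n =
    alpha^-n of the last time, while a Gronwall argument needs bounds for |u_h^k| and
    |w_h^k| at all earlier times k < n, where the weights are larger. As long as s_n
    >= 1/12 all these weights are comparable, and Young's inequality followed by
    Gronwall's works ([gradient_early_cubic], [gradient_early_linear]). When s_n is
    smaller a different argument is needed. At each step either the gradient is at
    most the forcing, or its excess over the forcing is damped by the factor 1/alpha,
    or it is at most a multiple of (1 + |w_h|) |u_h| ([gradient_trichotomy]). Only the
    last step k at which the third case occurs matters ([gradient_alternative]): there
    the two factors |w_h| and |u_h| have already decayed, up to the forcing, like s_k,
    which together with the damping s_{n-k} since then produces the weight s_n.

    The tests themselves need the linearity of the weak gradient, and the identity
    b^*(u, w, w) = 0 needs an integration by parts between two weakly differentiable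
    functions. Both rest on the density in L2 of a class of smooth functions,
    containing the trigonometric polynomials, each of which lies in a finite-
    dimensional space stable under the derivative ([approximable_sqint]). The L2
    projection onto such a space commutes with the weak derivative, so a function and
    its derivative are approximated at once ([weak_derivative_approx]), and the
    identity passes to the limit from the smooth case ([weak_derivative_ibp]). Since
    the gradient is a chosen representative of a class of functions up to null sets,
    all these facts are stated through [dot] only.

    Finally, the scheme samples the forcing at single times, whereas the norms of the
    theorem are essential suprema. A sampled value is a limit, in L2, of values taken
    at times where the essential bounds hold, hence inherits these bounds
    ([essential_value_le], [essential_value_dual]). *)

(** * The L2 pairing on the period cell *)

(** Cauchy-Schwarz for a positive semidefinite form, in terms of the three numbers
    involved: stated this way it serves scalar fields, vector fields and gradients
    without comparing the underlying pairings. *)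
Lemma discriminant_le (R : realType) (a b c : R) :
  0 <= a -> 0 <= c -> (forall t, 0 <= a - 2 * t * b + t ^+ 2 * c) ->
  `|b| <= Num.sqrt a * Num.sqrt c.
Proof.
move=> a0 c0 h; rewrite -sqrtrM// -sqrtr_sqr ler_sqrt ?mulr_ge0//.
have [c00|c0'] := eqVneq c 0.
  have [->|b0] := eqVneq b 0; first by rewrite expr0n mulr_ge0.
  have := h ((a + 1) / (2 * b)).
  have -> : a - 2 * ((a + 1) / (2 * b)) * b + ((a + 1) / (2 * b)) ^+ 2 * c = -1.
    by rewrite c00 mulr0; field.
  by rewrite ler0N1.
have cp : 0 < c by rewrite lt_neqAle eq_sym c0'.
have := h (b / c).
have -> : a - 2 * (b / c) * b + (b / c) ^+ 2 * c = (a * c - b ^+ 2) / c by field.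
by rewrite pmulr_lge0 ?invr_gt0// subr_ge0.
Qed.

(** Periodicity and zero mean are left out on purpose: products and differences with
    test functions must stay in the class. *)
Definition sqint {R : realType} (f : sfield R) : Prop :=
  measurable_fun setT f /\ area.-integrable Omega (fun x => (f x ^+ 2)%:E).

Section L2.
Context {R : realType}.
Implicit Types f g h : sfield R.

Lemma mOmega : measurable (@Omega R). Proof. exact: measurable_Omega. Qed.
Local Hint Resolve mOmega : core.

Lemma sqint_mul f g : sqint f -> sqint g ->
  area.-integrable Omega (EFin \o (fun x => f x * g x)).
Proof.
move=> [mf If] [mg Ig].
apply: (le_integrable (mu:=area) mOmega _ _ (integrableD (mu:=area) mOmega If Ig)) => //.
  by apply/measurable_EFinP; apply: measurable_funTS; exact: measurable_funM.
move=> x _ /=; rewrite lee_fin normrM.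
rewrite [leRHS]ger0_norm ?addr_ge0 ?sqr_ge0//.
rewrite -(real_normK (num_real (f x))) -(real_normK (num_real (g x))).
have := sqr_ge0 (`|f x| - `|g x|); have := normr_ge0 (f x); have := normr_ge0 (g x).
nra.
Qed.

Lemma sqintD f g : sqint f -> sqint g -> sqint (fun x => f x + g x).
Proof.
move=> sf sg; split; first by apply: measurable_funD; [case: sf|case: sg].
have I1 := sf.2; have I2 := sg.2; have I3 := sqint_mul sf sg.
have := integrableD (mu:=area) mOmega (integrableD (mu:=area) mOmega I1 I2) (integrableD (mu:=area) mOmega I3 I3).
by apply: eq_integrable => // x _ /=; rewrite -!EFinD; congr EFin; ring.
Qed.

Lemma sqintZ c f : sqint f -> sqint (fun x => c * f x).
Proof.
move=> sf; split; first by apply: measurable_funM; [exact: measurable_cst|case: sf].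
have := integrableZl (mu:=area) mOmega (c ^+ 2) sf.2.
by apply: eq_integrable => // x _ /=; rewrite -EFinM exprMn.
Qed.

Lemma sqintB f g : sqint f -> sqint g -> sqint (fun x => f x - g x).
Proof.
move=> sf sg; have := sqintD sf (sqintZ (-1) sg).
by congr sqint; apply: funext => x; rewrite mulN1r.
Qed.

Lemma dotC f g : dot f g = dot g f.
Proof. by rewrite /dot; apply: eq_Rintegral => x _; rewrite mulrC. Qed.

Lemma dotDl f g h : sqint f -> sqint g -> sqint h ->
  dot (fun x => f x + g x) h = dot f h + dot g h.
Proof.
move=> sf sg sh; rewrite /dot -(RintegralD (mu:=area))//; last 2 first.
- exact: sqint_mul.
- exact: sqint_mul.
by apply: eq_Rintegral => x _; rewrite mulrDl.
Qed.

Lemma dotZl c f h : sqint f -> sqint h -> dot (fun x => c * f x) h = c * dot f h.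
Proof.
move=> sf sh; rewrite /dot -(RintegralZl (mu:=area))//; last exact: sqint_mul.
by apply: eq_Rintegral => x _; rewrite mulrA.
Qed.

Lemma dotBl f g h : sqint f -> sqint g -> sqint h ->
  dot (fun x => f x - g x) h = dot f h - dot g h.
Proof.
move=> sf sg sh; rewrite -[- dot g h]mulN1r -dotZl// -dotDl//; last exact: sqintZ.
by congr dot; apply: funext => x; rewrite mulN1r.
Qed.

Lemma dotBr f g h : sqint f -> sqint g -> sqint h ->
  dot h (fun x => f x - g x) = dot h f - dot h g.
Proof. by move=> sf sg sh; rewrite dotC dotBl// !(dotC h). Qed.

Lemma dotZr c f h : sqint f -> sqint h -> dot h (fun x => c * f x) = c * dot h f.
Proof. by move=> sf sh; rewrite dotC dotZl// (dotC h). Qed.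

Lemma dot_ge0 f : 0 <= dot f f.
Proof. by apply: Rintegral_ge0 => x _; rewrite -expr2 sqr_ge0. Qed.

Lemma dot_quadratic f g t : sqint f -> sqint g ->
  0 <= dot f f - 2 * t * dot f g + t ^+ 2 * dot g g.
Proof.
move=> sf sg; have := dot_ge0 (fun x => f x - t * g x).
have st := sqintZ t sg; have sfg := sqintB sf st.
rewrite (dotBl sf st sfg) (dotBr sf st sf) (dotBr sf st st) !dotZl// !dotZr// (dotC g f).
by congr (0 <= _); ring.
Qed.

Lemma norm2_sqr f : norm2 f ^+ 2 = dot f f.
Proof. by rewrite sqr_sqrtr// dot_ge0. Qed.

Lemma dot_CS f g : sqint f -> sqint g -> `|dot f g| <= norm2 f * norm2 g.
Proof.
move=> sf sg; apply: discriminant_le; [exact: dot_ge0|exact: dot_ge0|].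
by move=> t; exact: dot_quadratic.
Qed.

Lemma L2per_sqint f : L2per f -> sqint f. Proof. by case. Qed.

End L2.

(** * Riesz representation in finite dimension *)

Section Riesz.
Context {R : realType} {V : lmodType R}.
Variables (S : set V) (B : V -> V -> R) (l : V -> R)
  (I : finType) (b : I -> V).
Hypothesis S0 : S 0.
Hypothesis SL : forall a u v, S u -> S v -> S (a *: u + v).
Hypothesis Sspan : forall v, S v -> exists c : I -> R, v = \sum_i c i *: b i.
Hypothesis Bsym : forall u v, S u -> S v -> B u v = B v u.
Hypothesis BL : forall a u v w, S u -> S v -> S w ->
  B (a *: u + v) w = a * B u w + B v w.
Hypothesis B_ge0 : forall u, S u -> 0 <= B u u.
Hypothesis lL : forall a u v, S u -> S v -> l (a *: u + v) = a * l u + l v.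
Hypothesis l_null : forall u, S u -> B u u = 0 -> l u = 0.

Let S_sum k (c : 'I_k -> R) (e : 'I_k -> V) : (forall i, S (e i)) ->
  S (\sum_i c i *: e i).
Proof.
move=> Se; elim: k c e Se => [|k IH] c e Se; first by rewrite big_ord0.
by rewrite big_ord_recl; apply: SL => //; apply: IH.
Qed.

Let B0 w : S w -> B 0 w = 0.
Proof. by move=> Sw; have := BL (-1) S0 S0 Sw; rewrite scaler0 addr0; lra. Qed.

Let l0 : l 0 = 0.
Proof. by have := lL (-1) S0 S0; rewrite scaler0 addr0; lra. Qed.

Let B_sum k (c : 'I_k -> R) (e : 'I_k -> V) w : (forall i, S (e i)) -> S w ->
  B (\sum_i c i *: e i) w = \sum_i c i * B (e i) w.
Proof.
move=> Se Sw; elim: k c e Se => [|k IH] c e Se; first by rewrite !big_ord0 B0.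
by rewrite !big_ord_recl BL ?IH//; exact: S_sum.
Qed.

Let l_sum k (c : 'I_k -> R) (e : 'I_k -> V) : (forall i, S (e i)) ->
  l (\sum_i c i *: e i) = \sum_i c i * l (e i).
Proof.
move=> Se; elim: k c e Se => [|k IH] c e Se; first by rewrite !big_ord0 l0.
by rewrite !big_ord_recl lL ?IH//; exact: S_sum.
Qed.

Let orthonormal k (e : 'I_k -> V) :=
  (forall i, S (e i)) /\ forall i j, B (e i) (e j) = (i == j)%:R.

Let orthonormal_le k (e : 'I_k -> V) : orthonormal e -> (k <= #|I|)%N.
Proof.
move=> [Se oe]; rewrite leqNgt; apply/negP => nk.
pose M := \matrix_(i < k, j < #|I|) sval (cid (Sspan (Se i))) (enum_val j).
have eM i : e i = \sum_j M i j *: b (enum_val j).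
  rewrite {1}(svalP (cid (Sspan (Se i)))) big_enum_val /=.
  by apply: eq_bigr => j _; rewrite mxE.
have : kermx M != 0.
  rewrite kermx_eq0 /row_free; apply/eqP => rM.
  by have := rank_leq_col M; rewrite rM leqNgt nk.
case/matrix0Pn => i0 [j0 nz].
pose c := row i0 (kermx M).
have cM : c *m M = 0 by apply/sub_kermxP; exact: row_sub.
have : B (\sum_i c 0 i *: e i) (e j0) = 0.
  suff -> : \sum_i c 0 i *: e i = 0 by rewrite B0.
  under eq_bigr do rewrite eM scaler_sumr.
  rewrite exchange_big /= big1// => j _.
  under eq_bigr do rewrite scalerA.
  rewrite -scaler_suml; have /matrixP/(_ 0 j) := cM.
  by rewrite !mxE => ->; rewrite scale0r.
rewrite B_sum// (bigD1 j0)//= big1 ?addr0; last first.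
  by move=> i /negPf ij; rewrite oe ij mulr0.
by rewrite oe eqxx mulr1 mxE => /eqP; apply/negP.
Qed.

Let orthonormal_extend k (e : 'I_k -> V) : orthonormal e ->
  ~ (exists a, S a /\ forall v, S v -> B a v = l v) ->
  exists e' : 'I_k.+1 -> V, orthonormal e'.
Proof.
move=> [Se oe] no.
pose a := \sum_i l (e i) *: e i.
have Sa : S a by exact: S_sum.
have [v [Sv ne]] : exists v, S v /\ B a v <> l v.
  apply: contrapT => h; apply: no; exists a; split=> // v Sv.
  by apply: contrapT => h'; apply: h; exists v.
pose p := \sum_i B v (e i) *: e i.
have Sp : S p by exact: S_sum.
pose u := (-1) *: p + v.
have Su : S u by exact: SL.
have ue j : B u (e j) = 0.
  rewrite BL// B_sum// (bigD1 j)//= big1 ?addr0; last first.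
    by move=> i /negPf ij; rewrite oe ij mulr0.
  by rewrite oe eqxx mulr1; lra.
have lu : l u = l v - B a v.
  rewrite lL// l_sum// B_sum// mulN1r addrC; congr (_ - _).
  by apply: eq_bigr => i _; rewrite mulrC (Bsym Sv).
have Buu : 0 < B u u.
  rewrite lt_neqAle B_ge0// andbT eq_sym; apply/eqP => /(l_null Su).
  by rewrite lu; lra.
pose s := Num.sqrt (B u u).
have s0 : 0 < s by rewrite sqrtr_gt0.
pose u' := s^-1 *: u + 0.
have Su' : S u' by exact: SL.
have u'e j : B u' (e j) = 0 by rewrite BL// ue B0// mulr0 addr0.
have u'u' : B u' u' = 1.
  have Buu' : B u u' = s^-1 * B u u.
    by rewrite Bsym// BL// B0// addr0.
  rewrite BL// B0// addr0 Buu' -(@sqr_sqrtr _ (B u u)) ?B_ge0// -/s.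
  by field; rewrite gt_eqF.
exists (fun i => if unlift ord_max i is Some j then e j else u'); split.
  by move=> i; case: unliftP => [j|] _.
move=> i j; case: (unliftP ord_max i) => [i'|] ->; case: (unliftP ord_max j) => [j'|] ->.
- by rewrite oe (inj_eq lift_inj).
- by rewrite Bsym// u'e -(negbK (_ == _)) eq_sym neq_lift.
- by rewrite u'e -(negbK (_ == _)) neq_lift.
- by rewrite u'u' eqxx.
Qed.

(** The form [B] is only semidefinite, since fields equal almost everywhere are not
    identified; hence the hypothesis that [l] vanishes on null vectors.  For an
    orthonormal family [e] the candidate is the sum of the [l (e i)] times [e i].  If no
    vector represents [l] the candidate fails against some [v], and the component of
    [v] orthogonal to [e] is not null: it extends the family.  Repeating this produces
    more orthonormal vectors than the spanning family allows. *)
Lemma riesz : exists a, S a /\ forall v, S v -> B a v = l v.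
Proof.
apply: contrapT => no.
have [e oe] : exists e : 'I_#|I|.+1 -> V, orthonormal e.
  elim: #|I|.+1 => [|k [e oe]]; last exact: (orthonormal_extend oe).
  by exists (fun=> 0); split=> [//|[]].
by have := orthonormal_le oe; rewrite ltnn.
Qed.

End Riesz.

(** * Trigonometric polynomials *)

Definition regular {R : realType} (psi : sfield R) : Prop :=
  [/\ C1per psi, measurable_fun setT psi & exists M, forall x, `|psi x| <= M].

Definition axis {R : realType} (e : R * R) : Prop := e = e1 \/ e = e2.

Lemma axis_e1 {R : realType} : axis (e1 : R * R). Proof. by left. Qed.
Lemma axis_e2 {R : realType} : axis (e2 : R * R). Proof. by right. Qed.

Definition invariant_family {R : realType} (e : R * R) (I : finType) (b : I -> sfield R)
    (D : I -> I -> R) : Prop :=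
  (forall i, regular (b i)) /\ forall i x, 'D_e (b i) x = \sum_j D i j * b j x.

(** A class containing the trigonometric polynomials and defined by the one property
    that is used of them: each lies in a finite-dimensional space of bounded C1
    functions stable under the derivative in direction [e].  Coefficients and
    frequencies never appear, and closure under products is a tensor product of
    families. *)
Definition trig {R : realType} (e : R * R) (psi : sfield R) : Prop :=
  exists (I : finType) (b : I -> sfield R) (D : I -> I -> R),
    invariant_family e b D /\ exists c : I -> R, psi = fun x => \sum_i c i * b i x.

Section Trig.
Context {R : realType}.
Implicit Types (phi psi : sfield R) (e : R * R).

Lemma C1per_cst (c : R) : C1per (cst c : sfield R).
Proof.
split; [by []|exact: cst_continuous|move=> e _; split=> [x|]].
  exact: derivable_cst.
have -> : (fun x : R * R => 'D_e (cst c : sfield R) x) = cst 0.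
  by apply: funext => x; exact: derive_cst.
exact: cst_continuous.
Qed.

Lemma C1per_add phi psi : C1per phi -> C1per psi -> C1per (phi \+ psi).
Proof.
move=> [pp cp dp] [pq cq dq]; split.
- by move=> x; have [? ?] := pp x; have [? ?] := pq x; split; congr (_ + _).
- by move=> x; apply: cvgD; [exact: cp|exact: cq].
move=> e ee; have [d1 c1] := dp e ee; have [d2 c2] := dq e ee; split.
  by move=> x; exact: derivableD.
have -> : (fun x => 'D_e (phi \+ psi) x) = (fun x => 'D_e phi x + 'D_e psi x).
  by apply: funext => x; exact: deriveD.
by move=> x; apply: cvgD; [exact: c1|exact: c2].
Qed.

Lemma C1per_mul phi psi : C1per phi -> C1per psi -> C1per (phi \* psi).
Proof.
move=> [pp cp dp] [pq cq dq]; split.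
- by move=> x; have [? ?] := pp x; have [? ?] := pq x; split; congr (_ * _).
- by move=> x; apply: cvgM; [exact: cp|exact: cq].
move=> e ee; have [d1 c1] := dp e ee; have [d2 c2] := dq e ee; split.
  by move=> x; exact: derivableM.
have -> : (fun x => 'D_e (phi \* psi) x) =
          (fun x => phi x * 'D_e psi x + psi x * 'D_e phi x).
  by apply: funext => x; exact: deriveM.
move=> x; apply: cvgD; apply: cvgM.
- exact: cp.
- exact: c2.
- exact: cq.
- exact: c1.
Qed.

Lemma derive_mul phi psi e : axis e -> C1per phi -> C1per psi ->
  forall x, 'D_e (fun x => phi x * psi x) x = phi x * 'D_e psi x + psi x * 'D_e phi x.
Proof.
move=> ee [_ _ /(_ e ee)[dp _]] [_ _ /(_ e ee)[dq _]] x.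
exact: (@deriveM _ _ phi psi x e).
Qed.

Lemma regular_cst (c : R) : regular (cst c : sfield R).
Proof.
by split; [exact: C1per_cst|exact: measurable_cst|exists `|c|].
Qed.

Lemma regular_mul phi psi : regular phi -> regular psi ->
  regular (fun x => phi x * psi x).
Proof.
move=> [p1 m1 [M b1]] [p2 m2 [N b2]]; split.
- exact: C1per_mul.
- exact: measurable_funM.
- by exists (M * N) => x; rewrite normrM ler_pM.
Qed.

Lemma regular_add phi psi : regular phi -> regular psi ->
  regular (fun x => phi x + psi x).
Proof.
move=> [p1 m1 [M b1]] [p2 m2 [N b2]]; split.
- exact: C1per_add.
- exact: measurable_funD.
- by exists (M + N) => x; rewrite (le_trans (ler_normD _ _))// lerD.
Qed.

Lemma regular_sum (I : finType) (c : I -> R) (b : I -> sfield R) :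
  (forall i, regular (b i)) -> regular (fun x => \sum_i c i * b i x).
Proof.
move=> rb; elim: (index_enum I) => [|i s IH].
  have -> : (fun x => \sum_(i <- [::]) c i * b i x) = (cst 0 : sfield R).
    by apply: funext => x; rewrite big_nil.
  exact: regular_cst.
have -> : (fun x => \sum_(i <- i :: s) c i * b i x) =
          (fun x => c i * b i x + \sum_(i <- s) c i * b i x).
  by apply: funext => x; rewrite big_cons.
apply: regular_add => //.
exact: (regular_mul (regular_cst (c i)) (rb i)).
Qed.

Lemma derive_lincomb (I : finType) (c : I -> R) (b : I -> sfield R) e x :
  axis e -> (forall i, regular (b i)) ->
  'D_e (fun x => \sum_i c i * b i x) x = \sum_i c i * 'D_e (b i) x.
Proof.
move=> ee rb.
suff : is_derive x e (fun x => \sum_i c i * b i x) (\sum_i c i * 'D_e (b i) x) by case.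
have db i : derivable (b i) x e by have [[_ _ /(_ e ee)[dp _]] _ _] := rb i.
elim: (index_enum I) => [|i s IH].
  have -> : (fun x => \sum_(i <- [::]) c i * b i x) = (cst 0 : sfield R).
    by apply: funext => y; rewrite big_nil.
  by rewrite big_nil; exact: is_derive_cst.
have -> : (fun x => \sum_(i <- i :: s) c i * b i x) =
          (c i \*: b i + (fun x => \sum_(i <- s) c i * b i x)).
  by apply: funext => y; rewrite big_cons.
rewrite big_cons; apply: is_deriveD.
apply: DeriveDef; first exact: derivableZ.
by rewrite deriveZ.
Qed.

Lemma trig_regular e psi : trig e psi -> regular psi.
Proof. by move=> [I [b [D [[rb _] [c ->]]]]]; exact: regular_sum. Qed.

Lemma trig_cst e (c : R) : trig e (cst c : sfield R).
Proof.
exists unit, (fun=> cst 1), (fun _ _ => 0); split; first split.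
- by move=> _; exact: regular_cst.
- by move=> i x; rewrite derive_cst big1// => j _; rewrite mul0r.
- exists (fun=> c); apply: funext => x.
  by rewrite sumr_const card_unit mulr1n /= mulr1.
Qed.

Lemma invariant_family_sum e (I J : finType) (b : I -> sfield R) D (b' : J -> sfield R) D' :
  invariant_family e b D -> invariant_family e b' D' ->
  invariant_family e (fun k : I + J => match k with inl i => b i | inr j => b' j end)
   (fun k l => match k, l with inl i, inl i' => D i i' | inr j, inr j' => D' j j'
               | _, _ => 0 end).
Proof.
move=> [rb db] [rb' db']; split=> [[i|j]//|[i|j] x]; rewrite big_sumType /=.
- by rewrite [X in _ + X]big1 ?addr0 ?db// => j _; rewrite mul0r.
- by rewrite [X in X + _]big1 ?add0r ?db'// => i _; rewrite mul0r.
Qed.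

(** By the Leibniz rule the matrix of the derivative is the sum of the Kronecker
    products of each matrix with the identity. *)
Lemma invariant_family_mul e (I J : finType) (b : I -> sfield R) D (b' : J -> sfield R) D' :
  axis e -> invariant_family e b D -> invariant_family e b' D' ->
  invariant_family e (fun k : I * J => fun x => b k.1 x * b' k.2 x)
   (fun k l => D k.1 l.1 * (k.2 == l.2)%:R + (k.1 == l.1)%:R * D' k.2 l.2).
Proof.
move=> ee [rb db] [rb' db']; split=> [[i j]|[i j] x] /=; first exact: regular_mul.
have [pi _ _] := rb i; have [pj _ _] := rb' j.
rewrite derive_mul// db db'.
transitivity (\sum_i' \sum_j' (D i i' * (j == j')%:R + (i == i')%:R * D' j j') *
                (b i' x * b' j' x)); last by rewrite pair_big.
transitivity (\sum_i' ((i == i')%:R * b i' x * \sum_j' D' j j' * b' j' x +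
                 D i i' * b i' x * b' j x)).
  rewrite big_split /=; congr (_ + _).
    rewrite [RHS](bigD1 i)//= eqxx mul1r [X in _ = _ + X]big1 ?addr0// => k /negPf.
    by rewrite eq_sym => ->; rewrite !mul0r.
  by rewrite mulrC mulr_suml.
apply: eq_bigr => i' _.
rewrite addrC; under [RHS]eq_bigr do rewrite mulrDl.
rewrite big_split /=; congr (_ + _).
  rewrite (bigD1 j)//= eqxx big1 ?addr0.
    by rewrite mulr1 mulrA.
  by move=> k /negPf; rewrite eq_sym => ->; rewrite mulr0 mul0r.
rewrite mulr_sumr; apply: eq_bigr => j' _; ring.
Qed.

Lemma trig_add e phi psi : trig e phi -> trig e psi -> trig e (fun x => phi x + psi x).
Proof.
move=> [I [b [D [fb [c ->]]]]] [J [b' [D' [fb' [c' ->]]]]].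
do 3 eexists; split; first exact: (invariant_family_sum fb fb').
exists (fun k => match k with inl i => c i | inr j => c' j end).
by apply: funext => x; rewrite big_sumType.
Qed.

Lemma trig_mul e phi psi : axis e ->
  trig e phi -> trig e psi -> trig e (fun x => phi x * psi x).
Proof.
move=> ee [I [b [D [fb [c ->]]]]] [J [b' [D' [fb' [c' ->]]]]].
do 3 eexists; split; first exact: (invariant_family_mul ee fb fb').
exists (fun k => c k.1 * c' k.2).
apply: funext => x; rewrite mulr_suml.
under eq_bigr do rewrite mulr_sumr.
by rewrite pair_big; apply: eq_bigr => k _ /=; ring.
Qed.

Lemma trig_exp e psi n : axis e -> trig e psi -> trig e (fun x => psi x ^+ n).
Proof.
move=> ee tp; elim: n => [|n IH].
  by have -> : (fun x => psi x ^+ 0) = cst 1 by []; exact: trig_cst.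
have -> : (fun x => psi x ^+ n.+1) = (fun x => psi x * psi x ^+ n).
  by apply: funext => x; rewrite exprS.
exact: trig_mul.
Qed.

Lemma trig_scale e c psi : axis e -> trig e psi -> trig e (fun x => c * psi x).
Proof. by move=> ee tp; apply: (trig_mul ee (trig_cst e c) tp). Qed.

Lemma trig_sub e phi psi : axis e -> trig e phi -> trig e psi ->
  trig e (fun x => phi x - psi x).
Proof.
move=> ee tp tq; have := trig_add tp (trig_scale (-1) ee tq).
by congr trig; apply: funext => x; rewrite mulN1r.
Qed.

Lemma trig_derive e psi : axis e -> trig e psi -> trig e (fun x => 'D_e psi x).
Proof.
move=> ee [I [b [D [fb [c ->]]]]]; exists I, b, D; split=> //.
exists (fun j => \sum_i c i * D i j); apply: funext => x.
rewrite derive_lincomb//; last by case: fb.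
under eq_bigr do rewrite fb.2 mulr_sumr.
rewrite exchange_big; apply: eq_bigr => j _; rewrite mulr_suml.
by apply: eq_bigr => i _; rewrite mulrA.
Qed.

Section coord.
Variables (g dg : R -> R).
Hypothesis dgE : forall t, is_derive t (1 : R) g (dg t).

Lemma derivable_fst x : is_derive x e1 (fun y : R * R => g y.1) (dg x.1).
Proof.
have [] := dgE x.1; rewrite /derivable /derive => d E.
by split; [exact: d|exact: E].
Qed.

Lemma derivable_fst2 x : is_derive x e2 (fun y : R * R => g y.1) 0.
Proof.
have E : (fun h : R => h^-1 *: (g (h *: e2 + x).1 - g x.1)) = cst 0.
  apply: funext => h; have -> : (h *: e2 + x).1 = x.1.
    by change (h * 0 + x.1 = x.1); rewrite mulr0 add0r.
  by rewrite subrr scaler0.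
by split; rewrite /derivable /derive E; [exact: is_cvg_cst|exact: lim_cst].
Qed.

Lemma derivable_snd x : is_derive x e2 (fun y : R * R => g y.2) (dg x.2).
Proof.
have [] := dgE x.2; rewrite /derivable /derive => d E.
by split; [exact: d|exact: E].
Qed.

Lemma derivable_snd1 x : is_derive x e1 (fun y : R * R => g y.2) 0.
Proof.
have E : (fun h : R => h^-1 *: (g (h *: e1 + x).2 - g x.2)) = cst 0.
  apply: funext => h; have -> : (h *: e1 + x).2 = x.2.
    by change (h * 0 + x.2 = x.2); rewrite mulr0 add0r.
  by rewrite subrr scaler0.
by split; rewrite /derivable /derive E; [exact: is_cvg_cst|exact: lim_cst].
Qed.

Hypothesis pg : forall t, g (t + 2 * pi) = g t.
Hypothesis cdg : continuous dg.
Hypothesis bg : forall t, `|g t| <= 1.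

Let cg : continuous g.
Proof.
by move=> t; apply: differentiable_continuous; apply/derivable1_diffP; case: (dgE t).
Qed.

Lemma regular_fst : regular (fun x : R * R => g x.1).
Proof.
split.
- split.
  + by move=> x /=; rewrite pg.
  + by move=> x; apply: (@continuous_comp _ _ _ fst g); [exact: cvg_fst|exact: cg].
  + move=> e [->|->]; split.
    * by move=> x; case: (derivable_fst x).
    * have -> : (fun x => 'D_e1 (fun x : R * R => g x.1) x) = dg \o fst.
        by apply: funext => x; case: (derivable_fst x).
      by move=> x; apply: continuous_comp; [exact: cvg_fst|exact: cdg].
    * by move=> x; case: (derivable_fst2 x).
    * have -> : (fun x => 'D_e2 (fun x : R * R => g x.1) x) = cst 0.
        by apply: funext => x; case: (derivable_fst2 x).
      exact: cst_continuous.
- apply: (@measurableT_comp _ _ _ _ _ _ g _ fst) => //.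
  exact: continuous_measurable_fun.
- by exists 1.
Qed.

Lemma regular_snd : regular (fun x : R * R => g x.2).
Proof.
split.
- split.
  + by move=> x /=; rewrite pg.
  + by move=> x; apply: (@continuous_comp _ _ _ snd g); [exact: cvg_snd|exact: cg].
  + move=> e [->|->]; split.
    * by move=> x; case: (derivable_snd1 x).
    * have -> : (fun x => 'D_e1 (fun x : R * R => g x.2) x) = cst 0.
        by apply: funext => x; case: (derivable_snd1 x).
      exact: cst_continuous.
    * by move=> x; case: (derivable_snd x).
    * have -> : (fun x => 'D_e2 (fun x : R * R => g x.2) x) = dg \o snd.
        by apply: funext => x; case: (derivable_snd x).
      by move=> x; apply: continuous_comp; [exact: cvg_snd|exact: cdg].
- apply: (@measurableT_comp _ _ _ _ _ _ g _ snd) => //.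
  exact: continuous_measurable_fun.
- by exists 1.
Qed.

End coord.

Let cos_per (t : R) : cos (t + 2 * pi) = cos t.
Proof. by rewrite [2 * pi]mulr_natl cosD2pi. Qed.
Let sin_per (t : R) : sin (t + 2 * pi) = sin t.
Proof. by rewrite [2 * pi]mulr_natl sinD2pi. Qed.

Lemma regular_cosx : regular (fun x : R * R => cos x.1).
Proof.
apply: (@regular_fst cos (fun t => - sin t)) => //.
- by move=> t; apply: continuousN; exact: continuous_sin.
- by move=> t; rewrite ler_norml cos_geN1 cos_le1.
Qed.

Lemma regular_sinx : regular (fun x : R * R => sin x.1).
Proof.
apply: (@regular_fst sin cos) => //; first exact: continuous_cos.
by move=> t; rewrite ler_norml sin_geN1 sin_le1.
Qed.

Lemma regular_cosy : regular (fun x : R * R => cos x.2).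
Proof.
apply: (@regular_snd cos (fun t => - sin t)) => //.
- by move=> t; apply: continuousN; exact: continuous_sin.
- by move=> t; rewrite ler_norml cos_geN1 cos_le1.
Qed.

Lemma regular_siny : regular (fun x : R * R => sin x.2).
Proof.
apply: (@regular_snd sin cos) => //; first exact: continuous_cos.
by move=> t; rewrite ler_norml sin_geN1 sin_le1.
Qed.

Let family_x (i : bool) : sfield R := if i then fun x => cos x.1 else fun x => sin x.1.
Let family_y (i : bool) : sfield R := if i then fun x => cos x.2 else fun x => sin x.2.
Let rotation (i j : bool) : R := if i then (if j then 0 else -1) else (if j then 1 else 0).

Let family_xP e : axis e ->
  exists D, invariant_family e family_x D.
Proof.
move=> [->|->].
  exists rotation; split=> [[]|[] x]; rewrite ?big_bool /=.
  - exact: regular_cosx.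
  - exact: regular_sinx.
  - by have [_ ->] := derivable_fst (@is_derive_cos R) x; ring.
  - by have [_ ->] := derivable_fst (@is_derive_sin R) x; ring.
exists (fun _ _ => 0); split=> [[]|[] x]; rewrite ?big_bool /=.
- exact: regular_cosx.
- exact: regular_sinx.
- by have [_ ->] := derivable_fst2 cos x; ring.
- by have [_ ->] := derivable_fst2 sin x; ring.
Qed.

Let family_yP e : axis e ->
  exists D, invariant_family e family_y D.
Proof.
move=> [->|->].
  exists (fun _ _ => 0); split=> [[]|[] x]; rewrite ?big_bool /=.
  - exact: regular_cosy.
  - exact: regular_siny.
  - by have [_ ->] := derivable_snd1 cos x; ring.
  - by have [_ ->] := derivable_snd1 sin x; ring.
exists rotation; split=> [[]|[] x]; rewrite ?big_bool /=.
- exact: regular_cosy.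
- exact: regular_siny.
- by have [_ ->] := derivable_snd (@is_derive_cos R) x; ring.
- by have [_ ->] := derivable_snd (@is_derive_sin R) x; ring.
Qed.

(** Cosine and sine of one coordinate span an invariant plane: the derivative rotates
    it in the direction of that coordinate and vanishes on it in the other. *)
Lemma trig_x e (a b : R) : axis e -> trig e (fun x => a * cos x.1 + b * sin x.1).
Proof.
move=> /family_xP[D fD]; exists bool, family_x, D; split=> //.
by exists (fun i : bool => if i then a else b); apply: funext => x; rewrite big_bool.
Qed.

Lemma trig_y e (a b : R) : axis e -> trig e (fun x => a * cos x.2 + b * sin x.2).
Proof.
move=> /family_yP[D fD]; exists bool, family_y, D; split=> //.
by exists (fun i : bool => if i then a else b); apply: funext => x; rewrite big_bool.
Qed.

End Trig.

(** * Integration by parts on the torus *)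

Section IntDerive.
Context {R : realType}.
Implicit Types (phi psi : sfield R) (e : R * R).

Lemma area_Omega : area (@Omega R) = (2 * pi * (2 * pi))%:E.
Proof.
rewrite /Omega product_measure1E; try exact: measurable_itv.
have E : lebesgue_measure (`]0%R, (2 * pi)%R[%classic : set R) = (2 * pi)%:E.
  by rewrite lebesgue_measure_itv /= lte_fin mulr_gt0// ?pi_gt0// -EFinB subr0.
by rewrite [X in (X * _)%E]E [X in (_ * X)%E]E -EFinM.
Qed.

Lemma bounded_integrable (f : sfield R) : measurable_fun setT f ->
  (exists M, forall x, `|f x| <= M) -> area.-integrable Omega (EFin \o f).
Proof.
move=> mf [M bM]; apply: (measurable_bounded_integrable (mu := area)).
- exact: mOmega.
- by have O : (area (@Omega R) < +oo)%E; [rewrite area_Omega ltry|exact: O].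
- exact: measurable_funTS.
- by exists M; split; [exact: num_real|move=> y yM x _; exact: le_trans (bM x) (ltW yM)].
Qed.

Lemma regular_sqint psi : regular psi -> sqint psi.
Proof.
move=> rp; split; first by case: rp.
have [_ mp bp] := regular_mul rp rp.
exact: bounded_integrable.
Qed.

Lemma integral_derive_periodic (g dg : R -> R) :
  (forall t : R, is_derive t (1 : R) g (dg t)) -> continuous dg -> g (2 * pi) = g 0 ->
  (\int[lebesgue_measure]_(t in `]0%R, (2 * pi)%R[) (dg t)%:E = 0)%E.
Proof.
move=> dgE cdg gp.
have cg : continuous g.
  by move=> t; apply: differentiable_continuous; apply/derivable1_diffP; case: (dgE t).
have p0 : 0 < 2 * pi :> R by rewrite mulr_gt0// pi_gt0.
have := @continuous_FTC2 R dg g 0 (2 * pi) p0.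
rewrite integral_itv_bndoo; last first.
  by apply/measurable_EFinP; apply: measurable_funTS; exact: continuous_measurable_fun.
rewrite gp subee// => -> //.
- exact: continuous_subspaceT.
- split.
  + by move=> x _; case: (dgE x).
  + by apply: cvg_at_right_filter; exact: cg.
  + by apply: cvg_at_left_filter; exact: cg.
- by move=> x _; rewrite derive1E; case: (dgE x).
Qed.

Lemma is_derive_fst psi t y : derivable psi (t, y) e1 ->
  is_derive t (1 : R) (fun t => psi (t, y)) ('D_e1 psi (t, y)).
Proof.
move=> d.
have E : (fun h : R => h^-1 *: (((fun t => psi (t, y)) \o shift t) (h *: (1 : R)) - psi (t, y))) =
         (fun h : R => h^-1 *: ((psi \o shift (t, y)) (h *: e1) - psi (t, y))).
  apply: funext => h /=; congr (_ *: (psi _ - _)).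
  by congr pair; exact: esym (etrans (congr1 (+%R^~ y) (mulr0 h)) (add0r y)).
split; first exact: (eq_ind_r (fun F => cvg (F @ 0^')) d E).
exact: (congr1 (fun F : R -> R => lim (F @ 0^')) E).
Qed.

Lemma is_derive_snd psi t y : derivable psi (t, y) e2 ->
  is_derive y (1 : R) (fun y => psi (t, y)) ('D_e2 psi (t, y)).
Proof.
move=> d.
have E : (fun h : R => h^-1 *: (((fun y => psi (t, y)) \o shift y) (h *: (1 : R)) - psi (t, y))) =
         (fun h : R => h^-1 *: ((psi \o shift (t, y)) (h *: e2) - psi (t, y))).
  apply: funext => h /=; congr (_ *: (psi _ - _)).
  by congr pair; exact: esym (etrans (congr1 (+%R^~ t) (mulr0 h)) (add0r t)).
split; first exact: (eq_ind_r (fun F => cvg (F @ 0^')) d E).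
exact: (congr1 (fun F : R -> R => lim (F @ 0^')) E).
Qed.

Let continuous_pairl (y : R) : continuous (fun t : R => (t, y)).
Proof.
by move=> t; apply: (@cvg_pair _ _ _ (nbhs t) (nbhs t) (nbhs y) _ _ _ id (cst y)); [exact: cvg_id|exact: cvg_cst].
Qed.

Let continuous_pairr (y : R) : continuous (fun t : R => (y, t)).
Proof.
by move=> t; apply: (@cvg_pair _ _ _ (nbhs t) (nbhs y) (nbhs t) _ _ _ (cst y) id); [exact: cvg_cst|exact: cvg_id].
Qed.

(** By Fubini the integral is an iterated one, and along each line the fundamental
    theorem of calculus leaves the difference of two equal boundary values. *)
Lemma integral_derive psi e : axis e -> regular psi ->
  regular (fun x => 'D_e psi x) -> (\int[area]_(x in Omega) 'D_e psi x)%R = 0.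
Proof.
move=> ee [[pp cp dp] _ _] [_ mD bD].
rewrite /Rintegral integral_mkcond.
have ID : area.-integrable setT (((EFin \o (fun x => 'D_e psi x)) \_ Omega)).
  apply/(integrable_mkcond (mu := area) _ mOmega).
  exact: bounded_integrable.
have [dpe cdpe] := dp e ee.
have per1 t y : psi (t + 2 * pi, y) = psi (t, y) by have [] := pp (t, y).
have per2 t y : psi (y, t + 2 * pi) = psi (y, t) by have [] := pp (y, t).
case: ee => ?; subst e.
- rewrite -(integral21_prod_meas1 ID) integral0_eq// => y _.
  rewrite /fubini_G; have [yin|yout] := pselect (`]0, 2 * pi[%classic y); last first.
    apply: integral0_eq => x _; rewrite patchE ifF//; apply/negbTE.
    by apply/negP; rewrite inE => -[].
  transitivity (\int[lebesgue_measure]_(t in `]0%R, (2 * pi)%R[) ('D_e1 psi (t, y))%:E)%E.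
    rewrite [RHS]integral_mkcond; apply: eq_integral => t _.
    rewrite !patchE; have [tin|tout] := pselect (`]0, 2 * pi[%classic t).
      by rewrite !mem_set.
    by rewrite !memNset// => -[].
  apply: (@integral_derive_periodic (fun t => psi (t, y))).
  + by move=> t; exact: is_derive_fst.
  + move=> t; apply: (@continuous_comp _ _ _ (fun t => (t, y)) (fun x => 'D_e1 psi x)); last exact: cdpe.
    exact: continuous_pairl.
  + by rewrite -[2 * pi]add0r per1.
- rewrite -(integral12_prod_meas1 ID) integral0_eq// => y _.
  rewrite /fubini_F; have [yin|yout] := pselect (`]0, 2 * pi[%classic y); last first.
    apply: integral0_eq => x _; rewrite patchE ifF//; apply/negbTE.
    by apply/negP; rewrite inE => -[].
  transitivity (\int[lebesgue_measure]_(t in `]0%R, (2 * pi)%R[) ('D_e2 psi (y, t))%:E)%E.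
    rewrite [RHS]integral_mkcond; apply: eq_integral => t _.
    rewrite !patchE; have [tin|tout] := pselect (`]0, 2 * pi[%classic t).
      by rewrite !mem_set.
    by rewrite !memNset// => -[].
  apply: (@integral_derive_periodic (fun t => psi (y, t))).
  + by move=> t; exact: is_derive_snd.
  + move=> t; apply: (@continuous_comp _ _ _ (fun t => (y, t)) (fun x => 'D_e2 psi x)); last exact: cdpe.
    exact: continuous_pairr.
  + by rewrite -[2 * pi]add0r per2.
Qed.

Lemma trig_ibp e phi psi : axis e -> trig e phi -> trig e psi ->
  dot phi (fun x => 'D_e psi x) = - dot (fun x => 'D_e phi x) psi.
Proof.
move=> ee tp tq; have tpq := trig_mul ee tp tq.
have := integral_derive ee (trig_regular tpq) (trig_regular (trig_derive ee tpq)).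
have [rp rq] := (trig_regular tp, trig_regular tq).
have [sp sq] := (regular_sqint rp, regular_sqint rq).
have sdp := regular_sqint (trig_regular (trig_derive ee tp)).
have sdq := regular_sqint (trig_regular (trig_derive ee tq)).
have [pC _ _] := rp; have [qC _ _] := rq.
under eq_Rintegral do rewrite derive_mul//.
rewrite (RintegralD (mu := area)); last 3 first.
- exact: mOmega.
- exact: sqint_mul.
- exact: sqint_mul.
by rewrite -!/(dot _ _) (dotC psi) => /eqP; rewrite addr_eq0 => /eqP.
Qed.

End IntDerive.

(** * Essentially bounded multipliers *)

(** The norm is an essential supremum for the restricted measure, for which the
    complement of [D] is a null set; the positive mass of [D] excludes the case where
    the norm is 0 by convention. *)
Lemma Linf_mrestrP d (T : measurableType d) (R : realType)
    (mu : {measure set T -> \bar R}) (D : set T) (mD : measurable D)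
    (f : T -> \bar R) (y : \bar R) : (0 < mu D)%E ->
  ('N[mrestr mu mD]_+oo[f] <= y)%E <-> {ae mu, forall x, D x -> (`|f x| <= y)%E}.
Proof.
move=> D0; rewrite unlock /= /mrestr setTI D0; split.
  move=> /ess_sup_inf.ess_supP[N [mN N0 NS]].
  exists (N `&` D); split=> //; first exact: measurableI.
  move=> x nx; have [Dx nle] : D x /\ ~ (`|f x| <= y)%E.
    by apply: contrapT => h; apply: nx => Dx; apply: contrapT => h'; apply: h.
  by split=> //; apply: NS.
move=> [N [mN N0 NS]]; apply/ess_sup_inf.ess_supP; exists (~` D `|` N); split.
- by apply: measurableU => //; exact: measurableC.
- apply/eqP; rewrite -measure_le0 -N0; apply: le_measure; rewrite ?inE.
  + by apply: measurableI => //; apply: measurableU => //; exact: measurableC.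
  + exact: mN.
  + by move=> x [[|]].
- move=> x nx; have [Dx|] := pselect (D x); last by left.
  by right; apply: NS => h; apply: nx; exact: h.
Qed.

Definition ae_bounded {R : realType} (M : R) (u : sfield R) : Prop :=
  {ae area, forall x, Omega x -> `|u x| <= M}.

Section AeBounded.
Context {R : realType}.

Lemma mul_ae_bounded (u f : sfield R) (M : R) : measurable_fun setT u -> 0 <= M ->
  ae_bounded M u -> sqint f ->
  sqint (fun x => u x * f x) /\ norm2 (fun x => u x * f x) <= M * norm2 f.
Proof.
move=> mu M0 bu sf; have sMf := sqintZ M sf.
have mf := sf.1.
have meas (g : sfield R) : measurable_fun setT g ->
    measurable_fun Omega (fun x => (g x ^+ 2)%:E).
  by move=> mg; apply/measurable_EFinP; apply: measurable_funTS; exact: measurable_funX.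
have muf : measurable_fun setT (fun x => u x * f x) by exact: measurable_funM.
have le : (\int[area]_(x in Omega) ((u x * f x) ^+ 2)%:E <=
           \int[area]_(x in Omega) ((M * f x) ^+ 2)%:E)%E.
  apply: (ae_ge0_le_integral (mu := area)).
  - exact: mOmega.
  - by move=> x _; rewrite lee_fin sqr_ge0.
  - exact: meas.
  - by move=> x _; rewrite lee_fin sqr_ge0.
  - by apply: meas; case: sMf.
  - case: bu => N [mN N0 NS]; exists N; split=> // x nx; apply: NS => bx.
    apply: nx => Ox; rewrite lee_fin !exprMn ler_wpM2r ?sqr_ge0//.
    by rewrite -(real_normK (num_real (u x))) lerXn2r// ?nnegrE//; exact: bx.
have fin : (\int[area]_(x in Omega) ((M * f x) ^+ 2)%:E)%E \is a fin_num.
  exact: (integrable_fin_num (mu := area) mOmega sMf.2).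
have suf : sqint (fun x => u x * f x).
  split=> //; apply/integrableP; split; first exact: meas.
  under eq_integral do rewrite gee0_abs ?lee_fin ?sqr_ge0//.
  by apply: le_lt_trans le _; rewrite ltey_eq fin.
split=> //.
have -> : M * norm2 f = norm2 (fun x => M * f x).
  by rewrite /norm2 dotZl// dotZr// mulrA -expr2 sqrtrM ?sqr_ge0// sqrtr_sqr ger0_norm.
rewrite ler_sqrt ?dot_ge0// /dot /Rintegral.
under [X in fine X <= _]eq_integral do rewrite -expr2.
under [X in _ <= fine X]eq_integral do rewrite -expr2.
apply: fine_le => //.
exact: (integrable_fin_num (mu := area) mOmega suf.2).
Qed.

Lemma sqint_regular_mul (psi f : sfield R) : regular psi -> sqint f ->
  sqint (fun x => psi x * f x).
Proof.
move=> [_ mp [M bM]] sf; apply: (mul_ae_bounded mp (normr_ge0 M) _ sf).1.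
by apply: aeW => x _; rewrite (le_trans (bM x))// ler_norm.
Qed.

Lemma ae_boundedW (m M : R) (phi : sfield R) : m <= M ->
  ae_bounded m phi -> ae_bounded M phi.
Proof.
move=> mM [N [mN N0 NS]]; exists N; split; [exact: mN|exact: N0|].
by move=> x nx; apply: NS => h; apply: nx => Ox; exact: le_trans (h Ox) mM.
Qed.

Lemma Lp_norm_ae (phi : sfield R) (c : R) : (Lp_norm +oo phi <= c%:E)%E -> ae_bounded c phi.
Proof.
have O0 : (0 < area (@Omega R))%E by rewrite area_Omega lte_fin !mulr_gt0// pi_gt0.
rewrite /Lp_norm => /(Linf_mrestrP (mu := area) (@measurable_Omega R) _ _ O0)[N [mN N0 NS]].
by exists N; split=> // x nx; apply: NS => h; apply: nx => Ox; rewrite -lee_fin; exact: h.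
Qed.

End AeBounded.

(** * Mean-square approximation by trigonometric polynomials *)

Section Density.
Context {R : realType}.
Implicit Types (f g phi psi : sfield R).
Variable e : R * R.
Hypothesis ee : axis e.

Lemma norm2_ge0 f : 0 <= norm2 f. Proof. exact: sqrtr_ge0. Qed.

Lemma norm2D f g : sqint f -> sqint g ->
  norm2 (fun x => f x + g x) <= norm2 f + norm2 g.
Proof.
move=> sf sg; rewrite -[leRHS]ger0_norm ?addr_ge0 ?norm2_ge0//.
rewrite -(sqrtr_sqr (norm2 f + norm2 g)) ler_sqrt ?sqr_ge0//.
have sfg := sqintD sf sg.
rewrite dotDl// (dotC f) (dotC g) !dotDl// (dotC g f) sqrrD !norm2_sqr.
have := le_trans (ler_norm _) (dot_CS sf sg); lra.
Qed.

Lemma norm2_mul_bounded f g M : sqint f -> measurable_fun setT g -> 0 <= M ->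
  (forall x, `|g x| <= M) ->
  sqint (fun x => f x * g x) /\ norm2 (fun x => f x * g x) <= M * norm2 f.
Proof.
move=> sf mg M0 bg; have E : (fun x => f x * g x) = (fun x => g x * f x).
  by apply: funext => x; rewrite mulrC.
by rewrite E; apply: mul_ae_bounded => //; apply: aeW => x _; exact: bg.
Qed.

(** The strategy is that of measure theory: this class contains trigonometric
    polynomials, is closed under sums, bounded products and dominated limits, and
    therefore contains indicators of rays, of measurable sets, simple functions, and
    in the end every square integrable function. *)
Definition approximable f := sqint f /\
  forall eps, 0 < eps -> exists psi, trig e psi /\ norm2 (fun x => f x - psi x) < eps.

Lemma trig_sqint psi : trig e psi -> sqint psi.
Proof. by move=> /trig_regular; exact: regular_sqint. Qed.

Lemma approximable_trig psi : trig e psi -> approximable psi.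
Proof.
move=> tp; split; first exact: trig_sqint.
move=> eps e0; exists psi; split=> //.
have -> : (fun x => psi x - psi x) = (fun x => 0 * psi x).
  by apply: funext => x; rewrite subrr mul0r.
by rewrite /norm2 dotZl ?mul0r ?sqrtr0//; [exact: trig_sqint|exact: sqintZ (trig_sqint tp)].
Qed.

Lemma approximable_add f g : approximable f -> approximable g ->
  approximable (fun x => f x + g x).
Proof.
move=> [sf af] [sg ag]; split; first exact: sqintD.
move=> eps e0; have [p [tp hp]] := af _ (divr_gt0 e0 (ltr0n _ 2)).
have [q [tq hq]] := ag _ (divr_gt0 e0 (ltr0n _ 2)).
exists (fun x => p x + q x); split; first exact: trig_add.
have -> : (fun x => f x + g x - (p x + q x)) = (fun x => (f x - p x) + (g x - q x)).
  by apply: funext => x; ring.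
apply: (le_lt_trans (norm2D _ _)).
- by apply: sqintB => //; exact: trig_sqint.
- by apply: sqintB => //; exact: trig_sqint.
- lra.
Qed.

Lemma approximable_mul f g : approximable f -> approximable g ->
  (exists M, forall x, `|g x| <= M) -> approximable (fun x => f x * g x).
Proof.
move=> [sf af] [sg ag] [M0 bg0].
pose M := `|M0| + 1.
have Mp : 0 < M by rewrite ltr_wpDl.
have bg x : `|g x| <= M by rewrite (le_trans (bg0 x))// (le_trans (ler_norm _))// lerDl.
split; first by have [] := norm2_mul_bounded sf sg.1 (ltW Mp) bg.
move=> eps e0.
have [p [tp hp]] := af _ (divr_gt0 (divr_gt0 e0 (ltr0n _ 2)) Mp).
have [_ mp [N0 bp0]] := trig_regular tp.
pose N := `|N0| + 1.
have Np : 0 < N by rewrite ltr_wpDl.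
have bp x : `|p x| <= N by rewrite (le_trans (bp0 x))// (le_trans (ler_norm _))// lerDl.
have [q [tq hq]] := ag _ (divr_gt0 (divr_gt0 e0 (ltr0n _ 2)) Np).
exists (fun x => p x * q x); split; first exact: trig_mul.
have -> : (fun x => f x * g x - p x * q x) =
          (fun x => (f x - p x) * g x + (g x - q x) * p x).
  by apply: funext => x; ring.
have sfp := sqintB sf (trig_sqint tp).
have sgq := sqintB sg (trig_sqint tq).
have [s1 n1] := norm2_mul_bounded sfp sg.1 (ltW Mp) bg.
have [s2 n2] := norm2_mul_bounded sgq mp (ltW Np) bp.
apply: (le_lt_trans (norm2D s1 s2)).
have h1 : M * norm2 (fun x => f x - p x) < eps / 2.
  by rewrite mulrC -ltr_pdivlMr.
have h2 : N * norm2 (fun x => g x - q x) < eps / 2.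
  by rewrite mulrC -ltr_pdivlMr.
lra.
Qed.

Lemma approximable_scale c f : approximable f -> approximable (fun x => c * f x).
Proof.
move=> af; have := approximable_mul af (approximable_trig (trig_cst e c)).
move=> /(_ _)/wrap[]; first by exists `|c|.
by congr approximable; apply: funext => x; rewrite mulrC.
Qed.

Lemma approximable_limit (f_ : nat -> sfield R) f (G : sfield R) :
  (forall n, approximable (f_ n)) -> sqint f ->
  area.-integrable Omega (EFin \o G) ->
  (forall n x, Omega x -> (f_ n x - f x) ^+ 2 <= G x) ->
  (forall x, Omega x -> f_ ^~ x @ \oo --> f x) ->
  approximable f.
Proof.
move=> af sf iG dom cv; split=> // eps e0.
pose h n x := ((f_ n x - f x) ^+ 2)%:E.
have sd n := sqintB (af n).1 sf.
have [|||||_ _] := @dominated_convergence _ _ R area Omega mOmega h (cst 0%E) (EFin \o G).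
- move=> n; apply/measurable_EFinP; apply: measurable_funTS.
  by apply: measurable_funX; case: (sd n).
- exact: measurable_cst.
- apply/aeW => x Ox; rewrite /h; apply: cvg_EFin; first by near=> n.
  have -> : (0 : R) = (f x - f x) ^+ 2 by rewrite subrr expr0n.
  rewrite expr2; under eq_fun do rewrite /= expr2.
  by apply: cvgM; (apply: cvgB; [exact: cv|exact: cvg_cst]).
- exact: iG.
- by apply/aeW => x n Ox; rewrite /h /= lee_fin ger0_norm ?sqr_ge0//; exact: dom.
rewrite integral0 => /fine_cvg /= hc.
have e2 : 0 < (eps / 2) ^+ 2 by rewrite exprn_gt0// divr_gt0.
move/cvgrPdist_lt : hc => /(_ _ e2)[n _ /(_ n (leqnn n))] /=.
rewrite sub0r normrN => hn.
have {hn} hn : norm2 (fun x => f_ n x - f x) < eps / 2.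
  rewrite -[ltRHS]ger0_norm ?divr_ge0 ?ltW// -sqrtr_sqr ltr_sqrt//.
  by apply: le_lt_trans hn; rewrite /dot; under eq_Rintegral do rewrite -expr2; exact: ler_norm.
have [p [tp hp]] := (af n).2 _ (divr_gt0 e0 (ltr0n _ 2)).
exists p; split=> //.
have -> : (fun x => f x - p x) = (fun x => (-1) * (f_ n x - f x) + (f_ n x - p x)).
  by apply: funext => x; ring.
apply: (le_lt_trans (norm2D (sqintZ _ (sd n)) (sqintB (af n).1 (trig_sqint tp)))).
have -> : norm2 (fun x => -1 * (f_ n x - f x)) = norm2 (fun x => f_ n x - f x).
  by rewrite /norm2 dotZl ?dotZr//; [rewrite mulrA mulrNN !mul1r|exact: sqintZ].
lra.
Unshelve. all: by end_near.
Qed.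

End Density.

(** * Density of the trigonometric polynomials *)

Section Indicators.
Context {R : realType}.

Lemma bernoulli_le (x : R) k : -1 <= x -> 1 + k%:R * x <= (1 + x) ^+ k.
Proof.
move=> x1; elim: k => [|k IH]; first by rewrite mul0r addr0 expr0.
rewrite exprS -natr1; have k0 : 0 <= k%:R :> R := ler0n _ k.
have h1 : 0 <= 1 + x by lra.
apply: le_trans (ler_wpM2l h1 IH).
rewrite -subr_ge0 (_ : _ - _ = k%:R * x ^+ 2); last by ring.
by rewrite mulr_ge0// sqr_ge0.
Qed.

(** The polynomials (1 - y^n)^(2^n) of the Stone-Weierstrass theorem converge to a step
    at 1/2 for 0 <= y <= 1.  The additional factor n in the exponent makes them
    converge to 0 at y = 1/2 as well. *)
Definition step_poly (n : nat) (y : R) : R := (1 - y ^+ n) ^+ (n * 2 ^ n).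

Lemma step_poly_ge0_le1 n (y : R) : 0 <= y <= 1 -> 0 <= step_poly n y <= 1.
Proof.
move=> /andP[y0 y1]; have t1 : y ^+ n <= 1 by rewrite exprn_ile1.
have t0 : 0 <= y ^+ n by rewrite exprn_ge0.
by rewrite exprn_ge0 ?exprn_ile1//; lra.
Qed.

Lemma cvg_mulr_geometric (q : R) : 0 <= q < 1 -> (n%:R * q ^+ n) @[n --> \oo] --> (0 : R).
Proof.
move=> /andP[q0 q1]; pose r := Num.sqrt q.
have [q00|qn0] := eqVneq q 0.
  apply: cvg_near_cst; exists 1%N => //= n n1.
  by rewrite q00 expr0n -(prednK n1) mulr0.
have r0 : 0 < r by rewrite sqrtr_gt0 lt_neqAle eq_sym qn0.
have r1 : r < 1 by rewrite -sqrtr1 ltr_sqrt.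
have rr : r * r = q by rewrite -expr2 sqr_sqrtr.
(* by Bernoulli's inequality for 1 + h = r^-1 the factor n r^n stays bounded *)
pose h := r^-1 - 1.
have h0 : 0 < h by rewrite subr_gt0 invf_gt1.
have b n : n%:R * r ^+ n <= h^-1.
  have := @bernoulli_le h n _; rewrite (_ : 1 + h = r^-1); last by rewrite /h; ring.
  move=> /(_ _)/wrap[]; first by lra.
  rewrite exprVn => H.
  have rn : 0 < r ^+ n by rewrite exprn_gt0.
  have : n%:R * r ^+ n * h * (r ^+ n)^-1 <= (r ^+ n)^-1.
    by rewrite (_ : _ * _ = n%:R * h); [lra|field; rewrite gt_eqF].
  by rewrite ler_pdivrMr// mulVf ?gt_eqF// => ?; rewrite -[leRHS]mul1r ler_pdivlMr.
apply: (@squeeze_cvgr _ _ _ _ (cst 0) (fun n => h^-1 * r ^+ n)).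
- near=> n; rewrite /= mulr_ge0 ?exprn_ge0//=.
  by rewrite -rr exprMn mulrA ler_wpM2r ?b// exprn_ge0// ltW.
- exact: cvg_cst.
- rewrite -[X in _ --> X](mulr0 h^-1); apply: cvgM; first exact: cvg_cst.
  by apply: cvg_expr; rewrite ger0_norm// ltW.
Unshelve. all: by end_near.
Qed.

(** Both halves are Bernoulli's inequality: below 1/2 the value is at least
    1 - n (2 y)^n, and from 1/2 on it is at most 1 / (1 + n (2 y)^n). *)
Lemma cvg_step_poly (y : R) : 0 <= y <= 1 ->
  step_poly n y @[n --> \oo] --> (if y < 1 / 2 then 1 else 0 : R).
Proof.
move=> y01; have /andP[y0 y1] := y01.
have pow2 n : (2 ^ n)%N%:R = 2 ^+ n :> R by rewrite natrX.
case: ltP => yh.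
  apply: (@squeeze_cvgr _ _ _ _ (fun n => 1 - n%:R * (2 * y) ^+ n) (cst 1)).
  - near=> n; rewrite (andP (step_poly_ge0_le1 n y01)).2 andbT /step_poly.
    have -> : n%:R * (2 * y) ^+ n = (n * 2 ^ n)%N%:R * y ^+ n.
      by rewrite natrM pow2 exprMn mulrA.
    rewrite -mulrN; apply: bernoulli_le; rewrite lerN2.
    by rewrite exprn_ile1.
  - rewrite -[X in _ --> X]subr0; apply: cvgB; first exact: cvg_cst.
    by apply: cvg_mulr_geometric; lra.
  - exact: cvg_cst.
apply: (@squeeze_cvgr _ _ _ _ (cst 0) (fun n => n.+1%:R^-1)).
- near=> n; rewrite (andP (step_poly_ge0_le1 n y01)).1 /= /step_poly.
  set k := (n * 2 ^ n)%N; set t := y ^+ n.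
  have t0 : 0 <= t by rewrite exprn_ge0.
  have t1 : t <= 1 by rewrite exprn_ile1.
  have kt : n%:R <= k%:R * t.
    rewrite /k natrM pow2 -mulrA -[leLHS]mulr1 ler_wpM2l// /t -exprMn.
    by rewrite exprn_ege1//; lra.
  rewrite -[leRHS]div1r ler_pdivlMr ?ltr0n//.
  apply: (@le_trans _ _ ((1 - t) ^+ k * (1 + t) ^+ k)).
    apply: ler_wpM2l; first by rewrite exprn_ge0// subr_ge0.
    by apply: le_trans (@bernoulli_le t k _); rewrite -?natr1; lra.
  by rewrite -exprMn exprn_ile1//; nra.
- exact: cvg_cst.
- exact: cvg_harmonic.
Unshelve. all: by end_near.
Qed.

Variable e : R * R.
Hypothesis ee : axis e.

Lemma trig_step_poly n psi : trig e psi -> trig e (fun x => step_poly n (psi x)).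
Proof.
move=> tp; apply: (trig_exp _ ee).
by apply: (trig_sub ee (trig_cst e 1)); exact: trig_exp.
Qed.

(** A trigonometric polynomial of degree one with values between 0 and 1 that crosses
    1/2 exactly at [a] inside the period: composed with [step_poly] it yields the
    indicator of a ray.  The factored form is [arcE]. *)
Definition arc (a t : R) : R :=
  (1 - 2^-1 * (cos (a / 2) * (1 - cos t) - sin (a / 2) * sin t)) / 2.

Lemma arcE a t : arc a t = (1 - sin (t / 2) * sin ((t - a) / 2)) / 2.
Proof.
rewrite /arc; congr ((1 - _) / 2).
have -> : (t - a) / 2 = t / 2 - a / 2 by field.
rewrite sinB.
have tE : t = t / 2 + t / 2 by field.
rewrite {1 2}tE cosD sinD.
have := cos2Dsin2 (t / 2) => H.
have -> : cos (t / 2) * cos (t / 2) = 1 - sin (t / 2) ^+ 2 by rewrite -expr2; lra.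
by field.
Qed.

Lemma arc_ge0_le1 a t : 0 <= arc a t <= 1.
Proof.
rewrite arcE.
have : `|sin (t / 2) * sin ((t - a) / 2)| <= 1.
  by rewrite normrM -[leRHS]mulr1 ler_pM// ler_norml sin_geN1 sin_le1.
rewrite ler_norml => /andP[? ?]; lra.
Qed.

Lemma arc_lt a t : 0 <= a <= 2 * pi -> 0 < t < 2 * pi -> (arc a t < 1 / 2) = (a < t).
Proof.
move=> /andP[a0 a1] /andP[t0 t1]; rewrite arcE.
have st : 0 < sin (t / 2) by apply: sin_gt0_pi; lra.
have -> : ((1 - sin (t / 2) * sin ((t - a) / 2)) / 2 < 1 / 2) =
          (0 < sin (t / 2) * sin ((t - a) / 2)) by apply/idP/idP => ?; lra.
rewrite pmulr_rgt0//; case: (ltP a t) => h.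
  by apply: sin_gt0_pi; lra.
apply/negbTE; rewrite -leNgt.
have -> : (t - a) / 2 = - ((a - t) / 2) by field.
by rewrite sinN oppr_le0; apply: sin_ge0_pi; lra.
Qed.

Lemma sqint_indic (E : set (R * R)) : measurable E -> sqint (\1_E : sfield R).
Proof.
move=> mE; split; first exact: measurable_indic.
apply: bounded_integrable; first by apply: measurable_funX; exact: measurable_indic.
by exists 1 => x; rewrite indicE; case: (_ \in _); rewrite /= ?expr1n ?expr0n/= ?normr1 ?normr0.
Qed.

Lemma integrable_cst1 : area.-integrable (@Omega R) (EFin \o cst 1).
Proof. by apply: bounded_integrable; [exact: measurable_cst|exists 1 => x; rewrite normr1]. Qed.

(** The projection [p] is one of the two coordinates.  Clamping [a] to the period
    changes the ray only outside [Omega]. *)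
Lemma approximable_ray (p : R * R -> R) (a : R) :
  (forall x, Omega x -> 0 < p x < 2 * pi) -> measurable_fun setT p ->
  (forall a b, trig e (fun x => a * cos (p x) + b * sin (p x))) ->
  approximable e \1_(p @^-1` `]a, +oo[).
Proof.
move=> pO mp tp.
have mE : measurable (p @^-1` `]a, +oo[).
  by rewrite -[X in measurable X]setTI; apply: mp => //; exact: measurable_itv.
(* arc needs a threshold inside the period *)
pose a' := Num.max 0 (Num.min a (2 * pi)).
have pi2 : 0 < 2 * pi :> R by rewrite mulr_gt0// pi_gt0.
have a'01 : 0 <= a' <= 2 * pi.
  by rewrite /a' le_max lexx /= ge_max ge_min lexx orbT (ltW pi2).
have aa' t : 0 < t < 2 * pi -> (a < t) = (a' < t).
  move=> /andP[t0 t1]; rewrite /a' gt_max t0 /= gt_min.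
  by rewrite [X in _ || X]ltNge (ltW t1) orbF.
have indE x : Omega x -> \1_(p @^-1` `]a, +oo[) x = (if arc a' (p x) < 1 / 2 then 1 else 0) :> R.
  move=> /pO xO; rewrite arc_lt// -aa'// indicE.
  rewrite (_ : (_ \in _) = (a < p x)); first by case: ifP.
  by apply/idP/idP; rewrite inE /= in_itv /= andbT.
have ta : trig e (fun x => arc a' (p x)).
  have := trig_add (trig_cst e ((1 - 2^-1 * cos (a' / 2)) / 2))
           (tp (2^-1 * cos (a' / 2) / 2) (2^-1 * sin (a' / 2) / 2)).
  by congr trig; apply: funext => x; rewrite /arc /=; field.
apply: (@approximable_limit _ e (fun n x => step_poly n (arc a' (p x))) _ (cst 1)).
- by move=> n; apply: approximable_trig; exact: trig_step_poly.
- exact: sqint_indic.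
- exact: integrable_cst1.
- move=> n x Ox /=; rewrite indE//.
  have := step_poly_ge0_le1 n (arc_ge0_le1 a' (p x)) => /andP[h1 h2].
  by case: (_ < _) => /=; nra.
- by move=> x Ox; rewrite indE//; apply: cvg_step_poly; exact: arc_ge0_le1.
Qed.

Lemma approximable_setC (E : set (R * R)) :
  approximable e \1_E -> approximable e \1_(~` E).
Proof.
move=> aE; have := approximable_add (approximable_trig (trig_cst e 1)) (approximable_scale ee (-1) aE).
by congr approximable; apply: funext => x; rewrite !indicE in_setC /=; case: (_ \in _) => /=; ring.
Qed.

Lemma indic_bounded (E : set (R * R)) : exists M : R, forall x, `|\1_E x| <= M.
Proof. by exists 1 => x; rewrite indicE; case: (_ \in _); rewrite /= ?normr1 ?normr0. Qed.

Lemma approximable_setI (E F : set (R * R)) :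
  approximable e \1_E -> approximable e \1_F -> approximable e \1_(E `&` F).
Proof.
move=> aE aF; have := approximable_mul ee aE aF (indic_bounded F).
by congr approximable; apply: funext => x; rewrite indicI.
Qed.

Lemma approximable_bigcup (E : nat -> set (R * R)) :
  (forall n, measurable (E n)) -> (forall n, approximable e \1_(E n)) ->
  approximable e \1_(\bigcup_n E n).
Proof.
move=> mE aE.
pose U n := \big[setU/set0]_(k < n) E k.
have aU n : approximable e \1_(U n).
  elim: n => [|n IH].
    have := approximable_trig (trig_cst e (0 : R)).
    by congr approximable; apply: funext => x; rewrite /U big_ord0 indic0.
  rewrite /U big_ord_recr /= -[_ `|` _]setCK setCU.
  by apply: approximable_setC; apply: approximable_setI; apply: approximable_setC.
have xU n x : (x \in U n) = [exists k : 'I_n, x \in E k].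
  rewrite /U -bigcup_mkord; apply/idP/existsP => [|[k]]; rewrite !inE.
    by move=> [k /= kn Ek]; exists (Ordinal kn); rewrite inE.
  by move=> Ek; exists k => //=.
apply: (@approximable_limit _ e (fun n => \1_(U n)) _ (cst 1)) => //.
- by apply: sqint_indic; exact: bigcup_measurable.
- exact: integrable_cst1.
- by move=> n x _; rewrite /= !indicE; case: (_ \in _); case: (_ \in _) => /=; nra.
- move=> x _; apply: cvg_near_cst.
  have [[k _ Ek]|nE] := pselect ((\bigcup_n E n) x).
    exists k.+1 => //= n kn; rewrite !indicE xU [in RHS]mem_set; last by exists k.
    by congr ((_ : bool)%:R); apply/existsP; exists (Ordinal kn); rewrite inE.
  exists 0%N => //= n _; rewrite !indicE xU [in RHS]memNset//.
  congr ((_ : bool)%:R); apply/negbTE; apply/existsP => -[k]; rewrite inE => Ek.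
  by apply: nE; exists k.
Qed.

(** The rays form a pi-system that generates the Borel sets, and the approximable sets
    form a Dynkin system. *)
Lemma approximable_preimage (p : R * R -> R) (A : set R) :
  (forall x, Omega x -> 0 < p x < 2 * pi) -> measurable_fun setT p ->
  (forall a b, trig e (fun x => a * cos (p x) + b * sin (p x))) ->
  measurable A -> approximable e \1_(p @^-1` A).
Proof.
move=> pO mp tp mA.
have mpA B : measurable B -> measurable (p @^-1` B).
  by move=> mB; rewrite -[X in measurable X]setTI; exact: mp.
apply: (@dynkin_induction _ (measurableTypeR R) (@RGenOInfty.G R)
  (fun B => approximable e \1_(p @^-1` B))).
- exact: RGenOInfty.measurableE.
- move=> _ _ [x ->] [y ->]; exists (Num.max x y).
  by apply/seteqP; split=> z /=; rewrite !in_itv /= !andbT gt_max => /andP.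
- have := approximable_trig (trig_cst e (1 : R)).
  by congr approximable; apply: funext => x; rewrite preimage_setT indicT.
- move=> _ [x ->]; exact: approximable_ray.
- by move=> S mS; rewrite preimage_setC; exact: approximable_setC.
- move=> F mF _ aF; rewrite preimage_bigcup; apply: approximable_bigcup => // n.
  exact: (mpA _ (mF n)).
- by have : (@ocitv R).-sigma.-measurable A by []; rewrite RGenOInfty.measurableE.
Qed.

Lemma approximable_indic (E : set (R * R)) : measurable E -> approximable e \1_E.
Proof.
move=> mE.
apply: (@dynkin_induction _ (measurableTypeR R * measurableTypeR R)%type
  [set A `*` B | A in measurable & B in measurable]
  (fun E => approximable e \1_E)).
- exact: measurable_prod_measurableType.
- move=> _ _ [A mA [B mB <-]] [C mC [D mD <-]].
  exists (A `&` C); first exact: measurableI.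
  by exists (B `&` D); [exact: measurableI|rewrite setXI].
- have := approximable_trig (trig_cst e (1 : R)).
  by congr approximable; apply: funext => x; rewrite indicT.
- move=> _ [A mA [B mB <-]].
  have -> : A `*` B = (fst @^-1` A) `&` (snd @^-1` B) by [].
  apply: approximable_setI.
    apply: approximable_preimage => //.
    + by move=> x [/= ]; rewrite in_itv.
    + by move=> a b; exact: trig_x.
  apply: approximable_preimage => //.
  + by move=> x [/= _]; rewrite in_itv.
  + by move=> a b; exact: trig_y.
- by move=> S _; exact: approximable_setC.
- by move=> F mF _ aF; exact: approximable_bigcup.
- by rewrite -measurable_prod_measurableType.
Qed.

Import HBNNSimple.

Lemma approximable_sum (I : choiceType) (s : seq I) (c : I -> R) (F : I -> sfield R) :
  (forall i, approximable e (F i)) ->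
  approximable e (fun x => \sum_(i <- s) c i * F i x).
Proof.
move=> aF; elim: s => [|i s IH].
  have := approximable_trig (trig_cst e (0 : R)).
  by congr approximable; apply: funext => x; rewrite big_nil.
have := approximable_add (approximable_scale ee (c i) (aF i)) IH.
by congr approximable; apply: funext => x; rewrite big_cons.
Qed.

Lemma approximable_nnsfun (s : {nnsfun (measurableTypeR R * measurableTypeR R)%type >-> R}) :
  approximable e s.
Proof.
have aF (r : R) : approximable e (\1_(s @^-1` [set r]) : sfield R).
  apply: approximable_indic; have ms : measurable_fun setT s by [].
  by rewrite -[X in measurable X]setTI; apply: ms => //; exact: measurable_set1.
have := approximable_sum (finmap.enum_fset (fset_set (range s))) id aF.
congr approximable; apply: funext => x.
by rewrite [RHS]fimfunE fsbig_finite//=.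
Qed.

Lemma approximable_ge0 (f : sfield R) : sqint f -> (forall x, 0 <= f x) -> approximable e f.
Proof.
move=> sf f0.
have mf : measurable_fun (setT : set (measurableTypeR R * measurableTypeR R)) (EFin \o f).
  by apply/measurable_EFinP; case: sf.
pose f_ := nnsfun_approx measurableT mf.
have fpos x : setT x -> (0 <= (EFin \o f) x)%E by rewrite lee_fin.
have cv x : f_ n x @[n --> \oo] --> f x.
  have := cvg_nnsfun_approx measurableT mf fpos (I : setT x).
  by move/fine_cvg.
have le n x : f_ n x <= f x.
  have nd : nondecreasing_seq (fun n => f_ n x).
    by move=> m k mk; have /lefP := nd_nnsfun_approx measurableT mf mk; apply.
  have := nondecreasing_cvgn_le nd (cvgP _ (cv x)) n.
  by rewrite (cvg_lim _ (cv x)).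
apply: (@approximable_limit _ e f_ f (fun x => f x ^+ 2)).
- by move=> n; exact: approximable_nnsfun.
- exact: sf.
- by case: sf.
- move=> n x _; have := le n x; have : 0 <= f_ n x by exact: fun_ge0.
  move=> h1 h2; rewrite -subr_ge0 (_ : _ - _ = f_ n x * (2 * f x - f_ n x)); last by ring.
  by rewrite mulr_ge0//; have := f0 x; lra.
- by move=> x _; exact: cv.
Qed.

Theorem approximable_sqint (f : sfield R) : sqint f -> approximable e f.
Proof.
move=> sf; have [mf If] := sf.
have part (g : sfield R) : measurable_fun setT g -> (forall x, 0 <= g x <= `|f x|) -> approximable e g.
  move=> mg bg; apply: approximable_ge0; last by move=> x; case/andP: (bg x).
  split=> //; apply: (le_integrable (mu := area) mOmega _ _ If).
    by apply/measurable_EFinP; apply: measurable_funTS; exact: measurable_funX.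
  move=> x _; rewrite /= lee_fin !ger0_norm ?sqr_ge0//.
  rewrite -[leRHS](real_normK (num_real (f x))) lerXn2r// ?nnegrE//; by case/andP: (bg x).
have aN : approximable e (fun x => (`|f x| + f x) / 2).
  apply: part.
    by apply: measurable_funM => //; apply: measurable_funD => //; exact: measurableT_comp.
  by move=> x; have := ler_norm (f x); have := ler_norm (- f x); rewrite normrN; lra.
have aP : approximable e (fun x => (`|f x| - f x) / 2).
  apply: part.
    by apply: measurable_funM => //; apply: measurable_funB => //; exact: measurableT_comp.
  by move=> x; have := ler_norm (f x); have := ler_norm (- f x); rewrite normrN; lra.
have := approximable_add aN (approximable_scale ee (-1) aP).
by congr approximable; apply: funext => x; field.
Qed.

End Indicators.

(** * Weak derivatives of square integrable functions *)

(** Weak derivatives without the periodicity clause and tested against the class [trig]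
    only: enough to determine the derivative by density, and products stay in it with
    no more than square integrability to check. *)
Definition trig_weak {R : realType} (e : R * R) (phi g : sfield R) : Prop :=
  sqint g /\ forall psi, trig e psi -> dot phi (fun x => 'D_e psi x) = - dot g psi.

Section Weak.
Context {R : realType}.
Implicit Types (f g h u v w phi psi chi : sfield R).

Lemma dot0_null f h : sqint f -> sqint h -> dot f f = 0 -> dot f h = 0.
Proof.
move=> sf sh f0; have := dot_CS sf sh.
by rewrite {1}/norm2 f0 sqrtr0 mul0r normr_le0 => /eqP.
Qed.

Lemma eps_le0 (a c : R) : 0 <= c -> (forall eps, 0 < eps -> a <= c * eps) -> a <= 0.
Proof.
move=> c0 H; apply/ler_addgt0Pr => eps e0; rewrite add0r.
have c1 : 0 < c + 1 by lra.
have := H _ (divr_gt0 e0 c1) => /le_trans; apply.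
by rewrite mulrA ler_pdivrMr//; nra.
Qed.

Variable e : R * R.
Hypothesis ee : axis e.

Lemma dot_orthogonal_trig g : sqint g -> (forall psi, trig e psi -> dot g psi = 0) ->
  forall h, sqint h -> dot g h = 0.
Proof.
move=> sg og h sh; apply/eqP; rewrite -normr_le0.
apply: (@eps_le0 _ (norm2 g)); first exact: norm2_ge0.
move=> eps e0; have [_ /(_ _ e0)[p [tp hp]]] := approximable_sqint ee sh.
have sp := trig_sqint tp.
have -> : dot g h = dot g (fun x => h x - p x) by rewrite dotBr// (og p)// subr0.
apply: le_trans (dot_CS sg (sqintB sh sp)) _.
by rewrite ler_wpM2l ?norm2_ge0// ltW.
Qed.

Lemma invariant_sqint (I : finType) (b : I -> sfield R) D (c : I -> R) :
  invariant_family e b D -> sqint (fun x => \sum_i c i * b i x).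
Proof. by move=> fb; apply: (@trig_sqint _ e); exists I, b, D; split=> //; exists c. Qed.

Definition spanned (I : finType) (b : I -> sfield R) : set (sfield R) :=
  [set psi | exists c : I -> R, psi = fun x => \sum_i c i * b i x].

Lemma projection (I : finType) (b : I -> sfield R) D h :
  invariant_family e b D -> sqint h ->
  exists p, spanned b p /\ forall psi, spanned b psi -> dot p psi = dot h psi.
Proof.
move=> fb sh; have sS v : spanned b v -> sqint v by move=> [c ->]; exact: invariant_sqint fb.
apply: (@riesz R _ (spanned b) dot (dot h) I b).
- exists (fun=> 0); apply: funext => x; rewrite big1// => i _; exact: mul0r.
- move=> a u v [c ->] [d ->]; exists (fun i => a * c i + d i); apply: funext => x /=.
  change (a * (\sum_i c i * b i x) + \sum_i d i * b i x = \sum_i (a * c i + d i) * b i x).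
  rewrite mulr_sumr -big_split /=.
  by apply: eq_bigr => i _; rewrite mulrDl mulrA.
- move=> v [c ->]; exists c; apply: funext => x.
  by rewrite fct_sumE.
- by move=> u v _ _; exact: dotC.
- move=> a u v w /sS su /sS sv /sS sw; rewrite -dotZl// -dotDl//; exact: sqintZ.
- by move=> u _; exact: dot_ge0.
- move=> a u v /sS su /sS sv; rewrite dotC (dotC h) (dotC h) -dotZl// -dotDl//; exact: sqintZ.
- by move=> u /sS su u0; rewrite dotC; exact: dot0_null.
Qed.

Lemma projection_best (I : finType) (b : I -> sfield R) D h p q :
  invariant_family e b D -> sqint h -> spanned b p -> spanned b q ->
  (forall psi, spanned b psi -> dot p psi = dot h psi) ->
  norm2 (fun x => h x - p x) <= norm2 (fun x => h x - q x).
Proof.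
move=> fb sh Sp Sq ph.
have sp : sqint p by case: Sp => c ->; exact: invariant_sqint fb.
have sq : sqint q by case: Sq => c ->; exact: invariant_sqint fb.
have shp := sqintB sh sp; have shq := sqintB sh sq.
have Eq : dot (fun x => h x - p x) (fun x => h x - q x) =
         dot (fun x => h x - p x) (fun x => h x - p x).
  rewrite !(dotBr _ _ shp)//; congr (_ - _).
  by rewrite !dotBl// ph// ph// !subrr.
have := dot_CS shp shq; rewrite Eq ger0_norm ?dot_ge0// -norm2_sqr expr2.
have [->|n0] := eqVneq (norm2 (fun x => h x - p x)) 0; first by rewrite norm2_ge0.
by rewrite ler_pM2l// lt_neqAle eq_sym n0 norm2_ge0.
Qed.

(** Take one invariant space containing good approximations of both [phi] and [g], and
    project [phi] onto it.  For every [v] in the space, (D (P phi), v) =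
    - (P phi, D v) = - (phi, D v) = (g, v), because D v stays in the space: the
    derivative of the projection is the projection of [g], and each projection is at
    least as good as the approximation chosen. *)
Lemma weak_derivative_approx phi g eps : sqint phi -> trig_weak e phi g ->
  0 < eps -> exists psi, [/\ trig e psi, norm2 (fun x => phi x - psi x) < eps &
                            norm2 (fun x => g x - 'D_e psi x) < eps].
Proof.
move=> sphi [sg wg] e0.
have [_ /(_ _ e0)[p [[I [b [D [fb [c ->]]]]] hp]]] := approximable_sqint ee sphi.
have [_ /(_ _ e0)[q [[J [b' [D' [fb' [c' ->]]]]] hq]]] := approximable_sqint ee sg.
(* the direct sum of the two families contains both approximations *)
have fB := invariant_family_sum fb fb'.
set B := (fun k : I + J => _) in fB.
have Sp : spanned B (fun x => \sum_i c i * b i x).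
  exists (fun k => if k is inl i then c i else 0); apply: funext => x.
  by rewrite big_sumType /= [X in _ + X]big1 ?addr0// => j _; rewrite mul0r.
have Sq : spanned B (fun x => \sum_i c' i * b' i x).
  exists (fun k => if k is inr i then c' i else 0); apply: funext => x.
  by rewrite big_sumType /= [X in X + _]big1 ?add0r// => j _; rewrite mul0r.
have [psi [Spsi Hpsi]] := projection fB sphi.
have trigS v : spanned B v -> trig e v.
  by move=> [d ->]; do 3 eexists; split; [exact: fB|exists d].
have dS v : spanned B v -> spanned B (fun x => 'D_e v x).
  move=> [d ->]; eexists; apply: funext => x.
  rewrite derive_lincomb//; last by case: fB.
  under eq_bigr do rewrite fB.2 mulr_sumr.
  rewrite exchange_big; apply: eq_bigr => j _; under eq_bigr do rewrite mulrA.
  by rewrite -mulr_suml.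
exists psi; split; first exact: trigS.
  exact: le_lt_trans (projection_best fB sphi Spsi Sp Hpsi) hp.
apply: le_lt_trans (projection_best fB sg (dS _ Spsi) Sq _) hq.
move=> v Sv; have := trig_ibp ee (trigS _ Spsi) (trigS _ Sv).
rewrite Hpsi; last exact: dS.
by rewrite (wg _ (trigS _ Sv)) => /oppr_inj ->.
Qed.

(** Replace [phi] by a trigonometric polynomial close to it together with its
    derivative; for that polynomial the formula is the definition of [h]. *)
Lemma weak_derivative_ibp phi g chi h : sqint phi -> sqint chi ->
  trig_weak e phi g -> trig_weak e chi h ->
  dot phi h = - dot g chi.
Proof.
move=> sphi schi wg wh; have [sg _] := wg; have [sh hh] := wh.
apply/eqP; rewrite -addr_eq0 -normr_le0.
apply: (@eps_le0 _ (norm2 h + norm2 chi)); first by rewrite addr_ge0// norm2_ge0.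
move=> eps e0; have [psi [tp n1 n2]] := weak_derivative_approx sphi wg e0.
have sp := trig_sqint tp; have sdp := trig_sqint (trig_derive ee tp).
have H : dot psi h = - dot (fun x => 'D_e psi x) chi.
  by rewrite (dotC _ chi) hh// opprK dotC.
have -> : dot phi h + dot g chi =
  dot (fun x => phi x - psi x) h + dot (fun x => g x - 'D_e psi x) chi.
  by rewrite !dotBl// H; ring.
apply: (le_trans (ler_normD _ _)).
rewrite mulrDl; apply: lerD.
  apply: le_trans (dot_CS (sqintB sphi sp) sh) _.
  by rewrite mulrC ler_wpM2l ?norm2_ge0// ltW.
apply: le_trans (dot_CS (sqintB sg sdp) schi) _.
by rewrite mulrC ler_wpM2l ?norm2_ge0// ltW.
Qed.

Lemma weak_derivative_unique phi g g' h : trig_weak e phi g ->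
  trig_weak e phi g' -> sqint h -> dot g h = dot g' h.
Proof.
move=> [sg wg] [sg' wg'] sh.
apply/eqP; rewrite -subr_eq0 -dotBl//; apply/eqP.
apply: dot_orthogonal_trig => //; first exact: sqintB.
move=> psi tp; have sp := trig_sqint tp.
rewrite dotBl//; apply/eqP; rewrite subr_eq0 -eqr_opp -wg// -wg'//.
Qed.

Lemma trig_weak_lin a phi psi g h : sqint phi -> sqint psi ->
  trig_weak e phi g -> trig_weak e psi h ->
  trig_weak e (fun x => a * phi x + psi x) (fun x => a * g x + h x).
Proof.
move=> sphi spsi [sg wg] [sh wh]; split; first by apply: sqintD => //; exact: sqintZ.
move=> chi tc; have sc := trig_sqint tc; have sd := trig_sqint (trig_derive ee tc).
rewrite !dotDl ?dotZl ?wg ?wh//; [by ring|exact: sqintZ|exact: sqintZ].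
Qed.

Section Product.
Variables (u w du dw : sfield R) (M : R).
Hypothesis M0 : 0 <= M.
Hypotheses (su : sqint u) (sw : sqint w).
Hypotheses (wu : trig_weak e u du) (ww : trig_weak e w dw).
Hypotheses (bu : ae_bounded M u) (bw : ae_bounded M w).

Let sdu : sqint du. Proof. by case: wu. Qed.
Let sdw : sqint dw. Proof. by case: ww. Qed.

(** [psi] times a test function is again a test function, so the Leibniz rule for
    smooth functions moves [psi] to the other factor. *)
Lemma trig_weak_mul_trig psi : trig e psi ->
  trig_weak e (fun x => psi x * w x) (fun x => psi x * dw x + 'D_e psi x * w x).
Proof.
move=> tp; have td := trig_derive ee tp.
have [pC mp [N bp]] := trig_regular tp.
have s1 : sqint (fun x => psi x * dw x) by apply: sqint_regular_mul (trig_regular tp) _.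
have s2 : sqint (fun x => 'D_e psi x * w x) by apply: sqint_regular_mul (trig_regular td) _.
split; first exact: sqintD.
move=> chi tc; have sc := trig_sqint tc.
have tpc := trig_mul ee tp tc.
have [cC _ _] := trig_regular tc.
have s3 : sqint (fun x => psi x * 'D_e chi x).
  exact: trig_sqint (trig_mul ee tp (trig_derive ee tc)).
have s4 : sqint (fun x => 'D_e psi x * chi x).
  exact: trig_sqint (trig_mul ee td tc).
have E : dot (fun x => psi x * w x) (fun x => 'D_e chi x) = dot w (fun x => psi x * 'D_e chi x).
  by apply: eq_Rintegral => x _; ring.
have := ww.2 _ tpc.
have -> : (fun x => 'D_e (fun x => psi x * chi x) x) =
          (fun x => psi x * 'D_e chi x - (-1) * ('D_e psi x * chi x)).
  by apply: funext => x; rewrite derive_mul//; ring.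
rewrite dotBr ?dotZr//; last exact: sqintZ.
have -> : dot dw (fun x => psi x * chi x) = dot (fun x => psi x * dw x) chi.
  by apply: eq_Rintegral => x _; ring.
have -> : dot w (fun x => 'D_e psi x * chi x) = dot (fun x => 'D_e psi x * w x) chi.
  by apply: eq_Rintegral => x _; ring.
rewrite E dotDl//; lra.
Qed.

Let sudw : sqint (fun x => u x * dw x).
Proof. by apply: (mul_ae_bounded su.1 M0 bu sdw).1. Qed.
Let sduw : sqint (fun x => du x * w x).
Proof.
have := (mul_ae_bounded sw.1 M0 bw sdu).1.
by congr sqint; apply: funext => x; rewrite mulrC.
Qed.
Let suw : sqint (fun x => u x * w x).
Proof. by apply: (mul_ae_bounded su.1 M0 bu sw).1. Qed.

(** Against a test function [psi], the integral of u w D psi is the pairing of [u] with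
    D (psi w) minus that with psi D w: the integration by parts formula for [u] and
    psi w then gives the Leibniz rule.  Essential boundedness makes the two products
    with weak derivatives square integrable. *)
Lemma trig_weak_mul :
  trig_weak e (fun x => u x * w x) (fun x => u x * dw x + du x * w x).
Proof.
split; first exact: sqintD.
move=> psi tp; have sp := trig_sqint tp.
have td := trig_derive ee tp; have sd := trig_sqint td.
have wp := trig_weak_mul_trig tp.
have spw : sqint (fun x => psi x * w x) by exact: sqint_regular_mul (trig_regular tp) _.
have spdw : sqint (fun x => psi x * dw x) by exact: sqint_regular_mul (trig_regular tp) _.
have sdpw : sqint (fun x => 'D_e psi x * w x) by exact: sqint_regular_mul (trig_regular td) _.
have := weak_derivative_ibp su spw wu wp.
rewrite dotC dotDl// dotDl//.
have -> : dot (fun x => psi x * dw x) u = dot (fun x => u x * dw x) psi.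
  by apply: eq_Rintegral => x _; ring.
have -> : dot (fun x => 'D_e psi x * w x) u = dot (fun x => u x * w x) (fun x => 'D_e psi x).
  by apply: eq_Rintegral => x _; ring.
have -> : dot du (fun x => psi x * w x) = dot (fun x => du x * w x) psi.
  by apply: eq_Rintegral => x _; ring.
lra.
Qed.

(** Integrate u w against D w by parts: the two occurrences of (u D w, w) add up. *)
Lemma transport_skew :
  dot (fun x => u x * dw x) w + 2^-1 * dot (fun x => du x * w x) w = 0.
Proof.
have := weak_derivative_ibp suw sw trig_weak_mul ww.
rewrite dotDl//.
have -> : dot (fun x => u x * w x) dw = dot (fun x => u x * dw x) w.
  by apply: eq_Rintegral => x _; ring.
lra.
Qed.

End Product.

End Weak.

(** * The scalar recursion *)

Ltac nneg := repeat first [done | exact: sqr_ge0 | by apply: ltW | apply: addr_ge0 | apply: mulr_ge0 | apply: exprn_ge0].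

Section Recursion.
Context {R : realType}.
Variables (kappa : R).
Hypothesis kappa0 : 0 < kappa.
Let alpha := 1 + kappa.
Let s n : R := (1 / alpha) ^+ n.

Let alpha1 : 1 < alpha. Proof. by have k0 := kappa0; rewrite /alpha; lra. Qed.
Let alpha0 : 0 < alpha. Proof. by have k0 := kappa0; rewrite /alpha; lra. Qed.
Let s_gt0 n : 0 < s n. Proof. by rewrite exprn_gt0// divr_gt0 ?ltr01. Qed.
Let sS n : alpha * s n.+1 = s n.
Proof. by rewrite /s exprS mulrA mul1r mulfV ?mul1r// gt_eqF. Qed.
Let s_le1 n : s n <= 1.
Proof. by rewrite exprn_ile1// ?divr_ge0// ?ler_pdivrMr// ?mul1r ltW. Qed.
Let sD m n : s (m + n) = s m * s n. Proof. exact: exprD. Qed.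
Let s_mono m n : (m <= n)%N -> s n <= s m.
Proof. by move=> mn; rewrite -(subnK mn) sD ler_piMl ?s_le1// ltW. Qed.

(** If [b'] exceeds [F] then so does [y], and kappa y (y - F) is at least
    kappa b' (b' - F): one may argue as if [y] were [b'] and divide by [b']. *)
Lemma damping_step (b b' y F : R) : 0 <= F -> 0 <= b' -> b' <= y ->
  b' ^+ 2 + kappa * y ^+ 2 <= b * b' + kappa * F * y ->
  b' <= F \/ alpha * (b' - F) <= b - F.
Proof.
move=> F0 b0 by_ H; have k0 := kappa0; have [|Fb] := leP b' F; [by left|right].
have b'0 : 0 < b' by lra.
have : b' * (alpha * b' - kappa * F) <= b' * b.
  have : 0 <= kappa * ((y - b') * (y + b' - F)) by apply: mulr_ge0; [exact: ltW|apply: mulr_ge0; lra].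
  by rewrite /alpha; nra.
by rewrite ler_pM2l// /alpha; lra.
Qed.

Lemma damping (b y : nat -> R) F : 0 <= F -> (forall k, 0 <= b k) ->
  (forall k, b k.+1 <= y k.+1) ->
  (forall k, b k.+1 ^+ 2 + kappa * y k.+1 ^+ 2 <= b k * b k.+1 + kappa * F * y k.+1) ->
  forall n, b n <= F + s n * b 0%N.
Proof.
move=> F0 b0 by_ H; have k0 := kappa0; elim=> [|n IH]; first by rewrite /s expr0; lra.
have sb : 0 <= s n.+1 * b 0%N by rewrite mulr_ge0// ltW.
have [|H'] := damping_step F0 (b0 _) (by_ n) (H n); first lra.
have : alpha * (b n.+1 - F) <= alpha * (s n.+1 * b 0%N).
  by rewrite mulrA sS; lra.
by rewrite ler_pM2l//; lra.
Qed.

Lemma sqrD_le (x y : R) : (x + y) ^+ 2 <= 2 * x ^+ 2 + 2 * y ^+ 2.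
Proof. by rewrite -subr_ge0 (_ : _ - _ = (x - y) ^+ 2) ?sqr_ge0//; ring. Qed.

(** Scaled quantities of the scheme: [a], [G], [A] stand for the norms of the velocity,
    of its gradient and of its discrete Stokes image, [X] and [Y] for those of the
    vorticity and its gradient, [Phi] and [F] for the dual and the L2 norm of the
    forcing, [phi] for the forcing of the vorticity.  [C0] and [C1] below are then the
    squares of the constants of the same name in the theorem. *)
Variables (a G A X Y : nat -> R) (F Phi phi c : R).
Hypothesis c0 : 0 <= c.
Hypothesis Phi0 : 0 <= Phi.
Hypothesis PhiF : Phi <= F.
Hypothesis phi0 : 0 <= phi.
Hypothesis a0 : forall k, 0 <= a k.
Hypothesis aG : forall k, a k <= G k.
Hypothesis A0 : forall k, 0 <= A k.
Hypothesis GaA : forall k, G k.+1 ^+ 2 <= a k.+1 * A k.+1.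
Hypothesis X0 : forall k, 0 <= X k.
Hypothesis XY : forall k, X k.+1 <= Y k.+1.
Hypothesis energy : forall k,
  a k.+1 ^+ 2 + kappa * G k.+1 ^+ 2 <= a k * a k.+1 + kappa * Phi * G k.+1.
Hypothesis vorticity : forall k,
  X k.+1 ^+ 2 + kappa * Y k.+1 ^+ 2 <= X k * X k.+1 + kappa * phi * Y k.+1.

Let F0 : 0 <= F. Proof. exact: le_trans PhiF. Qed.
Let G0 k : 0 <= G k. Proof. exact: le_trans (aG k). Qed.
Let a_le n : a n <= Phi + s n * a 0%N.
Proof. exact: (damping Phi0 a0 (fun k => aG k.+1) energy). Qed.
Let X_le n : X n <= phi + s n * X 0%N.
Proof. exact: (damping phi0 X0 XY vorticity). Qed.
Let GA k : G k.+1 <= A k.+1.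
Proof.
have [->//|n0] := eqVneq (G k.+1) 0.
have g0 : 0 < G k.+1 by rewrite lt_neqAle eq_sym n0 G0.
rewrite -(ler_pM2l g0) -expr2 (le_trans (GaA k))//.
by rewrite ler_wpM2r.
Qed.

Let C0 n := s n * a 0%N ^+ 2 + 2 * alpha * Phi ^+ 2.
Let C1 n := s n * X 0%N ^+ 2 + 2 * alpha * phi ^+ 2.

(** Up to the time where the weight is 1/12, all weights are comparable to the last. *)
Let early_sqr n k (p b y : R) : 1 / 12 <= s n -> 0 <= p -> 0 <= b -> 0 <= y ->
  y <= p + s k * b -> y ^+ 2 <= 24 * (s n * b ^+ 2 + 2 * alpha * p ^+ 2).
Proof.
move=> s12 p0 b0 y0 yle; have al1 := alpha1.
have yb : y <= p + b by apply: le_trans yle _; rewrite lerD2l ler_piMl.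
have : y ^+ 2 <= (p + b) ^+ 2 by rewrite lerXn2r// nnegrE// addr_ge0.
have := sqrD_le p b; have := ler_wpM2r (sqr_ge0 b) s12.
have : p ^+ 2 <= alpha * p ^+ 2 by rewrite ler_peMl ?sqr_ge0// ltW.
have := sqr_ge0 p; lra.
Qed.

Section Cubic.
Hypothesis gradient : forall k, G k.+1 ^+ 2 + kappa * A k.+1 ^+ 2 <=
  G k * G k.+1 + kappa * F * A k.+1 +
  kappa * (c * X k) * (Num.sqrt (a k.+1) * Num.sqrt (A k.+1)) * A k.+1.

(** Compare the excess A' - G' with the nonlinear term x sqrt(a' A'), where x = c X.  If
    the excess dominates, kappa A' (A' - F) - kappa G' (G' - F) absorbs the nonlinear
    term and what remains is the damping of [damping_step].  Otherwise A' is below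
    G' + x sqrt(a' A'), which by G' <= sqrt(a' A') is at most (1 + x) sqrt(a' A'); hence
    sqrt A' <= (1 + x) sqrt a', and G' is at most (1 + x) a'. *)
Lemma gradient_trichotomy k : [\/ G k.+1 <= F, G k.+1 <= (1 + c * X k) * a k.+1 |
  alpha * (G k.+1 - F) <= G k - F].
Proof.
have := gradient k; have := GaA k; have := GA k; have := A0 k.+1.
have := a0 k.+1; have := G0 k.+1.
have F00 := F0; have k0 := kappa0; set x := c * X k; have x0 : 0 <= x by rewrite mulr_ge0.
set p := Num.sqrt (a k.+1); set q := Num.sqrt (A k.+1).
move: (G k) (G k.+1) => g g'; move=> g0 ak Ak.
have p0 : 0 <= p by exact: sqrtr_ge0.
have q0 : 0 <= q by exact: sqrtr_ge0.
have aE : a k.+1 = p ^+ 2 by rewrite sqr_sqrtr.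
have AE : A k.+1 = q ^+ 2 by rewrite sqr_sqrtr.
move=> gA gaA H.
have [|Fg] := leP g' F; first by constructor 1.
have [le|lt] := leP (x * (p * q)) (A k.+1 - g').
  constructor 3.
  have g'0 : 0 < g' by lra.
  have : g' * (alpha * g' - kappa * F) <= g' * g.
    have h1 : x * (p * q) * A k.+1 <= (A k.+1 - g') * (A k.+1 + g' - F).
      apply: ler_pM => //; last by lra.
      by rewrite !mulr_ge0.
    have := ler_wpM2l (ltW kappa0) h1.
    by rewrite /alpha; nra.
  by rewrite ler_pM2l// /alpha; lra.
constructor 2.
have gpq : g' <= p * q.
  rewrite -(@ler_pXn2r _ 2)// ?nnegrE ?mulr_ge0//.
  by rewrite exprMn -aE -AE.
have qp : q <= (1 + x) * p.
  have [->|qn] := eqVneq q 0; first by rewrite mulr_ge0//; lra.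
  have qpos : 0 < q by rewrite lt_neqAle eq_sym qn.
  rewrite -(ler_pM2r qpos) -expr2 -AE.
  by move: lt gpq; nra.
by rewrite aE (le_trans gpq)// expr2 mulrCA ler_wpM2l.
Qed.

(** Follow the damping back from time [n] to the last step at which one of the other
    two cases occurred.  If there is none one arrives at the initial value. *)
Lemma gradient_alternative n : [\/ G n <= F, G n - F <= s n * (G 0%N - F) |
  exists2 m, (m < n)%N &
    G n - F <= s (n - m.+1) * ((1 + c * X m) * a m.+1 - F)].
Proof.
have F00 := F0; have k0 := kappa0; elim: n => [|n IH]; first by constructor 2; rewrite /s expr0 mul1r.
have [|le|le] := gradient_trichotomy n; first by constructor 1.
  by constructor 3; exists n => //; rewrite subnn /s expr0 mul1r; lra.
case: IH => [h|h|[m mn h]].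
- constructor 1; have : alpha * (G n.+1 - F) <= alpha * 0 by lra.
  by rewrite ler_pM2l//; lra.
- by constructor 2; rewrite -(ler_pM2l alpha0) mulrA sS; lra.
- constructor 3; exists m; first exact: ltnW.
  by rewrite -(ler_pM2l alpha0) mulrA subSn// sS; lra.
Qed.

(** Without an exceptional step, the first estimate follows by convexity of the square.
    Otherwise, [a] and [X] at the exceptional step are at most the forcing plus a
    decayed initial value, and multiplication by the damping since then turns their
    weights into [s n] or [s n.-1]. *)
Lemma gradient_late n : (0 < n)%N ->
  G n ^+ 2 <= s n * G 0%N ^+ 2 + F ^+ 2 \/
  exists z, [/\ 0 <= z, G n <= F + s n * a 0%N + z &
   z <= c * (phi * Phi + phi * (s n * a 0%N) + s n.-1 * X 0%N * Phi + s n * X 0%N * a 0%N)].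
Proof.
move=> n0; have F00 := F0; have sn0 := s_gt0 n; have sn1 := s_le1 n.
have PF := PhiF.
have [h|h|[m mn h]] := gradient_alternative n.
- left; have : G n ^+ 2 <= F ^+ 2 by rewrite lerXn2r// nnegrE.
  have h2 : 0 <= s n * G 0%N ^+ 2 by rewrite mulr_ge0 ?sqr_ge0// ltW.
  lra.
- left; have h' : G n <= s n * G 0%N + (1 - s n) * F by lra.
  have : G n ^+ 2 <= (s n * G 0%N + (1 - s n) * F) ^+ 2.
    by rewrite lerXn2r// nnegrE// addr_ge0// mulr_ge0// ?subr_ge0// ltW.
  have : 0 <= (s n * (1 - s n)) * (G 0%N - F) ^+ 2.
    by rewrite mulr_ge0 ?sqr_ge0// mulr_ge0 ?subr_ge0// ltW.
  have : 0 <= s n * F ^+ 2 by rewrite mulr_ge0 ?sqr_ge0// ltW.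
  have -> : (s n * G 0%N + (1 - s n) * F) ^+ 2 =
    s n * G 0%N ^+ 2 + (1 - s n) * F ^+ 2 - s n * (1 - s n) * (G 0%N - F) ^+ 2 by ring.
  lra.
(* the nonlinear part of the bound at the exceptional step, damped since then *)
right; exists (s (n - m.+1) * (c * X m * (Phi + s m.+1 * a 0%N))).
have sm0 := s_gt0 (n - m.+1); have sm1 := s_le1 (n - m.+1).
have smn : s (n - m.+1) * s m.+1 = s n by rewrite -sD subnK.
have smn' : s (n - m.+1) * s m = s n.-1.
  rewrite -sD; suff -> : (n - m.+1 + m = n.-1)%N by [].
  by case: (n) mn => // n' mn'; rewrite subSS subnK.
have am := a_le m.+1; have xm := X_le m.
have cX : 0 <= c * X m by rewrite mulr_ge0.
have sa : 0 <= Phi + s m.+1 * a 0%N by rewrite addr_ge0// mulr_ge0// ltW.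
split.
- by nneg.
- have : (1 + c * X m) * a m.+1 - F <= s m.+1 * a 0%N + c * X m * (Phi + s m.+1 * a 0%N).
    have := ler_wpM2l cX am; lra.
  move: h; set t := (1 + c * X m) * a m.+1 - F => h /(ler_wpM2l (ltW sm0)).
  have -> : s (n - m.+1) * (s m.+1 * a 0%N + c * X m * (Phi + s m.+1 * a 0%N)) =
    s n * a 0%N + s (n - m.+1) * (c * X m * (Phi + s m.+1 * a 0%N)).
    by rewrite mulrDr mulrA smn.
  lra.
- have : c * X m * (Phi + s m.+1 * a 0%N) <= c * (phi + s m * X 0%N) * (Phi + s m.+1 * a 0%N).
    by rewrite ler_wpM2r// ler_wpM2l.
  move=> /(ler_wpM2l (ltW sm0))/le_trans; apply.
  have -> : s (n - m.+1) * (c * (phi + s m * X 0%N) * (Phi + s m.+1 * a 0%N)) =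
    c * (s (n - m.+1) * (phi * Phi) + phi * ((s (n - m.+1) * s m.+1) * a 0%N) +
     (s (n - m.+1) * s m) * X 0%N * Phi +
     (s (n - m.+1) * s m) * s m.+1 * X 0%N * a 0%N) by ring.
  rewrite smn smn'; apply: ler_wpM2l => //.
  have t1 : s (n - m.+1) * (phi * Phi) <= phi * Phi by rewrite ler_piMl// mulr_ge0.
  have t2 : s n.-1 * s m.+1 * X 0%N * a 0%N <= s n * X 0%N * a 0%N.
    rewrite ler_wpM2r// ler_wpM2r//.
    have -> : s n = s n.-1 * s 1 by rewrite -sD addn1 prednK.
    by rewrite ler_wpM2l ?(ltW (s_gt0 _))// s_mono.
  lra.
Qed.

Lemma sqr_sum4 (x y z t : R) :
  (x + y + z + t) ^+ 2 <= 4 * (x ^+ 2 + y ^+ 2 + z ^+ 2 + t ^+ 2).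
Proof.
have := sqr_ge0 (x - y); have := sqr_ge0 (x - z); have := sqr_ge0 (x - t).
have := sqr_ge0 (y - z); have := sqr_ge0 (y - t); have := sqr_ge0 (z - t).
nra.
Qed.

(** Square of the previous bound.  The weights 3/2, 6, 6 of the three terms and the
    threshold 1/12 are chosen so that 6 (s a)^2 is at most half of s G^2, which leaves
    room for the remaining terms. *)
Lemma gradient_late_sqr n : (0 < n)%N -> s n <= 1 / 12 ->
  G n ^+ 2 <= s n * G 0%N ^+ 2 + F ^+ 2 \/
  G n ^+ 2 <= 3 / 2 * F ^+ 2 + 1 / 2 * (s n * G 0%N ^+ 2) +
   24 * c ^+ 2 * (phi ^+ 2 * Phi ^+ 2 + phi ^+ 2 * (s n ^+ 2 * a 0%N ^+ 2) +
     s n.-1 ^+ 2 * X 0%N ^+ 2 * Phi ^+ 2 + s n ^+ 2 * X 0%N ^+ 2 * a 0%N ^+ 2).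
Proof.
move=> n0 s12; have sn0 := s_gt0 n.
have [|[z [z0 Gz zle]]] := gradient_late n0; [by left|right].
have sa0 : 0 <= s n * a 0%N by rewrite mulr_ge0// ltW.
have z2 : z ^+ 2 <= c ^+ 2 * (4 * (phi ^+ 2 * Phi ^+ 2 + phi ^+ 2 * (s n ^+ 2 * a 0%N ^+ 2) +
     s n.-1 ^+ 2 * X 0%N ^+ 2 * Phi ^+ 2 + s n ^+ 2 * X 0%N ^+ 2 * a 0%N ^+ 2)).
  apply: (@le_trans _ _ ((c * (phi * Phi + phi * (s n * a 0%N) + s n.-1 * X 0%N * Phi + s n * X 0%N * a 0%N)) ^+ 2)).
    by rewrite lerXn2r// nnegrE// (le_trans z0).
  rewrite exprMn ler_wpM2l ?sqr_ge0//.
  by apply: le_trans (sqr_sum4 _ _ _ _) _; rewrite !exprMn.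
have G2 : G n ^+ 2 <= (F + s n * a 0%N + z) ^+ 2.
  by rewrite lerXn2r// nnegrE// !addr_ge0.
have H3 (x y t : R) : (x + y + t) ^+ 2 <= 3 / 2 * x ^+ 2 + 6 * y ^+ 2 + 6 * t ^+ 2.
  have := sqr_ge0 (x - 4 * y); have := sqr_ge0 (x - 4 * t); have := sqr_ge0 (y - t).
  nra.
have := H3 F (s n * a 0%N) z.
have sa2 : 6 * (s n * a 0%N) ^+ 2 <= 1 / 2 * (s n * G 0%N ^+ 2).
  have aG2 : a 0%N ^+ 2 <= G 0%N ^+ 2 by rewrite lerXn2r// nnegrE.
  have := ler_wpM2l (ltW sn0) aG2.
  have := ler_wpM2r (sqr_ge0 (s n * a 0%N)) s12.
  have : s n * (s n * a 0%N ^+ 2) <= 1 / 12 * (s n * a 0%N ^+ 2).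
    by rewrite ler_wpM2r// mulr_ge0 ?sqr_ge0// ltW.
  rewrite exprMn expr2; lra.
lra.
Qed.

Let s_pred n : (0 < n)%N -> s n.-1 = alpha * s n.
Proof. by case: n => // n _; rewrite sS. Qed.

Lemma gradient_late_linear n : (0 < n)%N -> s n <= 1 / 12 ->
  G n ^+ 2 <= s n * G 0%N ^+ 2 + 2 * alpha * F ^+ 2 + 24 * c ^+ 2 * C1 n * C0 n.
Proof.
move=> n0 s12; have sn0 := s_gt0 n; have al1 := alpha1; have [H|H] := gradient_late_sqr n0 s12.
  move: H => /le_trans; apply; rewrite -addrA lerD2l -[leLHS]addr0.
  apply: lerD; first by rewrite ler_peMl ?sqr_ge0//; lra.
  by rewrite /C1 /C0; nneg.
apply: le_trans H _.
have sG : 0 <= s n * G 0%N ^+ 2 by rewrite mulr_ge0 ?sqr_ge0// ltW.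
have F2 : 0 <= F ^+ 2 by exact: sqr_ge0.
have aF : 3 / 2 * F ^+ 2 <= 2 * alpha * F ^+ 2 by rewrite ler_wpM2r//; lra.
suff : phi ^+ 2 * Phi ^+ 2 + phi ^+ 2 * (s n ^+ 2 * a 0%N ^+ 2) +
       s n.-1 ^+ 2 * X 0%N ^+ 2 * Phi ^+ 2 + s n ^+ 2 * X 0%N ^+ 2 * a 0%N ^+ 2 <= C1 n * C0 n.
  have c2 : 0 <= 24 * c ^+ 2 by rewrite mulr_ge0// sqr_ge0.
  by move=> /(ler_wpM2l c2); lra.
rewrite /C1 /C0 s_pred//.
have p1 : 0 <= phi ^+ 2 * Phi ^+ 2 by rewrite mulr_ge0 ?sqr_ge0.
have p2 : 0 <= phi ^+ 2 * a 0%N ^+ 2 by rewrite mulr_ge0 ?sqr_ge0.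
have p3 : 0 <= X 0%N ^+ 2 * Phi ^+ 2 by rewrite mulr_ge0 ?sqr_ge0.
have als : alpha * s n <= 1 by rewrite -s_pred.
have t1 : phi ^+ 2 * Phi ^+ 2 <= (2 * alpha) ^+ 2 * (phi ^+ 2 * Phi ^+ 2).
  by rewrite ler_peMl// exprn_ege1//; lra.
have t2 : s n ^+ 2 * (phi ^+ 2 * a 0%N ^+ 2) <= (2 * alpha * s n) * (phi ^+ 2 * a 0%N ^+ 2).
  by rewrite ler_wpM2r// expr2 ler_wpM2r ?ltW//; lra.
have t3 : (alpha * s n) ^+ 2 * (X 0%N ^+ 2 * Phi ^+ 2) <= (2 * (alpha * s n)) * (X 0%N ^+ 2 * Phi ^+ 2).
  rewrite ler_wpM2r// expr2 ler_wpM2r ?mulr_ge0 ?ltW//; lra.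
by move: t1 t2 t3; lra.
Qed.

(** The bound just obtained is of second degree in [c], the one wanted of fourth degree.
    The inequality t <= 1/4 + t^2, with t made of E = 24 c^2 and the vorticity factor,
    is used on each of the four products: the quarter of the velocity factor is
    dominated by F^2 or by s G^2, and the rest has the wanted degree. *)
Lemma gradient_late_cubic n : (0 < n)%N -> s n <= 1 / 12 ->
  G n ^+ 2 <= s n * G 0%N ^+ 2 + 2 * alpha * F ^+ 2 +
    (24 * c ^+ 2) ^+ 2 * (alpha * C1 n ^+ 2 * C0 n).
Proof.
move=> n0 s12; have sn0 := s_gt0 n; have al1 := alpha1; have [H|H] := gradient_late_sqr n0 s12.
  move: H => /le_trans; apply; rewrite -addrA lerD2l -[leLHS]addr0.
  apply: lerD; first by rewrite ler_peMl ?sqr_ge0//; lra.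
  by rewrite /C1 /C0; nneg.
apply: le_trans H _; rewrite s_pred//.
set E := 24 * c ^+ 2; set sigma := alpha * s n.
have als : sigma <= 1 by rewrite /sigma -s_pred.
have sg0 : 0 <= sigma by rewrite mulr_ge0// ltW.
have E0 : 0 <= E by rewrite mulr_ge0// sqr_ge0.
have young (y : R) : y <= 1 / 4 + y ^+ 2.
  by have := sqr_ge0 (y - 1 / 2); rewrite sqrrB; lra.
set b := a 0%N ^+ 2; set x := X 0%N ^+ 2; set P := Phi ^+ 2; set f := phi ^+ 2.
have b0 : 0 <= b by exact: sqr_ge0.
have x0 : 0 <= x by exact: sqr_ge0.
have P0 : 0 <= P by exact: sqr_ge0.
have f0 : 0 <= f by exact: sqr_ge0.
have t1 : E * (f * P) <= P / 4 + E ^+ 2 * (f ^+ 2 * P).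
  by have := ler_wpM2r P0 (young (E * f)); lra.
have s2b : 0 <= s n ^+ 2 * b by rewrite mulr_ge0 ?sqr_ge0.
have s1b : 0 <= s n * b by rewrite mulr_ge0// ltW.
have t2 : E * (f * (s n ^+ 2 * b)) <= (s n ^+ 2 * b) / 4 + E ^+ 2 * (f ^+ 2 * (s n ^+ 2 * b)).
  by have := ler_wpM2r s2b (young (E * f)); lra.
have sP : 0 <= sigma * P by rewrite mulr_ge0.
have t3 : E * (sigma ^+ 2 * x * P) <= sigma * P / 4 + E ^+ 2 * (sigma ^+ 3 * x ^+ 2 * P).
  have := ler_wpM2r sP (young (E * sigma * x)).
  lra.
have t4 : E * (s n ^+ 2 * x * b) <= s n * b / 4 + E ^+ 2 * (s n ^+ 3 * x ^+ 2 * b).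
  have := ler_wpM2r s1b (young (E * s n * x)).
  lra.
have t5 : sigma * P <= P by rewrite ler_piMl.
have t6 : s n ^+ 2 * b <= s n * b.
  by rewrite ler_wpM2r// expr2 ler_piMl ?ltW//; lra.
have t7 : P <= F ^+ 2 by rewrite /P lerXn2r// nnegrE.
have t8 : s n * b <= s n * G 0%N ^+ 2.
  by apply: ler_wpM2l; [exact: ltW|rewrite /b lerXn2r// nnegrE].
have t9 : 2 * F ^+ 2 <= 2 * alpha * F ^+ 2 by rewrite ler_wpM2r ?sqr_ge0//; lra.
suff H : f ^+ 2 * P + f ^+ 2 * (s n ^+ 2 * b) + sigma ^+ 3 * x ^+ 2 * P + s n ^+ 3 * x ^+ 2 * b <=
         alpha * C1 n ^+ 2 * C0 n.
  have := ler_wpM2l (sqr_ge0 E) H; lra.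
rewrite /C1 /C0 -/b -/x -/P -/f.
have f2 : 0 <= f ^+ 2 by exact: sqr_ge0.
have x2 : 0 <= x ^+ 2 by exact: sqr_ge0.
have a3 : 1 <= alpha ^+ 3 by rewrite exprn_ege1// ltW.
have a4 : 1 <= alpha ^+ 4 by rewrite exprn_ege1// ltW.
have r1 : f ^+ 2 * P <= 8 * alpha ^+ 4 * (f ^+ 2 * P).
  by rewrite ler_peMl ?mulr_ge0//; lra.
have r2 : f ^+ 2 * (s n ^+ 2 * b) <= 4 * alpha ^+ 3 * s n * (f ^+ 2 * b).
  have : s n ^+ 2 <= 4 * alpha ^+ 3 * s n.
    by rewrite expr2 ler_wpM2r ?ltW//; lra.
  have fb : 0 <= f ^+ 2 * b by rewrite mulr_ge0.
  by move=> /(ler_wpM2r fb); lra.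
have r3 : sigma ^+ 3 * x ^+ 2 * P <= 2 * sigma ^+ 2 * (x ^+ 2 * P).
  have : sigma ^+ 3 <= 2 * sigma ^+ 2.
    by rewrite exprS ler_wpM2r ?sqr_ge0//; lra.
  have xP : 0 <= x ^+ 2 * P by rewrite mulr_ge0.
  by move=> /(ler_wpM2r xP); lra.
have r4 : s n ^+ 3 * x ^+ 2 * b <= alpha * s n ^+ 3 * (x ^+ 2 * b).
  have xb : 0 <= s n ^+ 3 * (x ^+ 2 * b) by nneg.
  have : 1 <= alpha by exact: ltW.
  by move=> /(ler_wpM2r xb); lra.
have rest : 0 <= 4 * alpha ^+ 2 * s n * x * f * (s n * b + 2 * alpha * P).
  by nneg.
have -> : alpha * (s n * x + 2 * alpha * f) ^+ 2 * (s n * b + 2 * alpha * P) =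
  8 * alpha ^+ 4 * (f ^+ 2 * P) + 4 * alpha ^+ 3 * s n * (f ^+ 2 * b) +
  2 * sigma ^+ 2 * (x ^+ 2 * P) + alpha * s n ^+ 3 * (x ^+ 2 * b) +
  4 * alpha ^+ 2 * s n * x * f * (s n * b + 2 * alpha * P) by rewrite /sigma; ring.
lra.
Qed.

(** Young's inequality bounds X sqrt(a') A'^(3/2) by a part of A'^2, absorbed by the
    dissipation, and a multiple of X^4 a'^2, bounded uniformly in time; the squared
    gradient is then damped towards a constant. *)
Lemma gradient_early_cubic n : 1 / 12 <= s n ->
  G n ^+ 2 <= s n * G 0%N ^+ 2 + 2 * alpha * F ^+ 2 +
    16 * 24 ^+ 3 * c ^+ 4 * (alpha * C1 n ^+ 2 * C0 n).
Proof.
move=> s12; have al1 := alpha1.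
have Xb k : X k ^+ 2 <= 24 * C1 n by exact: early_sqr s12 phi0 (X0 0%N) (X0 k) (X_le k).
have ab k : a k ^+ 2 <= 24 * C0 n by exact: early_sqr s12 Phi0 (a0 0%N) (a0 k) (a_le k).
(* the level towards which the squared gradient is damped *)
pose B := 2 * F ^+ 2 + 16 * c ^+ 4 * ((24 * C1 n) ^+ 2 * (24 * C0 n)).
have C1p : 0 <= C1 n by rewrite /C1 addr_ge0// !mulr_ge0 ?sqr_ge0// ltW.
have C0p : 0 <= C0 n by rewrite /C0 addr_ge0// !mulr_ge0 ?sqr_ge0// ltW.
have c4 : 0 <= c ^+ 4 by rewrite exprn_ge0.
have B0 : 0 <= B.
  by rewrite /B addr_ge0 ?mulr_ge0 ?sqr_ge0 ?exprn_ge0 ?mulr_ge0.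
have step k : alpha * (G k.+1 ^+ 2 - B) <= G k ^+ 2 - B.
  have := gradient k.
  set p := Num.sqrt (a k.+1); set q := Num.sqrt (A k.+1).
  have p0 : 0 <= p by exact: sqrtr_ge0.
  have q0 : 0 <= q by exact: sqrtr_ge0.
  have aE : a k.+1 = p ^+ 2 by rewrite sqr_sqrtr.
  have AE : A k.+1 = q ^+ 2 by rewrite sqr_sqrtr.
  set y := c * X k; have y0 : 0 <= y by rewrite mulr_ge0.
  have Y4 : (y * p) ^+ 4 <= c ^+ 4 * ((24 * C1 n) ^+ 2 * (24 * C0 n)).
    have -> : (y * p) ^+ 4 = c ^+ 4 * ((X k ^+ 2) ^+ 2 * (a k.+1 ^+ 2)).
      by rewrite aE /y; ring.
    rewrite ler_wpM2l// ler_pM ?sqr_ge0//.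
    by rewrite lerXn2r// nnegrE ?sqr_ge0// mulr_ge0.
  have quartic (r t : R) : 2 * (r * t ^+ 3) <= t ^+ 4 / 2 + 16 * r ^+ 4.
    have h := sqr_ge0 (t ^+ 2 - 2 * r * t - 2 * r ^+ 2).
    have h1 := sqr_ge0 (t ^+ 2 / 2 - 2 * r ^+ 2).
    have h2 := sqr_ge0 (r * t - 2 * r ^+ 2).
    have h3 := sqr_ge0 (r ^+ 2).
    have h4 := sqr_ge0 (t ^+ 2 - 3 * r * t).
    have h5 := sqr_ge0 (r * t - 3 * r ^+ 2).
    move: h h1 h2 h3 h4 h5.
    nra.
  have Gsq : G k.+1 ^+ 2 <= A k.+1 ^+ 2 by rewrite lerXn2r// nnegrE.
  have := sqr_ge0 (G k - G k.+1).
  have := quartic (y * p) q.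
  have := sqr_ge0 (F - A k.+1 / 2).
  have k0 := kappa0.
  move=> h1 h2 h3 h4.
  have h5 : kappa * (2 * (y * p * q ^+ 3)) <= kappa * (A k.+1 ^+ 2 / 2 + 16 * (y * p) ^+ 4).
    by rewrite ler_pM2l// AE -exprM.
  have h6 : kappa * (2 * F * A k.+1) <= kappa * (2 * F ^+ 2 + A k.+1 ^+ 2 / 2).
    by rewrite ler_pM2l//; lra.
  have h7 : kappa * (y * p) ^+ 4 <= kappa * (c ^+ 4 * ((24 * C1 n) ^+ 2 * (24 * C0 n))).
    by rewrite ler_pM2l.
  have h8 : kappa * G k.+1 ^+ 2 <= kappa * A k.+1 ^+ 2 by rewrite ler_pM2l.
  have h9 : kappa * y * (p * q) * A k.+1 = kappa * (y * p * q ^+ 3).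
    by rewrite AE; ring.
  rewrite h9 in h4.
  rewrite /B /alpha; lra.
have main : G n ^+ 2 - B <= s n * (G 0%N ^+ 2 - B).
  elim: (n in G n ^+ 2 - _ <= s n * _) => [|m IH]; first by rewrite /s expr0 mul1r.
  rewrite -(ler_pM2l alpha0) mulrA sS; exact: le_trans (step m) IH.
have sB : 0 <= s n * B by rewrite mulr_ge0// ltW.
have F2 : F ^+ 2 <= alpha * F ^+ 2 by rewrite ler_peMl ?sqr_ge0// ltW.
have last : C1 n ^+ 2 * C0 n <= alpha * (C1 n ^+ 2 * C0 n).
  by rewrite ler_peMl ?mulr_ge0 ?sqr_ge0// ltW.
have := ler_wpM2l c4 last.
move: main sB; rewrite /B; lra.
Qed.

Lemma gradient_cubic n : (0 < n)%N ->
  G n ^+ 2 <= s n * G 0%N ^+ 2 + 2 * alpha * F ^+ 2 +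
    16 * 24 ^+ 3 * c ^+ 4 * (alpha * C1 n ^+ 2 * C0 n).
Proof.
move=> n0.
have C1p : 0 <= C1 n by rewrite /C1; nneg.
have C0p : 0 <= C0 n by rewrite /C0; nneg.
have c4 : 0 <= c ^+ 4 * (alpha * C1 n ^+ 2 * C0 n).
  by rewrite mulr_ge0 ?exprn_ge0// mulr_ge0// mulr_ge0 ?sqr_ge0// ltW.
case: (lerP (s n) (1 / 12)) => s12.
  have := gradient_late_cubic n0 s12.
  by rewrite (_ : (24 * c ^+ 2) ^+ 2 = 576 * c ^+ 4); [lra|ring].
exact: gradient_early_cubic (ltW s12).
Qed.

End Cubic.

(** The term c X G' A' leaves c^2 X^2 G'^2 after Young's inequality, where [X] is bounded
    and kappa G'^2 is summable by the energy inequality: its sum grows by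
    kappa Phi^2 per step, and as alpha^n <= 12 there are at most 11 / kappa steps. *)
Lemma gradient_early_linear n :
  (forall k, G k.+1 ^+ 2 + kappa * A k.+1 ^+ 2 <=
    G k * G k.+1 + kappa * F * A k.+1 + kappa * (c * X k) * G k.+1 * A k.+1) ->
  1 / 12 <= s n ->
  G n ^+ 2 <= s n * G 0%N ^+ 2 + 2 * alpha * F ^+ 2 + 576 * c ^+ 2 * C1 n * C0 n.
Proof.
move=> gradient s12; have al1 := alpha1; have k0 := kappa0.
have Xb k : X k ^+ 2 <= 24 * C1 n by exact: early_sqr s12 phi0 (X0 0%N) (X0 k) (X_le k).
have C1p : 0 <= C1 n by rewrite /C1 addr_ge0// !mulr_ge0 ?sqr_ge0// ltW.
have diss m : a m ^+ 2 + \sum_(k < m) kappa * G k.+1 ^+ 2 <= a 0%N ^+ 2 + m%:R * kappa * Phi ^+ 2.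
  elim: m => [|m IH]; first by rewrite big_ord0 !mul0r.
  rewrite big_ord_recr /= -natr1.
  have := energy m; have := sqr_ge0 (a m - a m.+1).
  have : 0 <= kappa * (Phi - G m.+1) ^+ 2 by rewrite mulr_ge0 ?sqr_ge0// ltW.
  lra.
have sum_le : \sum_(k < n) kappa * G k.+1 ^+ 2 <= 12 * C0 n.
  have nk : n%:R * kappa <= 11.
    have := @bernoulli_le R kappa n _; rewrite -/alpha => /(_ _)/wrap[]; first lra.
    have : alpha ^+ n * s n = 1.
      by rewrite /s -exprMn mul1r mulfV ?expr1n// gt_eqF.
    have an : 0 < alpha ^+ n by rewrite exprn_gt0.
    have := ler_wpM2l (ltW an) s12; lra.
  have := ler_wpM2r (sqr_ge0 Phi) nk.
  have := ler_wpM2r (sqr_ge0 (a 0%N)) s12.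
  have : Phi ^+ 2 <= alpha * Phi ^+ 2 by rewrite ler_peMl ?sqr_ge0// ltW.
  have := diss n; have := sqr_ge0 (a n); have := sqr_ge0 Phi; rewrite /C0; lra.
have step k : alpha * (G k.+1 ^+ 2 - 2 * F ^+ 2) <=
    G k ^+ 2 - 2 * F ^+ 2 + 48 * c ^+ 2 * C1 n * (kappa * G k.+1 ^+ 2).
  have := gradient k.
  have Gsq : G k.+1 ^+ 2 <= A k.+1 ^+ 2 by rewrite lerXn2r// nnegrE.
  have h8 : kappa * G k.+1 ^+ 2 <= kappa * A k.+1 ^+ 2 by rewrite ler_pM2l.
  have := sqr_ge0 (G k - G k.+1).
  have h6 : 0 <= kappa * (2 * (F - A k.+1 / 2) ^+ 2).
    by nneg.
  have h7 : 0 <= kappa * (2 * (c * X k * G k.+1 - A k.+1 / 2) ^+ 2).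
    by nneg.
  have h9 : kappa * (c ^+ 2 * G k.+1 ^+ 2) * X k ^+ 2 <= kappa * (c ^+ 2 * G k.+1 ^+ 2) * (24 * C1 n).
    by rewrite ler_wpM2l// !mulr_ge0 ?sqr_ge0// ltW.
  rewrite /alpha; move: h6 h7 h9 h8; lra.
have c2C : 0 <= 48 * c ^+ 2 * C1 n by rewrite !mulr_ge0 ?sqr_ge0.
have kG k : 0 <= kappa * G k.+1 ^+ 2 by rewrite mulr_ge0 ?sqr_ge0// ltW.
have main m : G m ^+ 2 - 2 * F ^+ 2 <= s m * (G 0%N ^+ 2 - 2 * F ^+ 2) +
    48 * c ^+ 2 * C1 n * \sum_(k < m) (kappa * G k.+1 ^+ 2).
  elim: m => [|m IH]; first by rewrite big_ord0 mulr0 addr0 /s expr0 mul1r.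
  rewrite big_ord_recr /=.
  set S := \sum_(k < m) _ in IH *.
  have S0 : 0 <= S by apply: sumr_ge0.
  rewrite -(ler_pM2l alpha0) [X in _ <= X]mulrDr [alpha * (s _ * _)]mulrA sS.
  have t0 : 0 <= 48 * c ^+ 2 * C1 n * (S + kappa * G m.+1 ^+ 2) by rewrite mulr_ge0// addr_ge0.
  have := ler_wpM2r t0 (ltW alpha1); have := step m; lra.
have sF : 0 <= s n * F ^+ 2 by rewrite mulr_ge0 ?sqr_ge0// ltW.
have F2 : F ^+ 2 <= alpha * F ^+ 2 by rewrite ler_peMl ?sqr_ge0// ltW.
have := main n; have := ler_wpM2l c2C sum_le; lra.
Qed.

(** Since G' <= sqrt(a' A'), the hypothesis is stronger than that of the cubic bound and
    the late estimate applies, where [c] enters to the second power. *)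
Lemma gradient_linear n : (0 < n)%N ->
  (forall k, G k.+1 ^+ 2 + kappa * A k.+1 ^+ 2 <=
    G k * G k.+1 + kappa * F * A k.+1 + kappa * (c * X k) * G k.+1 * A k.+1) ->
  G n ^+ 2 <= s n * G 0%N ^+ 2 + 2 * alpha * F ^+ 2 + 576 * c ^+ 2 * C1 n * C0 n.
Proof.
move=> n0 gradient.
case: (lerP (s n) (1 / 12)) => s12; last by apply: gradient_early_linear => //; exact: ltW.
have C1p : 0 <= C1 n by rewrite /C1; nneg.
have C0p : 0 <= C0 n by rewrite /C0; nneg.
have cC : 0 <= c ^+ 2 * C1 n * C0 n by rewrite mulr_ge0// mulr_ge0// sqr_ge0.
have gs k : G k.+1 ^+ 2 + kappa * A k.+1 ^+ 2 <= G k * G k.+1 + kappa * F * A k.+1 +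
    kappa * (c * X k) * (Num.sqrt (a k.+1) * Num.sqrt (A k.+1)) * A k.+1.
  apply: le_trans (gradient k) _; rewrite lerD2l ler_wpM2r//.
  rewrite ler_wpM2l//; first by nneg.
  rewrite -(@ler_pXn2r _ 2)// ?nnegrE ?mulr_ge0 ?sqrtr_ge0//.
  by rewrite exprMn !sqr_sqrtr.
have := gradient_late_linear gs n0 s12; lra.
Qed.

End Recursion.

(** * Vector fields and the two nonlinear terms *)

Lemma linear_add2 (R : comPzRingType) (a p1 p2 q1 q2 : R) :
  (a * p1 + q1) + (a * p2 + q2) = a * (p1 + p2) + (q1 + q2).
Proof. ring. Qed.

Lemma quadratic_add (R : realType) (a b c a' b' c' t : R) :
  0 <= a - 2 * t * b + t ^+ 2 * c -> 0 <= a' - 2 * t * b' + t ^+ 2 * c' ->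
  0 <= (a + a') - 2 * t * (b + b') + t ^+ 2 * (c + c').
Proof. lra. Qed.

Section Fields.
Context {R : realType}.
Implicit Types (u v w : vfield R) (phi psi chi : sfield R).

Definition vsqint u := sqint u.1 /\ sqint u.2.

Lemma vdotC u v : vdot u v = vdot v u.
Proof. by rewrite /vdot (dotC u.1) (dotC u.2). Qed.

Lemma vdot_lin a u v w : vsqint u -> vsqint v -> vsqint w ->
  vdot (a *: u + v) w = a * vdot u w + vdot v w.
Proof.
move=> [u1 u2] [v1 v2] [w1 w2]; rewrite /vdot.
have E1 : (a *: u + v).1 = (fun x => a * u.1 x + v.1 x) by [].
have E2 : (a *: u + v).2 = (fun x => a * u.2 x + v.2 x) by [].
rewrite E1 E2 !dotDl ?dotZl//; [ring|exact: sqintZ|exact: sqintZ].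
Qed.

Lemma vdotBl u v w : vsqint u -> vsqint v -> vsqint w ->
  vdot (u - v) w = vdot u w - vdot v w.
Proof.
move=> su sv sw; have := vdot_lin (-1) sv su sw.
by rewrite scaleN1r addrC => ->; ring.
Qed.

Lemma vsqint_lin a u v : vsqint u -> vsqint v -> vsqint (a *: u + v).
Proof. by move=> [u1 u2] [v1 v2]; split; apply: sqintD => //; exact: sqintZ. Qed.

Lemma vdot_ge0 u : 0 <= vdot u u. Proof. by rewrite addr_ge0 ?dot_ge0. Qed.

Lemma vnorm2_ge0 u : 0 <= vnorm2 u. Proof. exact: sqrtr_ge0. Qed.

Lemma vnorm2_sqr u : vnorm2 u ^+ 2 = vdot u u.
Proof. by rewrite sqr_sqrtr ?vdot_ge0. Qed.

Lemma vdot_CS u v : vsqint u -> vsqint v -> `|vdot u v| <= vnorm2 u * vnorm2 v.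
Proof.
move=> [u1 u2] [v1 v2]; apply: discriminant_le; try exact: vdot_ge0.
move=> t; exact: quadratic_add (dot_quadratic t u1 v1) (dot_quadratic t u2 v2).
Qed.

Lemma vnorm2_triangle u v : vsqint u -> vsqint v -> vnorm2 u <= vnorm2 v + vnorm2 (u - v).
Proof.
move=> su sv; rewrite -(@ler_pXn2r _ 2)// ?nnegrE ?addr_ge0 ?vnorm2_ge0//.
have sd : vsqint (u - v) by have := vsqint_lin (-1) sv su; rewrite scaleN1r addrC.
have E : u = (u - v) + v by rewrite subrK.
have Ed w : vsqint w -> vdot u w = vdot (u - v) w + vdot v w.
  by move=> sw; rewrite vdotBl//; ring.
have -> : vnorm2 u ^+ 2 = vdot (u - v) (u - v) + 2 * vdot (u - v) v + vdot v v.
  rewrite vnorm2_sqr Ed// (vdotC _ u) (vdotC _ u) !Ed// (vdotC v (u - v)); ring.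
rewrite sqrrD !vnorm2_sqr.
have := le_trans (ler_norm _) (vdot_CS sd sv); lra.
Qed.

Lemma H1_sqint phi : H1 phi -> sqint phi.
Proof. by move=> [[/L2per_sqint]]. Qed.

Lemma H1v_vsqint u : H1v u -> vsqint u.
Proof. by move=> [/H1_sqint ? /H1_sqint ?]. Qed.

Lemma H1_wD e phi : axis e -> H1 phi -> is_weak_derivative e phi (wD e phi).
Proof.
by move=> [->|->] [_ g1 g2]; [exact: (getPex g1)|exact: (getPex g2)].
Qed.

Lemma weak_derivative_trig e phi g : is_weak_derivative e phi g -> trig_weak e phi g.
Proof.
move=> [/L2per_sqint sg wg]; split=> // psi /trig_regular[Cpsi _ _]; exact: wg.
Qed.

Lemma trig_weak_wD e phi : axis e -> H1 phi -> trig_weak e phi (wD e phi).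
Proof. by move=> ee /(H1_wD ee)/weak_derivative_trig. Qed.

Lemma sqint_wD e phi : axis e -> H1 phi -> sqint (wD e phi).
Proof. by move=> ee /(trig_weak_wD ee)[]. Qed.

(** [wD] picks a representative, so that linearity holds only up to a null set; paired
    with a square integrable function it is an equality. *)
Lemma dot_wD_lin e a phi psi h : axis e -> H1 phi -> H1 psi -> H1 (a *: phi + psi) ->
  sqint h -> dot (wD e (a *: phi + psi)) h = a * dot (wD e phi) h + dot (wD e psi) h.
Proof.
move=> ee hp hq hs sh.
have wp := trig_weak_wD ee hp; have wq := trig_weak_wD ee hq.
have wl := trig_weak_lin ee a (H1_sqint hp) (H1_sqint hq) wp wq.
rewrite (weak_derivative_unique ee (trig_weak_wD ee hs) wl sh).
have sp := sqint_wD ee hp; have sq := sqint_wD ee hq.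
rewrite dotDl ?dotZl//; exact: sqintZ.
Qed.

Lemma dot_wD_null e phi h : axis e -> H1 phi -> sqint h -> dot phi phi = 0 ->
  dot (wD e phi) h = 0.
Proof.
move=> ee hp sh p0; have [sw wp] := trig_weak_wD ee hp.
apply: (dot_orthogonal_trig ee) => // psi tp; apply/eqP; rewrite -oppr_eq0 -wp//.
by rewrite (dot0_null (H1_sqint hp) _ p0)//; exact: trig_sqint (trig_derive ee tp).
Qed.

Lemma gdotC phi psi : gdot phi psi = gdot psi phi.
Proof. by rewrite /gdot vdotC. Qed.

Lemma grad_vsqint phi : H1 phi -> vsqint (grad phi).
Proof. by move=> hp; split; [exact: sqint_wD axis_e1 hp|exact: sqint_wD axis_e2 hp]. Qed.

Lemma gdot_lin a phi psi chi : H1 phi -> H1 psi -> H1 (a *: phi + psi) -> H1 chi ->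
  gdot (a *: phi + psi) chi = a * gdot phi chi + gdot psi chi.
Proof.
move=> hp hq hs hc.
have E1 := dot_wD_lin axis_e1 hp hq hs (sqint_wD axis_e1 hc).
have E2 := dot_wD_lin axis_e2 hp hq hs (sqint_wD axis_e2 hc).
exact: etrans (f_equal2 +%R E1 E2) (linear_add2 _ _ _ _ _).
Qed.

Lemma vgdotC u v : vgdot u v = vgdot v u.
Proof. by rewrite /vgdot (gdotC u.1) (gdotC u.2). Qed.

Lemma vgdot_lin a u v w : H1v u -> H1v v -> H1v (a *: u + v) -> H1v w ->
  vgdot (a *: u + v) w = a * vgdot u w + vgdot v w.
Proof.
move=> [u1 u2] [v1 v2] [s1 s2] [w1 w2].
have E1 := gdot_lin u1 v1 s1 w1; have E2 := gdot_lin u2 v2 s2 w2.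
exact: etrans (f_equal2 +%R E1 E2) (linear_add2 _ _ _ _ _).
Qed.

Lemma gdot_ge0 phi : 0 <= gdot phi phi. Proof. exact: vdot_ge0. Qed.
Lemma vgdot_ge0 u : 0 <= vgdot u u. Proof. by rewrite addr_ge0 ?gdot_ge0. Qed.
Lemma gnorm_ge0 phi : 0 <= Defs.gnorm phi. Proof. exact: sqrtr_ge0. Qed.
Lemma vgnorm_ge0 u : 0 <= vgnorm u. Proof. exact: sqrtr_ge0. Qed.
Lemma gnorm_sqr phi : Defs.gnorm phi ^+ 2 = gdot phi phi.
Proof. by rewrite sqr_sqrtr ?gdot_ge0. Qed.
Lemma vgnorm_sqr u : vgnorm u ^+ 2 = vgdot u u.
Proof. by rewrite sqr_sqrtr ?vgdot_ge0. Qed.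

Lemma vgdot_CS u v : H1v u -> H1v v -> `|vgdot u v| <= vgnorm u * vgnorm v.
Proof.
move=> [u1 u2] [v1 v2]; apply: discriminant_le; try exact: vgdot_ge0.
have [g1 g1'] := grad_vsqint u1; have [g2 g2'] := grad_vsqint u2.
have [h1 h1'] := grad_vsqint v1; have [h2 h2'] := grad_vsqint v2.
move=> t; have Q1 := quadratic_add (dot_quadratic t g1 h1) (dot_quadratic t g1' h1').
have Q2 := quadratic_add (dot_quadratic t g2 h2) (dot_quadratic t g2' h2').
exact: quadratic_add Q1 Q2.
Qed.

Lemma divergence_lin a u v q : H1v u -> H1v v -> H1v (a *: u + v) -> sqint q ->
  dot (divergence (a *: u + v)) q = a * dot (divergence u) q + dot (divergence v) q.
Proof.
move=> hu hv hs sq; have [u1 u2] := hu; have [v1 v2] := hv; have [s1 s2] := hs.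
have D w : H1v w -> dot (divergence w) q = dot (wD e1 w.1) q + dot (wD e2 w.2) q.
  by move=> [w1 w2]; exact: dotDl (sqint_wD axis_e1 w1) (sqint_wD axis_e2 w2) sq.
rewrite (D _ hs) (D _ hu) (D _ hv).
have E1 := dot_wD_lin axis_e1 u1 v1 s1 sq; have E2 := dot_wD_lin axis_e2 u2 v2 s2 sq.
exact: etrans (f_equal2 +%R E1 E2) (linear_add2 _ _ _ _ _).
Qed.

Lemma L2per_sub phi psi : L2per phi -> L2per psi -> L2per (fun x => phi x - psi x).
Proof.
move=> pp pq; have [m1 q1 _] := pp; have [m2 q2 _] := pq.
have [ms is_] := sqintB (L2per_sqint pp) (L2per_sqint pq).
split=> // x; have [-> ->] := q1 x; by have [-> ->] := q2 x.
Qed.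

(** Test the definition against the constant 1. *)
Lemma trig_weak_mean e phi g : trig_weak e phi g -> dot g (cst 1) = 0.
Proof.
move=> [sg /(_ _ (trig_cst e (1 : R)))]; have -> : dot phi (fun x => 'D_e (cst 1 : sfield R) x) = 0.
  transitivity (\int[area]_(x in @Omega R) (0 : R))%R.
    by apply: eq_Rintegral => x _; rewrite derive_cst mulr0.
  by rewrite Rintegral_cst ?mul0r//; exact: mOmega.
by move=> /esym/eqP; rewrite oppr_eq0 => /eqP.
Qed.

Lemma dot_cst1 phi : dot phi (cst 1) = (\int[area]_(x in Omega) phi x)%R.
Proof. by apply: eq_Rintegral => x _; rewrite /= mulr1. Qed.

Lemma curl_L2 u : H1v u -> L2 (curl u).
Proof.
move=> [u1 u2].
have [p2 _] := H1_wD axis_e1 u2; have [p1 _] := H1_wD axis_e2 u1.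
have m2 := trig_weak_mean (trig_weak_wD axis_e1 u2).
have m1 := trig_weak_mean (trig_weak_wD axis_e2 u1).
split; first exact: L2per_sub p2 p1.
have s0 : sqint (cst 1 : sfield R) by exact: trig_sqint (trig_cst e1 (1 : R)).
rewrite -dot_cst1.
have E := dotBl (L2per_sqint p2) (L2per_sqint p1) s0.
exact: etrans E (etrans (f_equal2 (fun x y => x - y) m2 m1) (subrr 0)).
Qed.

(** Cauchy-Schwarz for the rotated field (d2, - d1), which has the same norm. *)
Lemma rotated_pair_le (g1 g2 d1 d2 : sfield R) :
  sqint g1 -> sqint g2 -> sqint d1 -> sqint d2 ->
  `|dot g1 d2 - dot g2 d1| <= vnorm2 (g1, g2) * vnorm2 (d1, d2).
Proof.
move=> sg1 sg2 sd1 sd2.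
have sd1' := sqintZ (-1) sd1.
have := @vdot_CS (g1, g2) (d2, fun x => (-1) * d1 x) (conj sg1 sg2) (conj sd2 sd1').
rewrite /vdot /= dotZr// mulN1r => /le_trans; apply.
rewrite ler_wpM2l ?vnorm2_ge0// /vnorm2 /vdot /= dotZl// dotZr//.
by rewrite !mulN1r opprK addrC.
Qed.

Lemma curl_dot_le g chi : vsqint g -> H1 chi -> `|curl_dot g chi| <= vnorm2 g * Defs.gnorm chi.
Proof.
move=> [g1 g2] hc; exact: (rotated_pair_le g1 g2 (sqint_wD axis_e1 hc) (sqint_wD axis_e2 hc)).
Qed.

Lemma transport_skew2 (u1 u2 chi d1u1 d2u2 d1c d2c : sfield R) M : 0 <= M ->
  sqint u1 -> sqint u2 -> sqint chi ->
  trig_weak e1 u1 d1u1 -> trig_weak e2 u2 d2u2 ->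
  trig_weak e1 chi d1c -> trig_weak e2 chi d2c ->
  ae_bounded M u1 -> ae_bounded M u2 -> ae_bounded M chi ->
  dot (fun x => u1 x * d1c x + u2 x * d2c x) chi
  + 2^-1 * dot (fun x => (d1u1 x + d2u2 x) * chi x) chi = 0.
Proof.
move=> M0 su1 su2 sc w1 w2 c1 c2 b1 b2 bc.
have T1 := transport_skew axis_e1 M0 su1 sc w1 c1 b1 bc.
have T2 := transport_skew axis_e2 M0 su2 sc w2 c2 b2 bc.
have bnd f g : sqint f -> ae_bounded M f -> sqint g -> sqint (fun x => f x * g x).
  by move=> [mf _] bf sg; exact: (mul_ae_bounded mf M0 bf sg).1.
have bnd' f g : sqint g -> ae_bounded M g -> sqint f -> sqint (fun x => f x * g x).
  by move=> sg bg sf; have := bnd _ _ sg bg sf; congr sqint; apply: funext => x; rewrite mulrC.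
rewrite (dotDl (bnd _ _ su1 b1 c1.1) (bnd _ _ su2 b2 c2.1) sc).
have -> : (fun x => (d1u1 x + d2u2 x) * chi x) = (fun x => d1u1 x * chi x + d2u2 x * chi x).
  by apply: funext => x; rewrite mulrDl.
rewrite (dotDl (bnd' _ _ sc bc w1.1) (bnd' _ _ sc bc w2.1) sc).
lra.
Qed.

(** The skew-symmetric part of the transport term is built so as to vanish on the
    diagonal.  The sup bounds are what finite element functions satisfy by Agmon's
    inequality; they make every product square integrable. *)
Lemma bstar_skew u chi M : 0 <= M -> H1v u -> H1 chi ->
  ae_bounded M u.1 -> ae_bounded M u.2 -> ae_bounded M chi ->
  bstar u chi chi = 0.
Proof.
move=> M0 [u1 u2] hc b1 b2 bc.
exact: (transport_skew2 M0 (H1_sqint u1) (H1_sqint u2) (H1_sqint hc) (trig_weak_wD axis_e1 u1)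
  (trig_weak_wD axis_e2 u2) (trig_weak_wD axis_e1 hc) (trig_weak_wD axis_e2 hc) b1 b2 bc).
Qed.

Lemma vmag_bounded M u : ae_bounded M (vmag u) -> ae_bounded M u.1 /\ ae_bounded M u.2.
Proof.
have le1 x : `|u.1 x| <= `|vmag u x|.
  rewrite [leRHS]ger0_norm ?sqrtr_ge0// -sqrtr_sqr ler_sqrt ?lerDl ?sqr_ge0//.
  by rewrite addr_ge0 ?sqr_ge0.
have le2 x : `|u.2 x| <= `|vmag u x|.
  rewrite [leRHS]ger0_norm ?sqrtr_ge0// -sqrtr_sqr ler_sqrt ?lerDr ?sqr_ge0//.
  by rewrite addr_ge0 ?sqr_ge0.
move=> [N [mN N0 NS]]; split; exists N; split=> // x nx; apply: NS => h; apply: nx => Ox.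
  exact: le_trans (le1 x) (h Ox).
exact: le_trans (le2 x) (h Ox).
Qed.

(** Pointwise, the field [cross chi u] is orthogonal to [u], and its product with [w] is
    [chi] times the cross product of [u] and [w], at most |chi| |u| |w|. *)
Lemma cross_le M u w chi : 0 <= M -> ae_bounded M (vmag u) ->
  vsqint u -> vsqint w -> sqint chi ->
  vdot (cross chi u) u = 0 /\
  `|vdot (cross chi u) w| <= norm2 chi * (M * vnorm2 w).
Proof.
move=> M0 bu [s1 s2] [w1 w2] sc; have [b1 b2] := vmag_bounded bu.
have bnd f g : sqint f -> ae_bounded M f -> sqint g -> sqint (fun x => f x * g x).
  by move=> [mf _] bf sg; exact: (mul_ae_bounded mf M0 bf sg).1.
have s2c := bnd _ _ s2 b2 sc; have s1c := bnd _ _ s1 b1 sc.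
have cE v : vsqint v -> vdot (cross chi u) v =
    dot (fun x => u.1 x * chi x) v.2 - dot (fun x => u.2 x * chi x) v.1.
  move=> [v1 v2]; rewrite /vdot /cross /=.
  have -> : (fun x => - u.2 x * chi x) = (fun x => (-1) * (u.2 x * chi x)).
    by apply: funext => x; ring.
  by rewrite dotZl//; ring.
split.
  rewrite cE//; apply/eqP; rewrite subr_eq0; apply/eqP.
  by apply: eq_Rintegral => x _; ring.
have u1w2 := bnd _ _ s1 b1 w2; have u2w1 := bnd _ _ s2 b2 w1.
have sd := sqintB u1w2 u2w1.
have -> : vdot (cross chi u) w = dot chi (fun x => u.1 x * w.2 x - u.2 x * w.1 x).
  rewrite cE// dotBr//; congr (_ - _); apply: eq_Rintegral => x _; ring.
apply: le_trans (dot_CS sc sd) _; rewrite ler_wpM2l ?norm2_ge0//.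
have sM1 := sqintZ M w1; have sM2 := sqintZ M w2.
have -> : M * vnorm2 w = Num.sqrt (\int[area]_(x in Omega) ((M * w.1 x) ^+ 2 + (M * w.2 x) ^+ 2))%R.
  rewrite (RintegralD (mu := area)); last 3 first.
  - exact: mOmega.
  - exact: sM1.2.
  - exact: sM2.2.
  have E f : sqint f -> (\int[area]_(x in Omega) ((M * f x) ^+ 2))%R = M ^+ 2 * dot f f.
    move=> sf; rewrite expr2 -mulrA -(dotZl M sf sf) -(dotZr M sf (sqintZ M sf)).
    by apply: eq_Rintegral => x _; rewrite expr2.
  by rewrite !E// -mulrDr sqrtrM ?sqr_ge0// sqrtr_sqr ger0_norm.
have iS : area.-integrable Omega (EFin \o (fun x => (M * w.1 x) ^+ 2 + (M * w.2 x) ^+ 2)).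
  exact: (integrableD (mu := area) mOmega sM1.2 sM2.2).
rewrite ler_sqrt; last by apply: Rintegral_ge0 => x _; rewrite addr_ge0 ?sqr_ge0.
rewrite /dot /Rintegral.
under [X in fine X <= _]eq_integral do rewrite -expr2.
apply: fine_le.
- exact: (integrable_fin_num (mu := area) mOmega sd.2).
- exact: (integrable_fin_num (mu := area) mOmega iS).
apply: (ae_ge0_le_integral (mu := area)).
- exact: mOmega.
- by move=> x _; rewrite lee_fin sqr_ge0.
- by apply/measurable_EFinP; apply: measurable_funTS; apply: measurable_funX; case: sd.
- by move=> x _; rewrite lee_fin addr_ge0 ?sqr_ge0.
- by move/integrableP : iS => [].
- case: bu => N [mN N0 NS]; exists N; split=> // x nx; apply: NS => bx.
  apply: nx => Ox; rewrite lee_fin.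
  have := bx Ox; rewrite ger0_norm ?sqrtr_ge0// => vM.
  have vM2 : u.1 x ^+ 2 + u.2 x ^+ 2 <= M ^+ 2.
    rewrite -(@sqr_sqrtr _ (u.1 x ^+ 2 + u.2 x ^+ 2)) ?addr_ge0 ?sqr_ge0//.
    by rewrite lerXn2r// nnegrE sqrtr_ge0.
  have w0 : 0 <= w.1 x ^+ 2 + w.2 x ^+ 2 by rewrite addr_ge0 ?sqr_ge0.
  have := ler_wpM2r w0 vM2.
  have := sqr_ge0 (u.1 x * w.1 x + u.2 x * w.2 x).
  lra.
Qed.

End Fields.

(** * Point values of the forcing *)

Section Forcing.
Context {R : realType}.

Lemma halflineE (t : R) : halfline t = (0 < t) :> Prop.
Proof. by rewrite /halfline /= in_itv /= andbT. Qed.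

Lemma lebesgue_halfline_gt0 : (0 < lebesgue_measure (@halfline R))%E.
Proof. rewrite /halfline lebesgue_measure_itv /= ltry oppr0 addye// ltry. Qed.

Lemma time_LinfP (g : R -> R) (c : \bar R) :
  (time_Linf g <= c)%E <-> {ae lebesgue_measure, forall t, 0 < t -> (`|g t|%:E <= c)%E}.
Proof.
apply: (iff_trans (Linf_mrestrP (mu := lebesgue_measure) (@measurable_halfline R) _ _ lebesgue_halfline_gt0)).
have E : (fun t => halfline t -> (`|(EFin \o g) t| <= c)%E) = (fun t => 0 < t -> (`|g t|%:E <= c)%E).
  by apply: funext => t; rewrite halflineE.
by split; move=> [N [mN N0 NS]]; exists N; split=> // t; [rewrite -E|rewrite E]; exact: NS.
Qed.

Lemma time_Linf_ge0 (g : R -> R) : (0 <= time_Linf g)%E.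
Proof. exact: Lnorm_ge0. Qed.

Lemma time_Linf_ae (g : R -> R) : (time_Linf g < +oo)%E ->
  {ae lebesgue_measure, forall t, 0 < t -> `|g t| <= fine (time_Linf g)}.
Proof.
move=> fin; have fn : time_Linf g \is a fin_num by rewrite ge0_fin_numE// time_Linf_ge0.
have /time_LinfP[N [mN N0 NS]] := lexx (time_Linf g).
exists N; split=> // t nt; apply: NS => h; apply: nt => t0.
by rewrite -lee_fin fineK//; exact: h.
Qed.

(** A property that holds at almost every time holds at some time where the forcing is
    close to its sampled value, since such times are not negligible. *)
Lemma essential_value_near (f : R -> vfield R) (s eps : R) (Q : R -> Prop) :
  essential_value f s -> 0 < eps -> {ae lebesgue_measure, forall t, 0 < t -> Q t} ->
  exists t, [/\ 0 < t, Q t & vnorm2 (f t - f s) < eps].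
Proof.
move=> fs e0 [N [mN N0 NS]]; apply: contrapT => no.
apply: (fs _ e0); exists N; split=> // t [t0 lt]; apply: NS => h.
by apply: no; exists t; split=> //; exact: h.
Qed.

Lemma dot_subC (a b : sfield R) :
  dot (fun x => a x - b x) (fun x => a x - b x) = dot (fun x => b x - a x) (fun x => b x - a x).
Proof. by apply: eq_Rintegral => x _; ring. Qed.

Lemma vnorm2_subC (u v : vfield R) : vnorm2 (u - v) = vnorm2 (v - u).
Proof.
rewrite /vnorm2; congr Num.sqrt.
exact: (f_equal2 (fun x y : R => x + y) (dot_subC u.1 v.1) (dot_subC u.2 v.2)).
Qed.

Lemma vgdot_null (u v : vfield R) : H1v u -> H1v v -> vdot u u = 0 -> vgdot u v = 0.
Proof.
move=> [u1 u2] [v1 v2] u0.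
have := dot_ge0 u.1; have := dot_ge0 u.2; rewrite /vdot in u0 => g2 g1.
have d1 : dot u.1 u.1 = 0 by lra.
have d2 : dot u.2 u.2 = 0 by lra.
have E11 := dot_wD_null axis_e1 u1 (sqint_wD axis_e1 v1) d1.
have E12 := dot_wD_null axis_e2 u1 (sqint_wD axis_e2 v1) d1.
have E21 := dot_wD_null axis_e1 u2 (sqint_wD axis_e1 v2) d2.
have E22 := dot_wD_null axis_e2 u2 (sqint_wD axis_e2 v2) d2.
have add00 (x y : R) : x = 0 -> y = 0 -> x + y = 0 by move=> -> ->; rewrite addr0.
exact: add00 (add00 _ _ E11 E12) (add00 _ _ E21 E22).
Qed.

Lemma le_addeps (x y c : R) : 0 <= c -> (forall eps, 0 < eps -> x <= y + c * eps) -> x <= y.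
Proof.
move=> c0 H; rewrite -subr_le0; apply: (@eps_le0 _ _ c) => // eps e0.
by rewrite lerBlDl; exact: H.
Qed.

Variables (f : R -> vfield R) (s : R).
Hypothesis Lf : LinfL2 f.
Hypothesis s0 : 0 < s.
Hypothesis ef : essential_value f s.

Let fL2 t : 0 < t -> vsqint (f t).
Proof. by case: Lf => _ _ H _ /H[[/L2per_sqint ? _] [/L2per_sqint ? _]]. Qed.

Let F := LinfL2_norm f.

Lemma LinfL2_norm_ge0 : 0 <= F.
Proof. by rewrite fine_ge0// time_Linf_ge0. Qed.

Lemma LinfL2_ae : {ae lebesgue_measure, forall t, 0 < t -> vnorm2 (f t) <= F}.
Proof.
have [_ _ _ fin] := Lf; have [N [mN N0 NS]] := time_Linf_ae fin.
exists N; split=> // t nt; apply: NS => h; apply: nt => t0.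
by have := h t0; rewrite ger0_norm ?vnorm2_ge0.
Qed.

Lemma essential_value_le : vnorm2 (f s) <= F.
Proof.
apply: (@le_addeps _ _ 1) => // eps e0; rewrite mul1r.
have [t [t0 Ft lt]] := essential_value_near ef e0 LinfL2_ae.
have := vnorm2_triangle (fL2 s0) (fL2 t0).
rewrite (vnorm2_subC (f s)); lra.
Qed.

Variables (Vh : set (vfield R)) (lambda : R).
Hypothesis lambda0 : 0 < lambda.
Hypothesis VH1 : Vh `<=` H1v.
Hypothesis pc : forall v, Vh v -> vnorm2 v <= lambda * vgnorm v.

Let quot_le (g : vfield R) (v : vfield R) : vsqint g -> Vh v -> vnorm2 v != 0 ->
  `|vdot g v / vgnorm v| <= lambda * vnorm2 g.
Proof.
move=> sg hv v0; have sv := H1v_vsqint (VH1 hv).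
have vp : 0 < vnorm2 v by rewrite lt_neqAle eq_sym v0 vnorm2_ge0.
have gp : 0 < vgnorm v.
  by rewrite -(pmulr_rgt0 _ lambda0); exact: lt_le_trans vp (pc hv).
rewrite normrM normfV (ger0_norm (vgnorm_ge0 v)) ler_pdivrMr//.
apply: le_trans (vdot_CS sg sv) _.
by rewrite mulrAC mulrC ler_wpM2r ?vnorm2_ge0//; exact: pc.
Qed.

Lemma dual_norm_le (g : vfield R) : vsqint g -> `|dual_norm Vh g| <= lambda * vnorm2 g.
Proof.
move=> sg; rewrite /dual_norm; set S := [set _ | _ in _].
have B x : S x -> `|x| <= lambda * vnorm2 g by move=> [v [hv v0] <-]; exact: quot_le.
have [->|/set0P[x Sx]] := eqVneq S set0.
  by rewrite sup0 normr0 mulr_ge0 ?vnorm2_ge0// ltW.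
have hs : has_sup S.
  split; first by exists x.
  by exists (lambda * vnorm2 g) => y /B; exact: le_trans (ler_norm _).
rewrite ler_norml; apply/andP; split.
  apply: (@le_trans _ _ x); first by have := B _ Sx; rewrite ler_norml => /andP[].
  by apply: sup_upper_bound.
by apply: ge_sup; [exists x|move=> y /B; exact: le_trans (ler_norm _)].
Qed.

(** The supremum runs over fields of nonzero norm; a null field contributes nothing on
    either side because its gradient is null as well. *)
Lemma dual_norm_ge (g v : vfield R) : vsqint g -> Vh v ->
  vdot g v <= dual_norm Vh g * vgnorm v.
Proof.
move=> sg hv; have sv := H1v_vsqint (VH1 hv).
have [v0|v0] := eqVneq (vnorm2 v) 0.
  have := vdot_CS sg sv; rewrite v0 mulr0 normr_le0 => /eqP ->.
  have v00 : vdot v v = 0 by rewrite -vnorm2_sqr v0 expr0n.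
  by rewrite /vgnorm (vgdot_null (VH1 hv) (VH1 hv) v00) sqrtr0 mulr0.
have vp : 0 < vnorm2 v by rewrite lt_neqAle eq_sym v0 vnorm2_ge0.
have gp : 0 < vgnorm v.
  by rewrite -(pmulr_rgt0 _ lambda0); exact: lt_le_trans vp (pc hv).
rewrite -ler_pdivrMr//; apply: sup_upper_bound; last by exists v.
split; first by exists (vdot g v / vgnorm v); exists v.
exists (lambda * vnorm2 g) => _ [w [hw w0] <-].
exact: le_trans (ler_norm _) (quot_le sg hw w0).
Qed.

Let D := LinfVh_norm Vh f.

(** By the Poincare inequality, the dual norm is bounded by the L2 norm at every time. *)
Lemma time_Linf_dual : (time_Linf (fun t => dual_norm Vh (f t)) <= (lambda * F)%:E)%E.
Proof.
apply/time_LinfP; have [N [mN N0 NS]] := LinfL2_ae.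
exists N; split=> // t nt; apply: NS => h; apply: nt => t0; rewrite lee_fin.
apply: le_trans (dual_norm_le (fL2 t0)) _.
by rewrite ler_wpM2l ?h// ltW.
Qed.

Lemma LinfVh_norm_ge0 : 0 <= D.
Proof. by rewrite fine_ge0// time_Linf_ge0. Qed.

Lemma LinfVh_norm_le : D <= lambda * F.
Proof.
rewrite -lee_fin fineK ?time_Linf_dual// ge0_fin_numE ?time_Linf_ge0//.
exact: le_lt_trans time_Linf_dual (ltry _).
Qed.

(** The pairing with [v] satisfies the bound at times whose forcing is close to the
    sampled one, and replacing them by the sampled time costs |v| times the L2
    distance. *)
Lemma essential_value_dual v : Vh v -> vdot (f s) v <= D * vgnorm v.
Proof.
move=> hv; have sv := H1v_vsqint (VH1 hv).
have fin : (time_Linf (fun t => dual_norm Vh (f t)) < +oo)%E.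
  exact: le_lt_trans time_Linf_dual (ltry _).
apply: (@le_addeps _ _ (vnorm2 v)); first exact: vnorm2_ge0.
move=> eps e0.
have [t [t0 Dt lt]] := essential_value_near ef e0 (time_Linf_ae fin).
have sd : vsqint (f s - f t) by have := vsqint_lin (-1) (fL2 t0) (fL2 s0); rewrite scaleN1r addrC.
have H := vdotBl (fL2 s0) (fL2 t0) sv.
have h1 := le_trans (ler_norm _) (vdot_CS sd sv).
have h2 := dual_norm_ge (fL2 t0) hv.
have h3 : dual_norm Vh (f t) * vgnorm v <= D * vgnorm v.
  by rewrite ler_wpM2r ?vgnorm_ge0// (le_trans (ler_norm _)).
have h4 : vnorm2 (f s - f t) * vnorm2 v <= eps * vnorm2 v.
  by rewrite ler_wpM2r ?vnorm2_ge0// vnorm2_subC ltW.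
lra.
Qed.

End Forcing.

(** * Energy estimates for one time step *)

(** The algebra of the three tests, over real numbers that stand for the pairings: no
    step of it looks into the integrals of chosen representatives. *)
Section StepArithmetic.
Variables (R : realFieldType) (d nu : R).
Hypothesis d0 : 0 < d.

Lemma clear_dt (t c p n q : R) : 1 / d * t + c - p + n = q ->
  t + d * c - d * p + d * n = d * q.
Proof. by move=> <-; field; rewrite gt_eqF. Qed.

Lemma energy_step (t c p n gv x y a b e D : R) :
  t + d * c - d * p + d * (nu * n) = d * gv -> p = 0 -> c = 0 -> t = x - y ->
  y <= a * b -> b ^+ 2 = x -> e ^+ 2 = n -> gv <= D * e ->
  b ^+ 2 + nu * d * e ^+ 2 <= a * b + d * D * e.
Proof.
move=> E p0 c0 Et le_ Eb Ee ge_; rewrite p0 c0 Et in E; rewrite Eb Ee.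
have L : d * gv <= d * (D * e) by rewrite ler_pM2l.
by lra.
Qed.

Lemma gradient_step (t c p n gv x y x1 y1 a2 a b e B D : R) :
  t + d * c - d * p + d * (nu * n) = d * gv -> p = 0 -> `|c| <= B -> t = x - y ->
  x = x1 -> y = y1 -> a2 = n -> y1 <= b * a -> e ^+ 2 = a2 -> b ^+ 2 = x1 ->
  gv <= D * e ->
  b ^+ 2 + nu * d * e ^+ 2 <= a * b + d * D * e + d * B.
Proof.
move=> E p0 cB Et Ex Ey En le_ Ee Eb ge_; rewrite p0 Et Ex Ey -En in E; rewrite Eb Ee.
have L : d * gv <= d * (D * e) by rewrite ler_pM2l.
have : d * - c <= d * B by rewrite ler_pM2l// (le_trans (ler_norm _))// normrN.
by lra.
Qed.

Lemma vorticity_step (t s n gv x y a b e F : R) :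
  1 / d * t + s + nu * n = gv -> s = 0 -> t = x - y ->
  y <= a * b -> b ^+ 2 = x -> e ^+ 2 = n -> gv <= F * e ->
  b ^+ 2 + nu * d * e ^+ 2 <= a * b + d * F * e.
Proof.
move=> E s0 Et le_ Eb Ee ge_; rewrite s0 addr0 in E; rewrite Eb Ee.
have L : d * gv <= d * (F * e) by rewrite ler_pM2l.
have : t + d * (nu * n) = d * gv by rewrite -E; field; rewrite gt_eqF.
by lra.
Qed.

End StepArithmetic.

Section Scheme.
Context {R : realType}.

Lemma fe_vspace_span (N : nat) (T : mesh R N) (S : set (vfield R)) : fe_vspace T S ->
  exists (n : nat) (b : 'I_n -> vfield R),
    S = [set u | exists c : 'I_n -> R, u = \sum_i c i *: b i].
Proof.
move=> [n [b [_ ->]]]; exists n, b.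
have E (c : 'I_n -> R) : ((fun x => \sum_i c i * (b i).1 x, fun x => \sum_i c i * (b i).2 x) : vfield R) =
    \sum_i c i *: b i.
  elim: (index_enum 'I_n) => [|i s IH].
    by rewrite big_nil; congr pair; apply: funext => x; rewrite big_nil.
  by rewrite big_cons -IH; congr pair; apply: funext => x; rewrite big_cons.
by apply/seteqP; split=> u [c ->]; exists c; rewrite E.
Qed.

Variables (N : nat) (T : mesh R N) (Xh : set (vfield R)) (Qh : set (sfield R)).
Hypothesis feX : fe_vspace T Xh.
Hypothesis XH1 : Xh `<=` H1v.
Hypothesis QL2 : Qh `<=` L2.
Let Vh := discrete_div_free Xh Qh.

Lemma div_free_H1v : Vh `<=` H1v. Proof. by move=> v [/XH1]. Qed.

Let Q_sqint q : Qh q -> sqint q. Proof. by move=> /QL2[/L2per_sqint]. Qed.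

Lemma fe_lin a u v : Xh u -> Xh v -> Xh (a *: u + v).
Proof.
have [n [b ->]] := fe_vspace_span feX; move=> [c ->] [d ->].
exists (fun i => a * c i + d i); rewrite scaler_sumr -big_split.
by apply: eq_bigr => i _; rewrite scalerDl scalerA.
Qed.

Lemma div_free_lin a u v : Vh u -> Vh v -> Vh (a *: u + v).
Proof.
move=> [Xu du] [Xv dv]; have Xs := fe_lin a Xu Xv; split; first exact: Xs.
move=> q hq; have E := divergence_lin (XH1 Xu) (XH1 Xv) (XH1 Xs) (Q_sqint hq).
have Z : a * 0 + 0 = 0 :> R by rewrite mulr0 addr0.
exact: etrans E (etrans (f_equal2 (fun s t => a * s + t) (du q hq) (dv q hq)) Z).
Qed.

Lemma fe0 : Xh 0.
Proof.
have [n [b ->]] := fe_vspace_span feX; exists (fun=> 0).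
by rewrite big1// => i _; rewrite scale0r.
Qed.

Lemma div_free0 : Vh 0.
Proof.
split; first exact: fe0.
move=> q hq; have Xs := fe_lin (-1) fe0 fe0.
have E := divergence_lin (XH1 fe0) (XH1 fe0) (XH1 Xs) (Q_sqint hq).
have z : -1 *: 0 + 0 = 0 :> vfield R by rewrite scaler0 addr0.
have Z (t : R) : -1 * t + t = 0 by rewrite mulN1r addNr.
exact: etrans (f_equal (fun v => dot (divergence v) q) (esym z)) (etrans E (Z _)).
Qed.

Lemma vgdot_linr phi : H1v phi -> forall a u v, Vh u -> Vh v ->
  vgdot phi (a *: u + v) = a * vgdot phi u + vgdot phi v.
Proof.
move=> hphi a u v Vu Vv; have Vs := div_free_lin a Vu Vv.
have E := vgdot_lin (div_free_H1v Vu) (div_free_H1v Vv) (div_free_H1v Vs) hphi.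
have Eu := vgdotC u phi; have Ev := vgdotC v phi; have Es := vgdotC phi (a *: u + v).
exact: (etrans Es (etrans E (f_equal2 (fun s t => a * s + t) Eu Ev))).
Qed.

Lemma vgdot_nullr phi : H1v phi -> forall u, Vh u -> vdot u u = 0 -> vgdot phi u = 0.
Proof.
move=> hphi u Vu u0; have E := vgdot_null (div_free_H1v Vu) hphi u0.
exact: (etrans (vgdotC phi u) E).
Qed.

Lemma discrete_stokesP phi : H1v phi ->
  Vh (discrete_stokes Vh phi) /\
  forall v, Vh v -> vdot (discrete_stokes Vh phi) v = vgdot phi v.
Proof.
move=> hphi; have sV v : Vh v -> vsqint v by move=> Vv; exact: H1v_vsqint (div_free_H1v Vv).
have lL := vgdot_linr hphi; have ln := vgdot_nullr hphi.
rewrite /discrete_stokes; move: (vgdot phi) lL ln => l lL ln.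
have [n [b Xb]] := fe_vspace_span feX.
have Vspan v : Vh v -> exists c : 'I_n -> R, v = \sum_i c i *: b i by move=> [Xv _]; rewrite Xb in Xv.
have BL a u v w : Vh u -> Vh v -> Vh w -> vdot (a *: u + v) w = a * vdot u w + vdot v w.
  by move=> Vu Vv Vw; exact: (vdot_lin a (sV _ Vu) (sV _ Vv) (sV _ Vw)).
have BC u v : Vh u -> Vh v -> vdot u v = vdot v u by move=> _ _; exact: vdotC.
have B0 u : Vh u -> 0 <= vdot u u by move=> _; exact: vdot_ge0.
have E := @riesz R (vfield R) Vh vdot l 'I_n b div_free0 div_free_lin Vspan BC BL B0 lL ln.
exact: (@getPex _ [set a | Vh a /\ forall v, Vh v -> vdot a v = l v] E).
Qed.

Section Step.
Variables (nu dt : R) (U U0 : vfield R) (P w : sfield R) (g : vfield R).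
Hypothesis dt0 : 0 < dt.
Hypothesis VU : Vh U.
Hypothesis VU0 : Vh U0.
Hypothesis QP : Qh P.
Hypothesis sw : sqint w.
Hypothesis sg : vsqint g.
Hypothesis momentum : forall v, Xh v ->
  1 / dt * vdot (U - U0) v + vdot (cross w U) v
  - dot P (divergence v) + nu * vgdot U v = vdot g v.
Variable M : R.
Hypothesis M0 : 0 <= M.
Hypothesis bU : ae_bounded M (vmag U).

Let HU : H1v U. Proof. exact: div_free_H1v VU. Qed.
Let HU0 : H1v U0. Proof. exact: div_free_H1v VU0. Qed.
Let sU : vsqint U. Proof. exact: H1v_vsqint. Qed.
Let sU0 : vsqint U0. Proof. exact: H1v_vsqint. Qed.

Lemma velocity_energy D : vdot g U <= D * vgnorm U ->
  vnorm2 U ^+ 2 + nu * dt * vgnorm U ^+ 2 <= vnorm2 U0 * vnorm2 U + dt * D * vgnorm U.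
Proof.
move=> gD; have [XU dU] := VU.
have B := clear_dt dt0 (momentum XU).
have p0 : dot P (divergence U) = 0 by exact: etrans (dotC _ _) (dU P QP).
have [c0 _] := cross_le M0 bU sU sU sw.
have Et := vdotBl sU sU0 sU.
have cs := le_trans (ler_norm _) (vdot_CS sU0 sU).
have nU := vnorm2_sqr U; have gU := vgnorm_sqr U.
exact: (energy_step dt0 B p0 c0 Et cs nU gU gD).
Qed.

Let A := discrete_stokes Vh U.
Let VA : Vh A. Proof. by have [] := discrete_stokesP HU. Qed.
Let sA : vsqint A. Proof. exact: H1v_vsqint (div_free_H1v VA). Qed.
Let EA v : Vh v -> vdot A v = vgdot U v.
Proof. by have [_] := discrete_stokesP HU; exact. Qed.

(** Test with the discrete Stokes image [A] of [U].  By its definition, (U - U0, A) is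
    the pairing of grad U with the gradient of the increment, and the viscous term is
    the squared norm of [A]. *)
Lemma velocity_gradient F : vnorm2 g <= F ->
  vgnorm U ^+ 2 + nu * dt * vnorm2 A ^+ 2 <=
  vgnorm U0 * vgnorm U + dt * F * vnorm2 A + dt * (norm2 w * (M * vnorm2 A)).
Proof.
move=> gF; have [XA dA] := VA.
have B := clear_dt dt0 (momentum XA).
have p0 : dot P (divergence A) = 0 by exact: etrans (dotC _ _) (dA P QP).
have [_ c0] := cross_le M0 bU sU sA sw.
have Et := vdotBl sU sU0 sA.
have E1 : vdot U A = vgdot U U := etrans (vdotC U A) (EA VU).
have E0 : vdot U0 A = vgdot U U0 := etrans (vdotC U0 A) (EA VU0).
have E2 := EA VA.
have cs := le_trans (ler_norm _) (vgdot_CS HU HU0).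
have nA := vnorm2_sqr A; have gU := vgnorm_sqr U.
have gA := le_trans (le_trans (ler_norm _) (vdot_CS sg sA)) (ler_wpM2r (vnorm2_ge0 A) gF).
exact: (gradient_step dt0 B p0 c0 Et E1 E0 E2 cs nA gU gA).
Qed.

(** |grad U|^2 = (A, U), so the gradient is interpolated between the velocity and its
    discrete Stokes image. *)
Lemma gradient_le_stokes : vgnorm U ^+ 2 <= vnorm2 U * vnorm2 A.
Proof.
have E1 : vdot U A = vgdot U U := etrans (vdotC U A) (EA VU).
have cs := le_trans (ler_norm _) (vdot_CS sU sA).
have gU := vgnorm_sqr U.
have L (x y z : R) : x = y -> y <= z -> x <= z by move=> ->.
exact: (L _ _ _ (etrans gU (esym E1)) cs).
Qed.

End Step.

Lemma vorticity_energy (nu dt M F : R) (U g : vfield R) (w w0 : sfield R) :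
  0 < dt -> 0 <= M -> H1v U -> H1 w -> sqint w0 ->
  ae_bounded M U.1 -> ae_bounded M U.2 -> ae_bounded M w ->
  vsqint g -> vnorm2 g <= F ->
  1 / dt * dot (w - w0) w + bstar U w w + nu * gdot w w = curl_dot g w ->
  norm2 w ^+ 2 + nu * dt * Defs.gnorm w ^+ 2 <= norm2 w0 * norm2 w + dt * F * Defs.gnorm w.
Proof.
move=> dt0 M0 HU Hw sw0 b1 b2 bw sg gF B.
have sw := H1_sqint Hw.
have s0 := bstar_skew M0 HU Hw b1 b2 bw.
have Et := dotBl sw sw0 sw.
have cs := le_trans (ler_norm _) (dot_CS sw0 sw).
have nw := norm2_sqr w; have gw := gnorm_sqr w.
have gA := le_trans (le_trans (ler_norm _) (curl_dot_le sg Hw)) (ler_wpM2r (gnorm_ge0 w) gF).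
exact: (vorticity_step dt0 B s0 Et cs nw gw gA).
Qed.

End Scheme.

(** * Scaling and conclusion *)

(** The change of unknowns G = lambda g, A = lambda^2 q, X = (lambda / nu) x,
    Y = (lambda^2 / nu) y turns the Poincare constant and the viscosity into 1, with
    kappa = nu dt / lambda^2 as the only remaining parameter. *)
Section Scaling.
Context {R : realType}.
Variables (nu dt lambda K L F D : R) (a g q x y : nat -> R).
Hypotheses (nu0 : 0 < nu) (dt0 : 0 < dt) (lambda0 : 0 < lambda) (K0 : 0 < K) (L0 : 0 <= L).
Hypotheses (F0 : 0 <= F) (D0 : 0 <= D) (DF : D <= lambda * F).
Hypothesis a0 : forall k, 0 <= a k.
Hypothesis ag : forall k, a k <= lambda * g k.
Hypothesis q0 : forall k, 0 <= q k.
Hypothesis gaq : forall k, g k.+1 ^+ 2 <= a k.+1 * q k.+1.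
Hypothesis x0 : forall k, 0 <= x k.
Hypothesis xy : forall k, x k.+1 <= lambda * y k.+1.
Hypothesis energy : forall k,
  a k.+1 ^+ 2 + nu * dt * g k.+1 ^+ 2 <= a k * a k.+1 + dt * D * g k.+1.
Hypothesis vorticity : forall k,
  x k.+1 ^+ 2 + nu * dt * y k.+1 ^+ 2 <= x k * x k.+1 + dt * F * y k.+1.
Hypothesis agmon : forall k, g k.+1 ^+ 2 + nu * dt * q k.+1 ^+ 2 <=
  g k * g k.+1 + dt * F * q k.+1 +
  dt * (x k * (K * Num.sqrt (a k.+1) * Num.sqrt (q k.+1) * q k.+1)).
Hypothesis inverse : forall k, g k.+1 ^+ 2 + nu * dt * q k.+1 ^+ 2 <=
  g k * g k.+1 + dt * F * q k.+1 +
  dt * (x k * (K * Num.sqrt L * g k.+1 * q k.+1)).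

Let kappa := nu * lambda ^- 2 * dt.
Let alpha := 1 + kappa.
Let r := lambda / nu.

Let kappa0 : 0 < kappa. Proof. by rewrite !mulr_gt0// invr_gt0 exprn_gt0. Qed.
Let alpha0 : 0 < alpha. Proof. by rewrite addr_gt0. Qed.
Let r0 : 0 < r. Proof. exact: divr_gt0. Qed.
Let lw := ltW lambda0.
Let nw := ltW nu0.
Let aw := ltW alpha0.
Let l0 : lambda != 0. Proof. by rewrite gt_eqF. Qed.
Let n0 : nu != 0. Proof. by rewrite gt_eqF. Qed.

Variables (C : R) (n : nat).
Hypothesis n_gt0 : (0 < n)%N.
Hypothesis C_cubic : 16 * 24 ^+ 3 * K ^+ 4 <= C.
Hypothesis C_linear : 576 * K ^+ 2 <= C.

Let s := (1 / alpha) ^+ n.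
Let C0 := s * a 0%N ^+ 2 + 2 * alpha * lambda ^+ 2 / nu ^+ 2 * D ^+ 2.
Let C1 := s * x 0%N ^+ 2 + 2 * alpha * lambda ^+ 2 / nu ^+ 2 * F ^+ 2.

Let s0 : 0 <= s. Proof. by rewrite exprn_ge0// divr_ge0// ltW. Qed.
Let C0_ge0 : 0 <= C0.
Proof. by rewrite addr_ge0// mulr_ge0 ?divr_ge0 ?mulr_ge0 ?sqr_ge0// mulr_ge0. Qed.
Let C1_ge0 : 0 <= C1.
Proof. by rewrite addr_ge0// mulr_ge0 ?divr_ge0 ?mulr_ge0 ?sqr_ge0// mulr_ge0. Qed.

Let G k := lambda * g k.
Let A k := lambda ^+ 2 * q k.
Let X k := r * x k.
Let Y k := lambda * r * y k.

Let Phi0 : 0 <= lambda * D / nu. Proof. by rewrite divr_ge0// mulr_ge0. Qed.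
Let PhiF : lambda * D / nu <= lambda ^+ 2 * F / nu.
Proof. by rewrite ler_pM2r ?invr_gt0// expr2 -mulrA ler_pM2l. Qed.
Let phi0 : 0 <= r ^+ 2 * F. Proof. by rewrite mulr_ge0// sqr_ge0. Qed.
Let A0 k : 0 <= A k. Proof. by rewrite mulr_ge0// sqr_ge0. Qed.
Let X0 k : 0 <= X k. Proof. by rewrite mulr_ge0// ltW. Qed.
Let GaA k : G k.+1 ^+ 2 <= a k.+1 * A k.+1.
Proof.
have -> : a k.+1 * A k.+1 = lambda ^+ 2 * (a k.+1 * q k.+1) by rewrite /A; ring.
by rewrite exprMn ler_pM2l ?exprn_gt0.
Qed.
Let XY k : X k.+1 <= Y k.+1.
Proof. by rewrite /Y (mulrC lambda) -mulrA ler_pM2l. Qed.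
Let energyS k : a k.+1 ^+ 2 + kappa * G k.+1 ^+ 2 <=
  a k * a k.+1 + kappa * (lambda * D / nu) * G k.+1.
Proof.
have -> : kappa * G k.+1 ^+ 2 = nu * dt * g k.+1 ^+ 2 by rewrite /kappa /G; field.
have -> : kappa * (lambda * D / nu) * G k.+1 = dt * D * g k.+1.
  by rewrite /kappa /G; field; rewrite n0 l0.
exact: energy.
Qed.
Let vorticityS k : X k.+1 ^+ 2 + kappa * Y k.+1 ^+ 2 <=
  X k * X k.+1 + kappa * (r ^+ 2 * F) * Y k.+1.
Proof.
have -> : X k.+1 ^+ 2 + kappa * Y k.+1 ^+ 2 = r ^+ 2 * (x k.+1 ^+ 2 + nu * dt * y k.+1 ^+ 2).
  by rewrite /kappa /X /Y; field.
have -> : X k * X k.+1 + kappa * (r ^+ 2 * F) * Y k.+1 =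
    r ^+ 2 * (x k * x k.+1 + dt * F * y k.+1).
  by rewrite /kappa /X /Y /r; field; rewrite n0 l0.
by rewrite ler_pM2l ?exprn_gt0.
Qed.

Let gradientS (c z z' : R) k :
  g k.+1 ^+ 2 + nu * dt * q k.+1 ^+ 2 <=
    g k * g k.+1 + dt * F * q k.+1 + dt * (x k * (c * z * q k.+1)) ->
  z' = lambda * z ->
  G k.+1 ^+ 2 + kappa * A k.+1 ^+ 2 <=
  G k * G k.+1 + kappa * (lambda ^+ 2 * F / nu) * A k.+1 +
  kappa * (c * X k) * z' * A k.+1.
Proof.
rewrite -(ler_pM2l (exprn_gt0 2 lambda0)) => H ->.
apply: le_trans (_ : lambda ^+ 2 * (g k.+1 ^+ 2 + nu * dt * q k.+1 ^+ 2) <= _).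
  by rewrite le_eqVlt; apply/orP; left; apply/eqP; rewrite /kappa /G /A; field.
apply: le_trans H _; rewrite le_eqVlt; apply/orP; left; apply/eqP.
by rewrite /kappa /G /A /X /r; field; rewrite n0 l0.
Qed.

Let C1S : s * X 0%N ^+ 2 + 2 * alpha * (r ^+ 2 * F) ^+ 2 = r ^+ 2 * C1.
Proof. by rewrite /X /C1 /r; field. Qed.
Let C0S : s * a 0%N ^+ 2 + 2 * alpha * (lambda * D / nu) ^+ 2 = C0.
Proof. by rewrite /C0; field. Qed.

Lemma gradient_bound_agmon : g n ^+ 2 <= s * g 0%N ^+ 2 +
  (2 * nu^-1 * F ^+ 2 + C * nu ^- 3 * C1 ^+ 2 * C0) * (alpha * lambda ^+ 2 / nu).
Proof.
have gr k : G k.+1 ^+ 2 + kappa * A k.+1 ^+ 2 <=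
    G k * G k.+1 + kappa * (lambda ^+ 2 * F / nu) * A k.+1 +
    kappa * (K * X k) * (Num.sqrt (a k.+1) * Num.sqrt (A k.+1)) * A k.+1.
  apply: (@gradientS K (Num.sqrt (a k.+1) * Num.sqrt (q k.+1))).
    by rewrite (mulrA K); exact: agmon.
  by rewrite /A sqrtrM ?sqr_ge0// sqrtr_sqr gtr0_norm// mulrCA.
have := gradient_cubic kappa0 (ltW K0) Phi0 PhiF phi0 a0 ag A0 GaA X0 XY energyS
  vorticityS gr n_gt0.
rewrite -/alpha -/s => H.
rewrite -(ler_pM2l (exprn_gt0 2 lambda0)).
have E : lambda ^+ 2 * g n ^+ 2 = G n ^+ 2 by rewrite exprMn.
rewrite E; apply: le_trans H _; rewrite C1S C0S.
have le : 16 * 24 ^+ 3 * K ^+ 4 * (alpha * (r ^+ 2 * C1) ^+ 2 * C0) <=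
    C * (alpha * (r ^+ 2 * C1) ^+ 2 * C0).
  by rewrite ler_wpM2r// mulr_ge0// mulr_ge0 ?sqr_ge0// ltW.
apply: le_trans (lerD (lexx _) le) _; rewrite le_eqVlt; apply/orP; left; apply/eqP.
by rewrite /G /r; field; rewrite n0.
Qed.

Lemma gradient_bound_inverse : g n ^+ 2 <= s * g 0%N ^+ 2 +
  2 * (alpha * lambda ^+ 2 / nu ^+ 2) * F ^+ 2 + C * L * nu ^- 2 * C1 * C0.
Proof.
have gr k : G k.+1 ^+ 2 + kappa * A k.+1 ^+ 2 <=
    G k * G k.+1 + kappa * (lambda ^+ 2 * F / nu) * A k.+1 +
    kappa * (K * Num.sqrt L * X k) * G k.+1 * A k.+1.
  by apply: (@gradientS (K * Num.sqrt L) (g k.+1)) => //; exact: inverse.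
have c0 : 0 <= K * Num.sqrt L by rewrite mulr_ge0 ?sqrtr_ge0// ltW.
have := gradient_linear kappa0 c0 Phi0 PhiF phi0 a0 ag A0 GaA X0 XY energyS
  vorticityS n_gt0 gr.
rewrite -/alpha -/s => H.
rewrite -(ler_pM2l (exprn_gt0 2 lambda0)).
have E : lambda ^+ 2 * g n ^+ 2 = G n ^+ 2 by rewrite exprMn.
rewrite E; apply: le_trans H _; rewrite C1S C0S [(K * _) ^+ 2]exprMn sqr_sqrtr//.
have le : 576 * K ^+ 2 * (L * (r ^+ 2 * C1) * C0) <= C * (L * (r ^+ 2 * C1) * C0).
  by rewrite ler_wpM2r// mulr_ge0// mulr_ge0// mulr_ge0// sqr_ge0.
have -> : 576 * (K ^+ 2 * L) * (r ^+ 2 * C1) * C0 = 576 * K ^+ 2 * (L * (r ^+ 2 * C1) * C0).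
  by ring.
apply: le_trans (lerD (lexx _) le) _; rewrite le_eqVlt; apply/orP; left; apply/eqP.
by rewrite /G /r; field; rewrite n0.
Qed.

End Scaling.

Theorem theorem3p2 (R : realType) (K : R) (K_gt0 : 0 < K) :
  exists2 C : R, 0 < C &
  forall (lambda : R) (N : nat) (T : mesh R N) (sigma beta : R)
    (Xh : set (vfield R)) (Qh Yh : set (sfield R)),
  let h := mesh_size T in
  let Vh := discrete_div_free Xh Qh in
  0 < lambda -> poincare lambda ->
  periodic_triangulation T -> 0 < sigma -> shape_regular sigma T ->
  fe_vspace T Xh -> fe_space T Qh -> fe_space T Yh ->
  Xh `<=` H1v -> Qh `<=` L2 -> Yh `<=` H1 ->
  0 < beta -> inf_sup beta Xh Qh ->
  agmon_inequalities K Vh Yh -> inverse_inequality K h Xh ->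
  forall (nu dt : R) (f : R -> vfield R) (u0 : vfield R)
    (Iu : vfield R -> vfield R) (Iw : sfield R -> sfield R)
    (u : nat -> vfield R) (P w : nat -> sfield R),
  0 < nu -> 0 < dt ->
  LinfL2 f ->
  (forall m : nat, (0 < m)%N -> essential_value f (m%:R * dt)) ->
  H1v u0 ->
  (forall v, H1v v -> Xh (Iu v)) -> (forall g, L2 g -> Yh (Iw g)) ->
  Vh (Iu u0) ->
  velocity_vorticity_solution Xh Qh Yh nu dt f (Iu u0) (Iw (curl u0)) u P w ->
  forall n : nat, (0 < n)%N ->
  let alpha := 1 + nu * lambda ^- 2 * dt in
  let F := LinfL2_norm f in
  let C0sq := (1 / alpha) ^+ n * vnorm2 (u 0%N) ^+ 2
              + 2 * alpha * lambda ^+ 2 / nu ^+ 2 * LinfVh_norm Vh f ^+ 2 in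
  let C1sq := (1 / alpha) ^+ n * norm2 (w 0%N) ^+ 2
              + 2 * alpha * lambda ^+ 2 / nu ^+ 2 * F ^+ 2 in
  vgnorm (u n) ^+ 2 <=
    (1 / alpha) ^+ n * vgnorm (u 0%N) ^+ 2
    + (2 * nu^-1 * F ^+ 2 + C * nu ^- 3 * C1sq ^+ 2 * C0sq)
      * (alpha * lambda ^+ 2 / nu)
  /\
  vgnorm (u n) ^+ 2 <=
    (1 / alpha) ^+ n * vgnorm (u 0%N) ^+ 2
    + 2 * (alpha * lambda ^+ 2 / nu ^+ 2) * F ^+ 2
    + C * (1 + `|ln h|) * nu ^- 2 * C1sq * C0sq.

Proof.
(* the constants of the two recursions, with the power of the Agmon or inverse constant *)
exists (16 * 24 ^+ 3 * K ^+ 4 + 576 * K ^+ 2).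
  have pos m : (0 < m)%N -> 0 < m%:R :> R by rewrite ltr0n.
  exact: (addr_gt0 (mulr_gt0 (mulr_gt0 (pos 16 erefl) (exprn_gt0 3 (pos 24 erefl)))
    (exprn_gt0 4 K_gt0)) (mulr_gt0 (pos 576 erefl) (exprn_gt0 2 K_gt0))).
move=> lambda N T sigma beta Xh Qh Yh h Vh lambda0 [poincare_v poincare_s] _ _ _ feX _ _
  XH1 QL2 YH1 _ _ [agmon_V agmon_Y] inv nu dt f u0 Iu Iw u P w nu0 dt0 Lf ef hu0 _ YIw VIu
  [u_0 w_0 step] n n0.
have L0 : 0 <= 1 + `|ln h| by rewrite addr_ge0.
have Sup_ge0 t : 0 <= K * Num.sqrt t by rewrite mulr_ge0 ?sqrtr_ge0// ltW.
have Agmon_ge0 s t : 0 <= K * Num.sqrt s * Num.sqrt t by rewrite mulr_ge0 ?sqrtr_ge0.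
have cubic_le : 16 * 24 ^+ 3 * K ^+ 4 <= 16 * 24 ^+ 3 * K ^+ 4 + 576 * K ^+ 2.
  by rewrite lerDl mulr_ge0 ?ler0n// sqr_ge0.
have linear_le : 576 * K ^+ 2 <= 16 * 24 ^+ 3 * K ^+ 4 + 576 * K ^+ 2.
  by rewrite lerDr !mulr_ge0 ?ler0n ?exprn_ge0// ltW.
have Xu k : Xh (u k.+1) := let: And5 (conj x _) _ _ _ _ := step k in x.
have QP k : Qh (P k.+1) := let: And5 (conj _ x) _ _ _ _ := step k in x.
have momentum k := let: And5 _ x _ _ _ := step k in x.
have incompressible k := let: And5 _ _ x _ _ := step k in x.
have transport k := let: And5 _ _ _ yw x := step k in x _ yw.
have Vu k : Vh (u k).
  case: k => [|k]; first by rewrite u_0; exact: VIu.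
  exact: (conj (Xu k) (incompressible k)).
have Yw k : Yh (w k).
  case: k => [|k]; first by rewrite w_0; exact: YIw (curl_L2 hu0).
  exact: (let: And5 _ _ _ x _ := step k in x).
have VH1 := div_free_H1v (Qh := Qh) XH1.
have Hu k : H1v (u k) := VH1 _ (Vu k).
have Hw k : H1 (w k) := YH1 _ (Yw k).
have sw k := H1_sqint (Hw k).
have pV v (Vv : Vh v) : vnorm2 v <= lambda * vgnorm v := poincare_v _ (VH1 _ Vv).
have F0 := LinfL2_norm_ge0 f; have D0 := LinfVh_norm_ge0 f Vh.
have DF := LinfVh_norm_le Lf lambda0 VH1 pV.
have t0 k : 0 < k.+1%:R * dt by rewrite mulr_gt0// ltr0n.
have ek k : essential_value f (k.+1%:R * dt) := ef k.+1 erefl.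
have fF k := essential_value_le Lf (t0 k) (ek k).
have fD k := essential_value_dual Lf (t0 k) (ek k) lambda0 VH1 pV (Vu k.+1).
have sf k : vsqint (f (k.+1%:R * dt)).
  have [_ _ fL2 _] := Lf; have [[f1 _] [f2 _]] := fL2 _ (t0 k).
  exact: (conj (L2per_sqint f1) (L2per_sqint f2)).
have bA k := Lp_norm_ae (agmon_V (u k.+1) (Vu k.+1)).
have bI k := Lp_norm_ae (inv (u k.+1) (Xu k)).
have bw k := Lp_norm_ae (let: And3 x _ _ := agmon_Y (w k.+1) (Yw k.+1) in x).
have MA k := Agmon_ge0 (vnorm2 (u k.+1)) (vnorm2 (discrete_stokes Vh (u k.+1))).
have MI k := mulr_ge0 (Sup_ge0 (1 + `|ln h|)) (vgnorm_ge0 (u k.+1)).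
have energy k := velocity_energy XH1 dt0 (Vu k.+1) (Vu k) (QP k) (sw k) (momentum k)
  (MA k) (bA k) (fD k).
have gA k := velocity_gradient feX XH1 QL2 dt0 (Vu k.+1) (Vu k) (QP k) (sw k) (sf k)
  (momentum k) (MA k) (bA k) (fF k).
have gI k := velocity_gradient feX XH1 QL2 dt0 (Vu k.+1) (Vu k) (QP k) (sw k) (sf k)
  (momentum k) (MI k) (bI k) (fF k).
have gs k := gradient_le_stokes feX XH1 QL2 (Vu k.+1).
have vorticity k : norm2 (w k.+1) ^+ 2 + nu * dt * Defs.gnorm (w k.+1) ^+ 2 <=
    norm2 (w k) * norm2 (w k.+1) + dt * LinfL2_norm f * Defs.gnorm (w k.+1).
  (* velocity and vorticity each satisfy an Agmon bound; the sum bounds both *)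
  set M1 := K * Num.sqrt (vnorm2 (u k.+1)) * Num.sqrt (vnorm2 (discrete_stokes Vh (u k.+1))).
  set M2 := K * Num.sqrt (norm2 (w k.+1)) *
    Num.sqrt (norm2 (discrete_laplacian Yh (w k.+1))).
  have M10 : 0 <= M1 := MA k.
  have M20 : 0 <= M2 by exact: Agmon_ge0.
  have le1 : M1 <= M1 + M2 by rewrite lerDl.
  have le2 : M2 <= M1 + M2 by rewrite lerDr.
  have [b1 b2] := vmag_bounded (bA k).
  exact: (vorticity_energy dt0 (addr_ge0 M10 M20) (Hu k.+1) (Hw k.+1) (sw k)
    (ae_boundedW le1 b1) (ae_boundedW le1 b2) (ae_boundedW le2 (bw k)) (sf k) (fF k)
    (transport k)).
have ag k := pV (u k) (Vu k).
have xy k := poincare_s _ (Hw k.+1).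
have a0 k := vnorm2_ge0 (u k); have x0 k := norm2_ge0 (w k).
have q0 k := vnorm2_ge0 (discrete_stokes Vh (u k)).
pose a k := vnorm2 (u k); pose g k := vgnorm (u k).
pose q k := vnorm2 (discrete_stokes Vh (u k)).
pose x k := norm2 (w k); pose y k := Defs.gnorm (w k).
have B1 := gradient_bound_agmon (a := a) (g := g) (q := q) (x := x) (y := y) nu0 dt0 lambda0 K_gt0 F0 D0 DF a0 ag q0 gs x0 xy energy
  vorticity gA n0 cubic_le.
have B2 := gradient_bound_inverse (a := a) (g := g) (q := q) (x := x) (y := y) nu0 dt0 lambda0 K_gt0 L0 F0 D0 DF a0 ag q0 gs x0 xy energy
  vorticity gI n0 linear_le.
exact: (conj B1 B2).
Qed.
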